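(* For every positive integer $n$, let $D_n$ be the graph obtained from the $n$-vertex path by adding, for each of its two endpoints $u$, two new adjacent vertices $u', u''$ both adjacent to $u$; let $\mathcal H := \{D_n : n \geqslant 1\}$. If for every $\varepsilon > 0$ \textsc{Mutually Induced $\mathcal H$-Packing} admits a polynomial-time $n^{\varepsilon}$-approximation algorithm on $n$-vertex graphs of bounded twin-width given with a 4-sequence, then for every $\varepsilon > 0$ \textsc{Longest Path} admits a polynomial-time $n^{\varepsilon}$-approximation algorithm on general $n$-vertex graphs.
   Context: \textsc{Mutually Induced $\mathcal H$-Packing}: given a graph $G$, find $S \subseteq V(G)$ such that $G[S]$ is a disjoint union of graphs each isomorphic to a member of $\mathcal H$, maximizing $|S|$. \textsc{Longest Path}: find a path in $G$ with the maximum number of edges. An $r$-approximation algorithm outputs a feasible solution of value at least the optimum divided by $r$. A trigraph consists of a vertex set together with two disjoint sets of unordered pairs of vertices: black edges and red edges. Contracting two (not necessarily adjacent) vertices $u,v$ of a trigraph into a new vertex $w$ produces the trigraph in which, for every other vertex $z$, $wz$ is a black edge if $uz$ and $vz$ were both black edges, $wz$ is a non-edge if $uz$ and $vz$ were both neither black nor red edges, and $wz$ is a red edge otherwise. A $d$-sequence of an $n$-vertex graph $G$ is a sequence of trigraphs $G=G_n,\ldots,G_1$ where $G_1$ has one vertex, each $G_i$ is obtained from $G_{i+1}$ by one contraction, and in every $G_i$ every vertex is incident to at most $d$ red edges. *)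

(* Defs.v *)
From HB Require Import structures.
From mathcomp Require Import all_boot all_order all_algebra finmap.
From mathcomp Require Import reals exp.
Set Implicit Arguments.
Unset Strict Implicit.
Unset Printing Implicit Defensive.
Import Order.TTheory GRing.Theory Num.Theory.
Local Open Scope nat_scope.

(** * Graphs *)

Record sgraph (V : finType) := SGraph {
  edge :> rel V;
  edge_sym : symmetric edge;
  edge_irr : irreflexive edge }.

Definition isomorphic (V W : finType) (G : sgraph V) (H : sgraph W) : Prop :=
  exists2 f : V -> W, bijective f & forall x y, H (f x) (f y) = G x y.

Section Induced.
Variables (V : finType) (G : sgraph V) (S : {set V}).

Definition induced_rel : rel {x | x \in S} := fun x y => G (val x) (val y).

Lemma induced_sym : symmetric induced_rel.
Proof. by move=> x y; apply: edge_sym. Qed.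

Lemma induced_irr : irreflexive induced_rel.
Proof. by move=> x; apply: edge_irr. Qed.

Definition induced : sgraph {x | x \in S} := SGraph induced_sym induced_irr.
End Induced.

(** [inl i] is the [i]-th vertex of the path; [inr (b, _)] are the two vertices
    added for its first ([b = false]) or last ([b = true]) vertex. For [n = 1]
    the two endpoints coincide and [D 1] is two triangles sharing a vertex. *)
Section D.
Variable n : nat.

Definition D_rel : rel ('I_n + bool * bool)%type := fun x y =>
  match x, y with
  | inl i, inl j => (i.+1 == j) || (j.+1 == i)
  | inl i, inr (b, _) | inr (b, _), inl i => i == (if b then n.-1 else 0) :> nat
  | inr (b, c), inr (b', c') => (b == b') && (c != c')
  end.

Lemma D_sym : symmetric D_rel.
Proof.
move=> [i|[b c]] [j|[b' c']] //=; first by rewrite orbC.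
by rewrite eq_sym (eq_sym c).
Qed.

Lemma D_irr : irreflexive D_rel.
Proof. by move=> [i|[b c]] /=; rewrite ?eqn_leq ?ltnn ?eqxx ?andbF. Qed.

Definition D : sgraph ('I_n + bool * bool)%type := SGraph D_sym D_irr.
End D.

(** A class of graphs, seen up to isomorphism. *)
Definition graph_class := forall V : finType, sgraph V -> Prop.

Definition D_class : graph_class := fun V G =>
  exists2 n, 0 < n & isomorphic G (D n).

(** [G[S]] is the disjoint union of the graphs [G[A]], [A] ranging over [P]. *)
Definition induced_packing (H : graph_class) (V : finType) (G : sgraph V)
    (S : {set V}) : Prop :=
  exists P : {set {set V}},
    [/\ partition P S,
        forall A B : {set V}, A \in P -> B \in P -> A != B ->
          {in A & B, forall x y, ~~ G x y}
      & forall A : {set V}, A \in P -> H _ (induced G A)].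

Definition is_path (V : finType) (G : sgraph V) (s : seq V) : Prop :=
  [/\ s != [::], uniq s & sorted G s].

Definition path_length (V : finType) (s : seq V) : nat := (size s).-1.

(** * Trigraphs and contraction sequences *)

Record trigraph := Trigraph {
  tverts : {fset nat};
  tblack : rel nat;
  tred : rel nat;
  tblack_verts : forall x y, tblack x y -> (x \in tverts) && (y \in tverts);
  tred_verts : forall x y, tred x y -> (x \in tverts) && (y \in tverts);
  tblack_sym : symmetric tblack;
  tred_sym : symmetric tred;
  tblack_irr : irreflexive tblack;
  tred_irr : irreflexive tred;
  tdisjoint : forall x y, ~~ (tblack x y && tred x y) }.

Definition tadj (T : trigraph) : rel nat := fun x y => tblack T x y || tred T x y.

Definition red_degree (T : trigraph) (x : nat) : nat :=
  #|` [fset y in tverts T | tred T x y]%fset |.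

Section Contract.
Variables (T : trigraph) (u v w : nat).

Definition contract_verts : {fset nat} := (w |` (tverts T `\` [fset u; v]))%fset.

Definition new_black (z : nat) : bool := tblack T u z && tblack T v z.

Definition new_red (z : nat) : bool :=
  ~~ new_black z && ~~ (~~ tadj T u z && ~~ tadj T v z).

Definition contract_rel (new : pred nat) (old : rel nat) : rel nat := fun x y =>
  [&& x \in contract_verts, y \in contract_verts, x != y
    & if x == w then new y else if y == w then new x else old x y].

Lemma contract_rel_verts new old x y :
  contract_rel new old x y -> (x \in contract_verts) && (y \in contract_verts).
Proof. by case/and4P=> -> ->. Qed.

Lemma contract_rel_sym new old :
  symmetric old -> symmetric (contract_rel new old).
Proof.
move=> sym x y; rewrite /contract_rel andbCA (eq_sym y x).
case: (x =P y) => [->|ne] //=; rewrite ?(sym y x).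
by case: (x =P w) => [xw|_] //; case: (y =P w) => [yw|_] //; case: ne; rewrite xw.
Qed.

Lemma contract_rel_irr new old : irreflexive (contract_rel new old).
Proof. by move=> x; rewrite /contract_rel eqxx !andbF. Qed.

Lemma contract_disjoint x y :
  ~~ (contract_rel new_black (tblack T) x y && contract_rel new_red (tred T) x y).
Proof.
apply/negP=> /andP[/and4P[_ _ _ b] /and4P[_ _ _]].
by move: b; do 2?[case: ifP => _]; rewrite /new_red => b;
  rewrite ?b // => r; case/negP: (tdisjoint T x y); rewrite b.
Qed.

(** The contraction of [u] and [v] into the new vertex [w]. *)
Definition contract : trigraph := Trigraph
  (contract_rel_verts (new := new_black) (old := tblack T))
  (contract_rel_verts (new := new_red) (old := tred T))
  (contract_rel_sym new_black (@tblack_sym T))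
  (contract_rel_sym new_red (@tred_sym T))
  (contract_rel_irr new_black (tblack T))
  (contract_rel_irr new_red (tred T))
  contract_disjoint.
End Contract.

Section TrigraphOfGraph.
Variables (n : nat) (G : sgraph 'I_n).

Definition graph_verts : {fset nat} := [fset val i | i in 'I_n]%fset.

Definition graph_black : rel nat := fun x y =>
  [exists i : 'I_n, exists j : 'I_n, [&& x == i, y == j & G i j]].

Lemma graph_black_verts x y :
  graph_black x y -> (x \in graph_verts) && (y \in graph_verts).
Proof.
by case/existsP=> i /existsP[j /and3P[/eqP-> /eqP-> _]]; rewrite !in_imfset.
Qed.

Lemma graph_black_sym : symmetric graph_black.
Proof.
suff h x y : graph_black x y -> graph_black y x.
  by move=> x y; apply/idP/idP; apply: h.
case/existsP=> i /existsP[j /and3P[xi yj ij]].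
by apply/existsP; exists j; apply/existsP; exists i; rewrite xi yj edge_sym.
Qed.

Lemma graph_black_irr : irreflexive graph_black.
Proof.
move=> x; apply/negbTE/negP=> /existsP[i /existsP[j /and3P[/eqP-> /eqP/val_inj-> ]]].
by rewrite edge_irr.
Qed.

Definition trigraph_of_graph : trigraph := @Trigraph graph_verts
  graph_black (fun _ _ => false) graph_black_verts
  (fun x y (h : false) => False_ind _ (notF h))
  graph_black_sym (fun _ _ => erefl) graph_black_irr (fun _ => erefl)
  (fun x y => introN idP (fun h => notF (proj2 (andP h)))).
End TrigraphOfGraph.

(** A contraction sequence is given by the list of the contracted pairs;
    its [k]-th contraction ([k] starting from [0]) creates the vertex [n + k]. *)
Fixpoint d_sequence_from (d : nat) (T : trigraph) (w : nat)
    (cs : seq (nat * nat)) : bool :=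
  all (fun x => red_degree T x <= d) (tverts T) &&
  (if cs is (u, v) :: cs' then
     [&& u \in tverts T, v \in tverts T, u != v
       & d_sequence_from d (contract T u v w) w.+1 cs']
   else #|` tverts T| == 1).

Definition d_sequence (d n : nat) (G : sgraph 'I_n) (cs : seq (nat * nat)) : bool :=
  d_sequence_from d (trigraph_of_graph G) n cs.

(** * Algorithms *)

(** Unit-cost random access machines, presented as structured programs over
    arrays of natural numbers named by natural numbers. The arithmetic is limited
    to addition and truncated subtraction, so that in [t] steps the numbers only
    grow by [O(t)] bits; polynomial time thus agrees with that of
    Turing machines. *)
Inductive expr :=
  | Const of nat
  | Get of nat & expr
  | Add of expr & expr
  | Sub of expr & expr.

Inductive prog :=
  | Skip
  | Set_ of nat & expr & expr
  | Seq of prog & prog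
  | If of expr & prog & prog
  | While of expr & prog.

Definition memory := nat -> nat -> nat.

Definition update (m : memory) (a i x : nat) : memory := fun a' i' =>
  if (a' == a) && (i' == i) then x else m a' i'.

Fixpoint eval (m : memory) (e : expr) : nat :=
  match e with
  | Const k => k
  | Get a i => m a (eval m i)
  | Add e1 e2 => eval m e1 + eval m e2
  | Sub e1 e2 => eval m e1 - eval m e2
  end.

(** [exec c m t m']: started in memory [m], the program [c] halts in memory [m']
    after [t] steps. *)
Inductive exec : prog -> memory -> nat -> memory -> Prop :=
  | ExecSkip m : exec Skip m 1 m
  | ExecSet a i e m : exec (Set_ a i e) m 1 (update m a (eval m i) (eval m e))
  | ExecSeq c1 c2 m1 m2 m3 t1 t2 :
      exec c1 m1 t1 m2 -> exec c2 m2 t2 m3 -> exec (Seq c1 c2) m1 (t1 + t2) m3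
  | ExecIfTrue e c1 c2 m m' t :
      eval m e != 0 -> exec c1 m t m' -> exec (If e c1 c2) m t.+1 m'
  | ExecIfFalse e c1 c2 m m' t :
      eval m e = 0 -> exec c2 m t m' -> exec (If e c1 c2) m t.+1 m'
  | ExecWhileTrue e c m1 m2 m3 t1 t2 :
      eval m1 e != 0 -> exec c m1 t1 m2 -> exec (While e c) m2 t2 m3 ->
      exec (While e c) m1 (t1 + t2).+1 m3
  | ExecWhileFalse e c m : eval m e = 0 -> exec (While e c) m 1 m.

(** Array [0] holds the number of vertices in its cell [0], array [1] the
    adjacency matrix in row-major order; all the other cells are [0]. *)
Definition graph_input (n : nat) (G : sgraph 'I_n) : memory := fun a k =>
  match a with
  | 0 => if k == 0 then n else 0
  | 1 => [exists i : 'I_n, exists j : 'I_n, (k == i * n + j) && G i j]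
  | _ => 0
  end.

(** Arrays [2] and [3] hold the two components of the contracted pairs. *)
Definition graph_seq_input (n : nat) (G : sgraph 'I_n) (cs : seq (nat * nat)) :
    memory := fun a k =>
  match a with
  | 2 => (nth (0, 0) cs k).1
  | 3 => (nth (0, 0) cs k).2
  | _ => graph_input G a k
  end.

(** A set of vertices is output as its characteristic vector in array [1], a
    sequence as its size in cell [0] of array [0] and its entries in array [1]. *)
Definition output_set (n : nat) (m : memory) : {set 'I_n} :=
  [set v : 'I_n | m 1 v != 0].

Definition output_seq (m : memory) : seq nat := mkseq (m 1) (m 0 0).

(** * Approximation *)

Local Open Scope ring_scope.

(** [s] is feasible and its value is at least the optimum divided by [r]. *)
Definition approximate_solution (R : realType) (Sol : Type)
    (feasible : Sol -> Prop) (value : Sol -> nat) (r : R) (s : Sol) : Prop :=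
  feasible s /\
  forall s', feasible s' -> (value s')%:R / r <= (value s)%:R.

(** The running time is polynomial in the number [n] of vertices, which is
    polynomially related to the size of the input. *)
Definition packing_approximable (R : realType) (H : graph_class) (d : nat)
    (ratio : nat -> R) : Prop :=
  exists (c : prog) (k : nat),
    forall (n : nat) (G : sgraph 'I_n) (cs : seq (nat * nat)),
      d_sequence d G cs ->
      exists (t : nat) (m : memory),
        [/\ exec c (graph_seq_input G cs) t m,
            (t <= k * n ^ k + k)%N
          & approximate_solution (induced_packing H G)
              (fun S : {set 'I_n} => #|S|) (ratio n) (output_set n m)].

(** A path has at least one vertex, hence the restriction to nonempty graphs. *)
Definition longest_path_approximable (R : realType) (ratio : nat -> R) : Prop :=
  exists (c : prog) (k : nat),
    forall (n : nat) (G : sgraph 'I_n), (0 < n)%N ->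
      exists (t : nat) (m : memory) (s : seq 'I_n),
        [/\ exec c (graph_input G) t m,
            (t <= k * n ^ k + k)%N,
            output_seq m = map val s
          & approximate_solution (is_path G) (@path_length 'I_n) (ratio n) s].

(* Main.v *)
(** Longest Path on [G] reduces to a single packing instance. Every edge of [G] is
    replaced by two paths with [9 * n] inner vertices, and two hubs, each carrying a
    triangle, are joined to every vertex of [G] by paths of length two. The hubs are the
    only triangles, so a nonempty packing is one induced [D m] running from hub to hub:
    a path of [G] with [l] edges becomes a packing of [l * (9 * n + 1) + 9] vertices, and
    the additive constant is negligible against the ratio.

    For the 4-sequence, a caterpillar is obtained by zipping the long paths one after the
    other, vertex by vertex, onto [n] additional isolated vertices, the spine, the [i]-th
    of which is attached to the [i]-th vertex of [G]; the inner vertices of the path from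
    [i] to [j] walk along the spine from [i] to [j] and then wait. The remaining ladder is
    collapsed row by row. *)
Require Import Defs.
From HB Require Import structures.
From mathcomp Require Import all_boot all_order all_algebra finmap.
From mathcomp Require Import reals exp ring zify.
Set Implicit Arguments.
Unset Strict Implicit.
Unset Printing Implicit Defensive.
Import Order.TTheory GRing.Theory Num.Theory.
Local Open Scope nat_scope.

(** * Quotient trigraphs and contraction sequences *)

(** The hubs decide what is maximized: a packing could otherwise collect many short pieces, whereas
    a packing that must be connected measures a single path. The subdivision is what makes any path
    of $G$ usable as an induced one: a chord turns into a path whose inner vertices are simply not
    chosen.

    The bound 4 is reached during the zipping, at a vertex of the spine: it can have red edges to
    its two neighbours on the spine, to its vertex of $G$, and to the single path vertex that is
    next to be merged. This needs paths with at least [n] inner vertices, long enough to walk along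
    the spine from any [i] to any [j]. The factor 9 in their number comes from the ratio instead:
    besides its edges a packing has 9 vertices, namely the 6 of the hubs, the 2 that lead to them
    and the first vertex of the path.

    Indexing the long paths by ordered pairs gives each edge two copies. This makes the numbering of
    the gadget plain arithmetic in [n], and a packing may run along either copy, in either
    direction, so both have to be recognized when the path is read off. *)

Section Quotient.
Variables (N : nat) (G : sgraph 'I_N).

(** Only what bounds red degrees from above is recorded. A red edge needs an edge between the two
    fibres by [quotient_adj] and, since it is not black, also a non-edge by [quotient_black]. The
    exact colours are not tracked. *)
Record quotient (phi : 'I_N -> nat) (T : trigraph) : Prop := Quotient {
  quotient_verts : forall x, x \in tverts T <-> exists i, phi i = x;
  quotient_black : forall x y, x \in tverts T -> y \in tverts T -> x != y ->
    (forall i j, phi i = x -> phi j = y -> G i j) -> tblack T x y;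
  quotient_adj : forall x y, tadj T x y ->
    exists i j, [/\ phi i = x, phi j = y & G i j] }.

Lemma quotient_init : quotient val (trigraph_of_graph G).
Proof.
split=> [x|x y|x y].
- split=> [/imfsetP[i _ ->]|[i <-]]; first by exists i.
  exact: in_imfset.
- move=> /imfsetP[i _ ->] /imfsetP[j _ ->] _ h.
  by apply/existsP; exists i; apply/existsP; exists j; rewrite !eqxx h.
- rewrite /tadj /= orbF => /existsP[i /existsP[j /and3P[/eqP-> /eqP-> ij]]].
  by exists i, j.
Qed.

Lemma quotient_contract phi T u v w :
  quotient phi T -> u \in tverts T -> v \in tverts T -> u != v ->
  w \notin tverts T ->
  quotient (fun i => if (phi i == u) || (phi i == v) then w else phi i)
    (contract T u v w).
Proof.
move=> [vP bP aP] uT vT uv wT.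
have phiw i : (phi i == w) = false.
  by apply: contraNF wT => /eqP <-; apply/vP; exists i.
have inC x : (x \in contract_verts T u v w) = (x == w) || [&& x != u, x != v & x \in tverts T].
  by rewrite !inE negb_or -andbA.
split.
- move=> x /=; rewrite inC; split.
    case/orP => [/eqP->|/and3P[xu xv /vP[i ix]]].
      by case/vP: uT => i iu; exists i; rewrite iu eqxx.
    by exists i; rewrite ix (negbTE xu) (negbTE xv).
  move=> [i]; case: ifP => [_ <-|/norP[iu iv] <-]; first by rewrite eqxx.
  by rewrite iu iv /= (_ : _ \in _) ?orbT //; apply/vP; exists i.
- move=> x y /=; rewrite /contract_rel => xC yC xy h; rewrite xC yC xy /=.
  have old z : z \in contract_verts T u v w -> z != w ->
      [/\ z != u, z != v & z \in tverts T].
    by rewrite inC => /orP[-> //|/and3P[]].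
  case: (x =P w) => [xw|/eqP xw].
    case: (old y yC) => [|yu yv yT]; first by rewrite -xw eq_sym.
    rewrite /new_black !bP // 1?eq_sym // => i j ix jy; apply: h;
      by rewrite ?ix ?jy ?eqxx ?orbT //= ?(negbTE yu) ?(negbTE yv).
  case: (old x xC xw) => xu xv xT.
  case: (y =P w) => [yw|/eqP yw].
    rewrite /new_black !bP // 1?eq_sym // => i j ix jy; rewrite edge_sym; apply: h;
      by rewrite ?ix ?jy ?eqxx ?orbT //= ?(negbTE xu) ?(negbTE xv).
  case: (old y yC yw) => yu yv yT.
  apply: bP => // i j ix jy; apply: h;
    by rewrite ?ix ?jy ?(negbTE xu) ?(negbTE xv) ?(negbTE yu) ?(negbTE yv).
- have new z : z != u -> z != v -> new_black T u v z || new_red T u v z ->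
      exists i j, [/\ (if (phi i == u) || (phi i == v) then w else phi i) = w,
        (if (phi j == u) || (phi j == v) then w else phi j) = z & G i j].
    move=> zu zv h.
    have /orP[] : tadj T u z || tadj T v z.
      case/orP: h => [/andP[h _]|/andP[_]]; last by rewrite -negb_or negbK.
      by rewrite /tadj h.
    + move=> /aP[i [j [iu jz ij]]]; exists i, j.
      by rewrite iu jz eqxx (negbTE zu) (negbTE zv).
    + move=> /aP[i [j [iu jz ij]]]; exists i, j.
      by rewrite iu jz eqxx orbT (negbTE zu) (negbTE zv).
  move=> x y.
  have -> : tadj (contract T u v w) x y = [&& x \in contract_verts T u v w,
      y \in contract_verts T u v w, x != y &
      if x == w then new_black T u v y || new_red T u v y else
      if y == w then new_black T u v x || new_red T u v x else tadj T x y].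
    rewrite /tadj /= /contract_rel -!andb_orr.
    by case: (x == w); case: (y == w).
  rewrite !inC => /and4P[].
  case: (x =P w) => [-> _|/eqP xw /= /and3P[xu xv xT]].
    case: (y =P w) => [-> _|/eqP yw /= /and3P[yu yv yT] _]; first by rewrite eqxx.
    exact: new.
  case: (y =P w) => [-> _ _|/eqP yw /= /and3P[yu yv yT] _].
    by move=> /(new _ xu xv)[i [j [iw jx ij]]]; exists j, i; rewrite edge_sym.
  move=> /aP[i [j [ix jy ij]]]; exists i, j.
  by rewrite ix jy (negbTE xu) (negbTE xv) (negbTE yu) (negbTE yv).
Qed.

End Quotient.

(** * Contraction sequences described by representatives *)

Section Merges.
Variables (N : nat) (G : sgraph 'I_N) (T : eqType) (dec : 'I_N -> T) (H : rel T).
Hypothesis decG : forall i j, G i j = H (dec i) (dec j).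

(** A partition of the vertices is given by a map sending each vertex to the
    representative of its part. *)
Definition red_bounded (d : nat) (rho : T -> T) : Prop :=
  forall X, exists2 l : seq T, size l <= d & forall i j i' j',
    rho (dec i) = X -> rho (dec j) != X -> H (dec i) (dec j) ->
    rho (dec i') = X -> rho (dec j') = rho (dec j) -> ~~ H (dec i') (dec j') ->
    rho (dec j) \in l.

(** Contractions are written as pairs of representatives, the second of which survives; the numbers
    of the trigraph vertices enter only with [emit]. Maps are compared on the values of [dec] alone,
    the other elements of [T] being no vertices. The bound is asked before each merge, so that of
    the final partition is a separate hypothesis below. *)
Inductive merges (d : nat) : (T -> T) -> seq (T * T) -> (T -> T) -> Prop :=
  | MergesNil rho rho' :
      (forall k, rho (dec k) = rho' (dec k)) -> merges d rho [::] rho'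
  | MergesCons rho rho' rho'' i j ms :
      red_bounded d rho -> dec i != dec j ->
      rho (dec i) = dec i -> rho (dec j) = dec j ->
      (forall k, rho' (dec k) = if rho (dec k) == dec i then dec j else rho (dec k)) ->
      merges d rho' ms rho'' ->
      merges d rho ((dec i, dec j) :: ms) rho''.

Lemma merges_eq d rho rho' rho'' ms :
  (forall k, rho (dec k) = rho' (dec k)) ->
  merges d rho' ms rho'' -> merges d rho ms rho''.
Proof.
move=> e M; case: M e => [r r' e' e|r r' r'' i j l bd ij ri rj rE M e].
  by apply: MergesNil => k; rewrite e.
apply: (MergesCons _ ij _ _ _ M); rewrite ?e //; last by move=> k; rewrite e.
by move=> X; have [l' l'd h] := bd X; exists l' => // i1 j1 i2 j2; rewrite !e; apply: h.
Qed.

Lemma merges_cat d rho rho' rho'' ms ms' :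
  merges d rho ms rho' -> merges d rho' ms' rho'' -> merges d rho (ms ++ ms') rho''.
Proof.
elim=> [r r' e|r r1 r2 i j l bd ij ri rj r1E _ IH] h; first exact: merges_eq h.
exact: MergesCons bd ij ri rj r1E (IH h).
Qed.

Lemma merges_iota d (rho : nat -> T -> T) (f : nat -> seq (T * T)) m :
  (forall k, k < m -> merges d (rho k) (f k) (rho k.+1)) ->
  merges d (rho 0) (flatten [seq f k | k <- iota 0 m]) (rho m).
Proof.
elim: m => [|m IH] h; first exact: MergesNil.
rewrite -addn1 iotaD map_cat flatten_cat /= cats0 add0n addn1.
by apply: merges_cat (h m _) => //; apply: IH => k km; apply/h/ltnW.
Qed.

(** [name] gives the trigraph vertex that currently stands for a representative. After [x] is merged
    into [y] the fresh vertex belongs to [y]; the entry of [x] becomes stale, but [x] never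
    represents a part again. *)
Definition renamed (name : T -> nat) (y : T) (w : nat) : T -> nat :=
  fun z => if z == y then w else name z.

Fixpoint emit (name : T -> nat) (w : nat) (ms : seq (T * T)) : seq (nat * nat) :=
  if ms is (x, y) :: ms' then (name x, name y) :: emit (renamed name y w) w.+1 ms'
  else [::].

Lemma quotient_red_degree d phi T0 rho name :
  quotient G phi T0 ->
  (forall i, phi i = name (rho (dec i))) ->
  (forall i j, name (rho (dec i)) = name (rho (dec j)) -> rho (dec i) = rho (dec j)) ->
  red_bounded d rho ->
  all (fun x => red_degree T0 x <= d) (tverts T0).
Proof.
move=> [vP bP aP] phiE inj bd; apply/allP=> x /vP[i0 xE].
have [l ld lP] := bd (rho (dec i0)).
suff sub : {subset enum_fset [fset y in tverts T0 | tred T0 x y]%fset <= map name l}.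
  apply: leq_trans ld; rewrite -(size_map name l).
  by apply: uniq_leq_size; rewrite ?fset_uniq.
move=> y; rewrite !inE => /andP[yT xy].
have [i [j [ix jy ij]]] : exists i j, [/\ phi i = x, phi j = y & G i j].
  by apply: aP; rewrite /tadj xy orbT.
have xT : x \in tverts T0 by case/andP: (tred_verts xy).
have ny : x != y by apply: contraTneq xy => ->; rewrite tred_irr.
(* If the two fibres were completely joined, the edge would be black, against [tdisjoint]; so there
   is a non-edge, and [red_bounded] applies. *)
case: (boolP [forall i' : 'I_N, forall j' : 'I_N,
    (phi i' == x) ==> (phi j' == y) ==> G i' j']) => [/forallP h|].
  have := tdisjoint T0 x y; rewrite xy andbT bP // => i' j' /eqP ix' /eqP jy'.
  by have /forallP/(_ j') := h i'; rewrite ix' jy'.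
case/forallPn=> i' /forallPn[j']; rewrite !negb_imply => /and3P[/eqP ix' /eqP jy' nij].
apply/mapP; exists (rho (dec j)); last by rewrite -jy phiE.
apply: (lP i j i' j'); rewrite -?decG //.
- by apply: inj; rewrite -!phiE ix xE.
- apply: contraNneq ny => e; apply/eqP.
  by rewrite -xE -jy !phiE e.
- by apply: inj; rewrite -!phiE ix' xE.
- by apply: inj; rewrite -!phiE jy jy'.
Qed.

Lemma merges_d_sequence_from d rho ms rho' phi T0 name w :
  merges d rho ms rho' -> quotient G phi T0 ->
  (forall i, phi i = name (rho (dec i))) ->
  (forall i j, name (rho (dec i)) = name (rho (dec j)) -> rho (dec i) = rho (dec j)) ->
  (forall i, phi i < w) ->
  red_bounded d rho' -> (exists i0, forall i, rho' (dec i) = rho' (dec i0)) ->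
  d_sequence_from d T0 w (emit name w ms).
Proof.
move=> M; elim: M phi T0 name w => {rho ms rho'}.
  move=> rho rho' e phi T0 name w Q phiE inj _ bd [i0 one].
  have bd0 : red_bounded d rho.
    by move=> X; have [l ld h] := bd X; exists l => // i1 j1 i2 j2; rewrite !e; apply: h.
  rewrite /= (quotient_red_degree Q phiE inj bd0) /=.
  apply/cardfs1P; exists (phi i0); apply/fsetP=> x; rewrite inE.
  apply/idP/eqP => [/(quotient_verts Q)[i <-]|->]; first by rewrite !phiE !e one.
  by apply/(quotient_verts Q); exists i0.
move=> rho rho' rho'' i j ms bd ij ri rj rho'E _ IH phi T0 name w Q phiE inj phiw bd' one.
rewrite [emit _ _ _]/= [d_sequence_from _ _ _ _]/=.
have vi : name (dec i) = phi i by rewrite phiE ri.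
have vj : name (dec j) = phi j by rewrite phiE rj.
have nij : phi i != phi j.
  apply: contraNneq ij => e; rewrite -ri -rj; apply/eqP; apply: inj.
  by rewrite -!phiE e.
have iT : phi i \in tverts T0 by apply/(quotient_verts Q); exists i.
have jT : phi j \in tverts T0 by apply/(quotient_verts Q); exists j.
have wT : w \notin tverts T0.
  apply/negP => /(quotient_verts Q)[k kw].
  by have := phiw k; rewrite kw ltnn.
have eqphi k l : (phi k == phi l) = (rho (dec k) == rho (dec l)).
  by rewrite !phiE; apply/eqP/eqP => [/inj|->].
have newphi k : (if (phi k == phi i) || (phi k == phi j) then w else phi k) =
    renamed name (dec j) w (rho' (dec k)).
  rewrite !eqphi ri rj /renamed rho'E.
  case: eqP => /= [_|_]; first by rewrite eqxx.
  by case: ifP => //; rewrite phiE.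
rewrite (quotient_red_degree Q phiE inj bd) vi vj iT jT nij /=.
apply: (IH _ _ _ _ (quotient_contract Q iT jT nij wT)) => //.
(* Names stay injective on representatives because [w] exceeds every number in use. *)
- move=> k l; rewrite -!newphi !rho'E !eqphi ri rj.
  have wF m : (w = phi m) -> False by move=> e; have := phiw m; rewrite -e ltnn.
  case: (rho (dec k) =P dec i) => /= [_|_];
    case: (rho (dec l) =P dec i) => /= [_|_] //.
  + by case: (rho (dec l) =P dec j) => [-> //|_ /wF].
  + by case: (rho (dec k) =P dec j) => [-> //|_ /esym/wF].
  + case: (rho (dec k) =P dec j) => [->|_].
      by case: (rho (dec l) =P dec j) => [-> //|_ /wF].
    case: (rho (dec l) =P dec j) => [_ /esym/wF //|_].
    by rewrite !phiE => /inj.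
- by move=> k; case: ifP => _ //; apply: ltnW; exact: phiw.
Qed.

Lemma merges_d_sequence d ms rho : injective dec ->
  merges d id ms rho -> red_bounded d rho ->
  (exists i0, forall i, rho (dec i) = rho (dec i0)) ->
  forall name, (forall i, name (dec i) = val i) ->
  d_sequence d G (emit name N ms).
Proof.
move=> dec_inj M bd one name nameE.
apply: (merges_d_sequence_from M (quotient_init G)) => // [i j|i].
  by rewrite !nameE => /val_inj ->.
exact: ltn_ord.
Qed.

End Merges.

(** * The gadget and its 4-sequence *)

(** [VP i] is the [i]-th vertex of the spine, [VV i] the [i]-th vertex of [G], and
    [VE i j k] the [k]-th inner vertex of a path from [VV i] to [VV j]. The hubs are
    [VX b None], with triangle [VX b _], and [VW b i] subdivides the edge from [VX b None]
    to [VV i]. *)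
Inductive vtx :=
  | VP of nat
  | VV of nat
  | VW of bool & nat
  | VX of bool & option bool
  | VE of nat & nat & nat.

Definition corner (o : option bool) : nat := if o is Some c then c.+1 else 0.

(** The code serves twice: for the decidable equality on [vtx], and as the record that the program
    stores for each vertex in arrays 5 to 8. *)
Definition vcode (v : vtx) : nat * nat * nat * nat :=
  match v with
  | VP i => (0, i, 0, 0)
  | VV i => (1, i, 0, 0)
  | VW b i => (2 + b, i, 0, 0)
  | VX b o => (4 + b, corner o, 0, 0)
  | VE i j k => (6, i, j, k)
  end.

Lemma vcode_inj : injective vcode.
Proof.
by case=> [i|i|[] i|[] [[]|]|i j k] [i'|i'|[] i'|[] [[]|]|i' j' k'] //= [] *; subst.
Qed.

HB.instance Definition _ := Equality.copy vtx (inj_type vcode_inj).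

Section Gadget.
Variables (n L : nat) (g : rel nat).

Definition vadj (v w : vtx) : bool :=
  match v, w with
  | VE i j k, VE i' j' k' => [&& i == i', j == j' & (k.+1 == k') || (k'.+1 == k)]
  | VV a, VE i j k | VE i j k, VV a =>
      g i j && ((a == i) && (k == 0) || (a == j) && (k.+1 == L))
  | VW _ i, VV j | VV j, VW _ i => i == j
  | VX b o, VW b' _ | VW b' _, VX b o => (o == None) && (b == b')
  | VX b o, VX b' o' => (b == b') && (o != o')
  | _, _ => false
  end.

Lemma vadj_sym : symmetric vadj.
Proof.
case=> [i|i|b i|b o|i j k] [i'|i'|b' i'|b' o'|i' j' k'] //=.
- by rewrite eq_sym (eq_sym o).
- by rewrite eq_sym (eq_sym j) orbC.
Qed.

Lemma vadj_irr : irreflexive vadj.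
Proof.
by case=> [i|i|b i|b o|i j k] //=; rewrite ?eqxx //= ?andbF //; lia.
Qed.

(** The paths are present for all pairs [(i, j)], so that the vertices do not depend on
    the edges of [G], but they are attached to [VV i] and [VV j] only if [ij] is an edge. *)
Definition edge_path (c : nat) : vtx := VE (c %/ L %/ n) (c %/ L %% n) (c %% L).

(** The order matters: it is the order in which the program creates the vertices, and a position in
    this list is the number of the vertex in the gadget. *)
Definition vertices : seq vtx :=
  [seq VP i | i <- iota 0 n] ++ [seq VV i | i <- iota 0 n] ++
  [seq VW false i | i <- iota 0 n] ++ [seq VW true i | i <- iota 0 n] ++
  [seq VX false o | o <- [:: None; Some false; Some true]] ++
  [seq VX true o | o <- [:: None; Some false; Some true]] ++
  [seq edge_path c | c <- iota 0 (n * n * L)].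

Definition valid (v : vtx) : bool :=
  match v with
  | VP i | VV i | VW _ i => i < n
  | VX _ _ => true
  | VE i j k => [&& i < n, j < n & k < L]
  end.

Definition edge_index (i j k : nat) : nat := (i * n + j) * L + k.

Lemma edge_pathK i j k : j < n -> k < L -> edge_path (edge_index i j k) = VE i j k.
Proof.
move=> jn kL; rewrite /edge_path /edge_index.
have [L0 n0] : 0 < L /\ 0 < n by lia.
by rewrite modnMDl (modn_small kL) divnMDl // (divn_small kL) addn0 modnMDl
  divnMDl // (divn_small jn) (modn_small jn) addn0.
Qed.

Lemma edge_indexK c : edge_index (c %/ L %/ n) (c %/ L %% n) (c %% L) = c.
Proof. by rewrite /edge_index -!divn_eq. Qed.

Lemma edge_index_lt i j k : i < n -> j < n -> k < L -> edge_index i j k < n * n * L.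
Proof.
rewrite /edge_index => i_n jn kL.
have h : (i * n + j).+1 <= n * n by nia.
by apply: leq_trans (leq_mul h (leqnn L)); rewrite mulSn addnC ltn_add2r.
Qed.

Lemma edge_path_inj : {in gtn (n * n * L) &, injective edge_path}.
Proof.
by move=> c d _ _ [e1 e2 e3]; rewrite -(edge_indexK c) e1 e2 e3 edge_indexK.
Qed.

Lemma mem_vertices v : (v \in vertices) = valid v.
Proof.
rewrite /vertices !mem_cat.
have mX (A : eqType) (f : A -> vtx) s (u : vtx) : (forall x, f x != u) ->
    (u \in [seq f x | x <- s]) = false.
  by move=> h; apply/mapP=> -[x _ e]; have := h x; rewrite -e eqxx.
have mI (f : nat -> vtx) i : injective f -> (f i \in [seq f i | i <- iota 0 n]) = (i < n).
  by move=> fI; rewrite (mem_map fI) mem_iota.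
case: v => [i|i|b i|b o|i j k].
- by rewrite (mI VP) ?mX ?orbF // => ? ? [].
- by rewrite mX // (mI VV) ?mX ?orbF //= => ? ? [].
- case: b; rewrite (mX _ VP) // (mX _ VV) //.
  + rewrite (mX _ (VW false)) // (mI (VW true)) => [|? ? []] //.
    by rewrite ?mX // ?orbF.
  + rewrite (mI (VW false)) => [|? ? []] //.
    by rewrite ?mX // ?orbF.
- by case: b; case: o => [[]|]; rewrite (mX _ VP) // (mX _ VV) // (mX _ (VW _)) // (mX _ (VW true)) // !inE.
- rewrite (mX _ VP) // (mX _ VV) // (mX _ (VW _)) // (mX _ (VW true)) //
    (mX _ (VX _)) // (mX _ (VX true)) //.
  rewrite !orFb; apply/mapP/and3P => [[c]|[i_n jn kL]].
    rewrite mem_iota /= add0n => cl [-> -> ->].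
    have [L0 n0] : 0 < L /\ 0 < n by split; nia.
    by rewrite ltn_divLR // ltn_divLR // ltn_mod ltn_mod.
  by exists (edge_index i j k); rewrite ?edge_pathK // mem_iota edge_index_lt.
Qed.

Lemma size_vertices : size vertices = 4 * n + 6 + n * n * L.
Proof. by rewrite /vertices !size_cat !size_map !size_iota /=; lia. Qed.

Lemma uniq_vertices : uniq vertices.
Proof.
have dj (A B : eqType) (f : A -> vtx) (h : B -> vtx) s t :
    (forall x y, f x != h y) -> has (mem [seq f x | x <- s]) [seq h x | x <- t] = false.
  move=> ne; apply/hasPn=> _ /mapP[y _ ->]; apply/mapP=> -[x _ e].
  by have := ne x y; rewrite e eqxx.
rewrite /vertices !cat_uniq !has_cat !dj //=.
rewrite (map_inj_in_uniq (f := edge_path)) ?iota_uniq; last first.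
  by move=> c d; rewrite !mem_iota; apply: edge_path_inj.
by rewrite !map_inj_uniq ?iota_uniq // => ? ? [].
Qed.

(** * The 4-sequence of the gadget *)

Section Contractions.
Variables (N : nat) (dec : 'I_N -> vtx).
Hypothesis n_L : n <= L.
Hypothesis dec_valid : forall i, valid (dec i).

(** The position at time [k] of a walk from [i] to [j] along the spine that waits at [j]. *)
Definition spine (i j k : nat) : nat := minn (i + k) j + (i - k - j).

Lemma spine_first i j : spine i j 0 = i.
Proof. by rewrite /spine; lia. Qed.

(** The walk needs fewer than [n] steps, so [n <= L] lets it arrive in time. Hence both end vertices
    of a path are merged with the spine vertices of the vertices of $G$ to which they are
    attached. *)
Lemma spine_last i j k : i < n -> j < n -> k.+1 = L -> spine i j k = j.
Proof. by rewrite /spine; lia. Qed.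

(** The representatives once the first [c] inner vertices of paths are merged into the
    spine and, in each of the four rows [VW false], [VW true], [VV] and [VP], the vertices
    up to [aw], [au], [av] and [ap]. *)
Definition zipped (c aw au av ap : nat) (v : vtx) : vtx :=
  match v with
  | VP i => VP (maxn i ap)
  | VV i => VV (maxn i av)
  | VW b i => VW b (maxn i (if b then au else aw))
  | VX b o => VX b o
  | VE i j k => if edge_index i j k < c then VP (maxn (spine i j k) ap) else VE i j k
  end.

(** The disjunction separates the two phases: rows move only after all paths are zipped. The offsets
    let each row be at most one step ahead of the next one towards the spine, so a vertex of a row
    meets that next row in at most two places. A hub centre is joined to its whole row [VW b], so
    those pairs stay homogeneous however far the row is merged. Zipped neighbours on a path lie on
    equal or adjacent spine vertices. *)
Lemma zipped_red_bounded c aw au av ap :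
  (c = n * n * L) \/ [/\ aw = 0, au = 0, av = 0 & ap = 0] -> c <= n * n * L ->
  av <= aw <= av.+1 -> av <= au <= av.+1 -> ap <= av <= ap.+1 ->
  red_bounded dec vadj 4 (zipped c aw au av ap).
Proof.
move=> phase cl haw hau hap; set rho := zipped _ _ _ _ _.
case=> [x|x|b x|b o|i j k].
- exists [:: VP x.-1; VP x.+1; VV (maxn x av); edge_path c] => // e f e' f'.
  move: (dec_valid e) (dec_valid f); rewrite /rho.
  case: (dec e) => [i|i|b i|b o|i j k] //=; case: (dec f) => [i'|i'|b' i'|b' o'|i' j' k'] //=;
    try by case: ifP.
  + case: ifP => // _ /and3P[i_n jn kL] i'n [<-] _ /andP[_ att] _ _ _.
    have -> : spine i j k = i'.
      case/orP: att => /andP[/eqP-> /eqP e0]; first by rewrite e0 spine_first.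
      exact: spine_last.
    rewrite !inE; apply/orP; right; apply/orP; right; apply/orP; left.
    by apply/eqP; congr VV; lia.
  + case: ifP => // lc _ /and3P[i_n jn kL] [<-] ne /and3P[/eqP ii /eqP jj kk] _ _ _.
    subst i' j'; move: ne; case: ifP => lc' ne; last first.
      (* Indices of neighbours on a path differ by one, so an unzipped neighbour of a zipped vertex
         is the very next one to be merged. *)
      have -> : c = edge_index i j k' by move: lc lc' kk; rewrite /edge_index; lia.
      by rewrite edge_pathK // !inE eqxx !orbT.
    have : maxn (spine i j k) ap != maxn (spine i j k') ap.
      by apply: contraNneq ne => ->.
    rewrite !inE => ne'.
    have : (maxn (spine i j k') ap == (maxn (spine i j k) ap).-1) ||
       (maxn (spine i j k') ap == (maxn (spine i j k) ap).+1).
      by move: ne'; rewrite /spine; lia.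
    by case/orP => /eqP->; rewrite eqxx ?orbT.
- exists [:: VW false (maxn x aw); VW true (maxn x au); VP ap; VP x] => // e f e' f'.
  move: (dec_valid f); rewrite /rho.
  case: (dec e) => [i|i|b i|b o|i j k] //=; case: (dec f) => [i'|i'|b' i'|b' o'|i' j' k'] //=;
    try by case: ifP.
  + move=> _ [<-] _ /eqP<- _ _ _; rewrite !inE; case: b'.
      by apply/orP; right; apply/orP; left; apply/eqP; congr VW; lia.
    by apply/orP; left; apply/eqP; congr VW; lia.
  + move=> /and3P[i_n jn kL] [<-] _ adj; case: ifP => lc.
      move=> _ _ _; have -> : spine i' j' k' = i.
        case/andP: adj => _ /orP[] /andP[/eqP-> /eqP e0]; first by rewrite e0 spine_first.
        exact: spine_last.
      rewrite !inE.
      have : (maxn i ap == ap) || (maxn i ap == maxn i av) by lia.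
      by case/orP=> /eqP->; rewrite eqxx ?orbT.
    (* An unzipped path vertex exists only in the first phase. There both parts are singletons, so
       the edge between them is black; this matters because [VV] vertices may have many such
       neighbours. *)
    case: phase => [ec|[_ _ av0 _]].
      by have := edge_index_lt i_n jn kL; rewrite -ec lc.
    rewrite av0; case: (dec e') => //=; try by [move=> *; case: ifP].
      move=> a; rewrite !maxn0 => -[->]; case: (dec f') => [?|?|? ?|? ?|a1 a2 a3] //=.
      by case: ifP => // _ [-> -> ->]; rewrite adj.
    by move=> ? ? ?; case: ifP.
- exists [:: VV av; VV x] => // e f e' f'; rewrite /rho.
  case: (dec e) => [i|i|b1 i|b1 o|i j k] //=; try by case: ifP.
  case: (dec f) => [i'|i'|b' i'|b' o'|i' j' k'] //=.
  + move=> [<- <-] _ /eqP-> _ _ _; rewrite !inE.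
    have : (maxn i' av == av) || (maxn i' av == maxn i' (if b1 then au else aw)).
      by case: b1; lia.
    by case/orP=> /eqP->; rewrite eqxx ?orbT.
  + move=> [-> _] _ /andP[/eqP-> /eqP->].
    case: (dec e') => [?|?|b2 i2|? ?|? ? ?] //=; try by case: ifP.
    move=> [-> _]; case: (dec f') => [?|?|? ?|? ?|? ? ?] //=; try by case: ifP.
    by case=> -> ->; rewrite !eqxx.
- exists [:: VX b None; VX b (Some false); VX b (Some true)] => // e f e' f'; rewrite /rho.
  case: (dec e) => [i|i|b1 i|b1 o1|i j k] //=; try by case: ifP.
  case: (dec f) => [i'|i'|b' i'|b' o'|i' j' k'] //=.
  (* A complete pair: no non-edge exists between the hub centre and its row. *)
  + move=> [-> ->] _ /andP[/eqP oE /eqP bE].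
    case: (dec e') => [?|?|b2 i2|? ?|? ? ?] //=; try by case: ifP.
    move=> [-> ->]; case: (dec f') => [?|?|? ?|? ?|? ? ?] //=; try by case: ifP.
    by case=> -> _; rewrite oE bE !eqxx.
  + move=> [-> _] _ /andP[/eqP-> _] _ _ _.
    by case: o' => [[]|]; rewrite !inE eqxx ?orbT.
- exists [:: rho (VE i j k.-1); rho (VE i j k.+1); rho (VV i); rho (VV j)] => // e f e' f' eE.
  have {eE} -> : dec e = VE i j k.
    by move: eE; rewrite /rho; case: (dec e) => //= ? ? ?; case: ifP.
  case: (dec f) => [i'|i'|b' i'|b' o'|i' j' k'] // _.
    case/andP=> _ /orP[] /andP[/eqP-> _] _ _ _; by rewrite !inE eqxx ?orbT.
  by case/and3P=> /eqP-> /eqP-> /orP[] /eqP<- _ _ _; rewrite !inE eqxx ?orbT.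
Qed.

Hypothesis n_gt0 : 0 < n.
Hypothesis dec_onto : forall v, valid v -> exists i, dec i = v.

Lemma merges1 rho rho' x y :
  valid x -> valid y -> red_bounded dec vadj 4 rho -> x != y -> rho x = x -> rho y = y ->
  (forall v, valid v -> rho' v = if rho v == x then y else rho v) ->
  merges dec vadj 4 rho [:: (x, y)] rho'.
Proof.
move=> /dec_onto[i <-] /dec_onto[j <-] bd ij ri rj h.
apply: (MergesCons bd ij ri rj (rho' := rho')); last exact: MergesNil.
by move=> k; apply: h.
Qed.

Definition spine_of (v : vtx) : vtx := if v is VE i j k then VP (spine i j k) else v.

Lemma merges_edges :
  merges dec vadj 4 id
    (flatten [seq [:: (edge_path c, spine_of (edge_path c))] | c <- iota 0 (n * n * L)])
    (zipped (n * n * L) 0 0 0 0).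
Proof.
apply: (merges_eq (rho' := zipped 0 0 0 0 0)).
  by move=> k; case: (dec k) => [i|i|[] i|b o|i j l] //=; rewrite maxn0.
apply: (merges_iota (rho := fun c => zipped c 0 0 0 0)) => c cl.
have [L0 n0] : 0 < L /\ 0 < n by split; nia.
have [i_n jn kL] : [/\ c %/ L %/ n < n, c %/ L %% n < n & c %% L < L].
  by rewrite ltn_divLR // ltn_divLR // !ltn_mod.
rewrite /edge_path; set i := c %/ L %/ n in i_n *; set j := c %/ L %% n in jn *.
set k := c %% L in kL *; have cE : edge_index i j k = c by exact: edge_indexK.
have sp_n : spine i j k < n by rewrite /spine; lia.
apply: merges1 => //=; rewrite ?i_n ?jn ?cE ?ltnn ?maxn0 //.
  by apply: zipped_red_bounded => //; [right | exact: ltnW].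
case=> [a|a|[] a|[] o|i' j' k'] //=; rewrite ?maxn0 //.
move=> /and3P[i'n j'n k'L].
have -> : (edge_index i' j' k' < c.+1) =
    (edge_index i' j' k' < c) || (edge_index i' j' k' == c).
  by rewrite ltnS leq_eqVlt orbC.
case: ltnP => //= _; rewrite -{1}cE.
have <- : (VE i' j' k' == VE i j k) = (edge_index i' j' k' == edge_index i j k).
  apply/eqP/eqP => [[-> -> ->] //|e].
  by rewrite -(edge_pathK i' j'n k'L) -(edge_pathK i jn kL) e.
by case: eqP => [[-> -> ->]|].
Qed.

(** Contracting from the hub side down to the spine keeps the offsets within the bounds of
    [zipped_red_bounded]. *)
Definition merge_rows (q : nat) : seq (vtx * vtx) :=
  [:: (VW false q, VW false q.+1); (VW true q, VW true q.+1);
      (VV q, VV q.+1); (VP q, VP q.+1)].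

Lemma maxn_step (f : nat -> vtx) a q : injective f ->
  f (maxn a q.+1) = if f (maxn a q) == f q then f q.+1 else f (maxn a q).
Proof.
by move=> fI; rewrite (inj_eq fI); case: eqP => e; congr f; lia.
Qed.

Lemma merges_rows :
  merges dec vadj 4 (zipped (n * n * L) 0 0 0 0)
    (flatten [seq merge_rows q | q <- iota 0 n.-1])
    (zipped (n * n * L) n.-1 n.-1 n.-1 n.-1).
Proof.
apply: (merges_iota (rho := fun q => zipped (n * n * L) q q q q)) => q qn.
have qn1 : q.+1 < n by lia.
have bd aw au av ap : av <= aw <= av.+1 -> av <= au <= av.+1 -> ap <= av <= ap.+1 ->
    red_bounded dec vadj 4 (zipped (n * n * L) aw au av ap).
  by apply: zipped_red_bounded => //; left.
have E i j k : valid (VE i j k) -> edge_index i j k < n * n * L.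
  by case/and3P; exact: edge_index_lt.
have ne1 (f : nat -> vtx) : injective f -> f q != f q.+1.
  by move=> fI; rewrite (inj_eq fI); lia.
have step x y rho rho' : valid x -> valid y -> red_bounded dec vadj 4 rho ->
    x != y -> rho x = x -> rho y = y ->
    (forall v, valid v -> rho' v = if rho v == x then y else rho v) ->
    forall ms rho'', merges dec vadj 4 rho' ms rho'' ->
    merges dec vadj 4 rho ((x, y) :: ms) rho''.
  move=> vx vy b xy rx ry h ms rho''.
  exact: (merges_cat (merges1 vx vy b xy rx ry h)).
have qn0 : q < n by exact: ltnW.
have [m1 m2] : maxn q.+1 q = q.+1 /\ maxn q q.+1 = q.+1 by lia.
have VWI b : injective (VW b) by move=> ? ? [].
have VVI : injective VV by move=> ? ? [].
have VPI : injective VP by move=> ? ? [].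
apply: (step _ _ _ (zipped (n * n * L) q.+1 q q q)); rewrite /= ?maxnn ?m1 ?m2 ?qn1 ?qn0 ?ne1 //.
- by apply: bd; lia.
- case=> [a|a|[] a|b o|i j k] v //=; rewrite -?maxn_step //; by case: ifP.
apply: (step _ _ _ (zipped (n * n * L) q.+1 q.+1 q q)); rewrite /= ?maxnn ?m1 ?m2 ?qn1 ?qn0 ?ne1 //.
- by apply: bd; lia.
- case=> [a|a|[] a|b o|i j k] v //=; rewrite -?maxn_step //; by case: ifP.
apply: (step _ _ _ (zipped (n * n * L) q.+1 q.+1 q.+1 q)); rewrite /= ?maxnn ?m1 ?m2 ?qn1 ?qn0 ?ne1 //.
- by apply: bd; lia.
- case=> [a|a|[] a|b o|i j k] v //=; rewrite -?maxn_step //; by case: ifP.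
apply: (step _ _ _ (zipped (n * n * L) q.+1 q.+1 q.+1 q.+1)); rewrite /= ?maxnn ?m1 ?m2 ?qn1 ?qn0 ?ne1 //.
- by apply: bd; lia.
- by case=> [a|a|[] a|b o|i j k] v //=; rewrite ?E // -?maxn_step.
exact: MergesNil.
Qed.

(** The ten vertices left once the rows are merged, in the order in which each is merged into its
    successor; [level] is the position in this list of the vertex that represents [v]. *)
Definition chain : seq vtx :=
  [:: VP n.-1; VV n.-1; VW false n.-1; VW true n.-1] ++
  [seq VX false o | o <- [:: None; Some false; Some true]] ++
  [seq VX true o | o <- [:: None; Some false; Some true]].

Definition level (v : vtx) : nat :=
  match v with
  | VP _ | VE _ _ _ => 0
  | VV _ => 1
  | VW b _ => 2 + b
  | VX b o => 4 + 3 * b + corner o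
  end.

Definition collapsed (m : nat) (v : vtx) : vtx := nth (VP 0) chain (maxn m (level v)).

Definition level_adj : seq (nat * nat) :=
  let s := [:: (0, 1); (1, 2); (1, 3); (2, 4); (3, 7); (4, 5); (4, 6); (5, 6);
               (7, 8); (7, 9); (8, 9)] in
  (0, 0) :: s ++ [seq (p.2, p.1) | p <- s].

Lemma vadj_level v w : vadj v w -> (level v, level w) \in level_adj.
Proof.
case: v => [i|i|[] i|[] [[]|]|i j k]; case: w => [i'|i'|[] i'|[] [[]|]|i' j' k'] //=;
  by rewrite ?andbF.
Qed.

Lemma level_lt v : level v < 10.
Proof. by case: v => [i|i|[] i|[] [[]|]|i j k]. Qed.

Lemma chain_uniq : uniq chain.
Proof. by []. Qed.

(** With ten levels this is a finite check, done by computation on [level_adj]. All neighbours are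
    counted, whatever their colour, and there are still at most four. *)
Lemma collapsed_red_bounded m : m < 10 -> red_bounded dec vadj 4 (collapsed m).
Proof.
move=> m10 X.
pose nbr m p := undup [seq maxn m e.2 | e <- level_adj &
  (maxn m e.1 == p) && (maxn m e.2 != p)].
have nbr4 p : p < 10 -> size (nbr m p) <= 4.
  have /allP h : all (fun m => all (fun p => size (nbr m p) <= 4) (iota 0 10)) (iota 0 10).
    by [].
  have /allP h' : all (fun p => size (nbr m p) <= 4) (iota 0 10).
    by apply: h; rewrite mem_iota.
  by move=> p10; apply: h'; rewrite mem_iota.
exists (if index X chain < 10 then [seq nth (VP 0) chain q | q <- nbr m (index X chain)]
        else [::]).
  by case: ifP => // h; rewrite size_map nbr4.
move=> i j i' j' iX jX adj _ _ _.
have m10' v : maxn m (level v) < 10 by rewrite gtn_max m10 level_lt.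
have ix v : index (collapsed m v) chain = maxn m (level v).
  by rewrite /collapsed index_uniq ?chain_uniq // m10'.
rewrite -iX ix m10'; apply/map_f; rewrite mem_undup; apply/mapP.
exists (level (dec i), level (dec j)) => //.
rewrite mem_filter vadj_level // andbT /= eqxx /=.
by apply: contraNneq jX => e; rewrite -iX /collapsed e.
Qed.

Lemma merges_chain :
  merges dec vadj 4 (collapsed 0)
    (flatten [seq [:: (nth (VP 0) chain m, nth (VP 0) chain m.+1)] | m <- iota 0 9])
    (collapsed 9).
Proof.
apply: merges_iota => m m9.
have lv k : k < 10 -> level (nth (VP 0) chain k) = k.
  by case: k => [|[|[|[|[|[|[|[|[|[|k]]]]]]]]]].
have vd k : k < 10 -> valid (nth (VP 0) chain k).
  by case: k => [|[|[|[|[|[|[|[|[|[|k]]]]]]]]]] //= _; lia.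
have m10 : m < 10 by exact: ltnW.
apply: merges1; rewrite ?vd //.
- exact: collapsed_red_bounded.
- by rewrite nth_uniq ?chain_uniq // neq_ltn ltnSn.
- by rewrite /collapsed lv // maxnn.
- by rewrite /collapsed lv //; congr nth; lia.
- move=> v _; rewrite /collapsed.
  rewrite nth_uniq ?chain_uniq // ?gtn_max ?m10 ?level_lt //.
  by case: eqP => e; congr nth; lia.
Qed.

Definition contractions : seq (vtx * vtx) :=
  flatten [seq [:: (edge_path c, spine_of (edge_path c))] | c <- iota 0 (n * n * L)] ++
  flatten [seq merge_rows q | q <- iota 0 n.-1] ++
  flatten [seq [:: (nth (VP 0) chain m, nth (VP 0) chain m.+1)] | m <- iota 0 9].

Lemma contractions_d_sequence (G : sgraph 'I_N) (name : vtx -> nat) :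
  injective dec -> (forall i j, G i j = vadj (dec i) (dec j)) ->
  (forall i, name (dec i) = val i) -> d_sequence 4 G (emit name N contractions).
Proof.
move=> decI decG nameE.
apply: (merges_d_sequence decG decI _ _ _ nameE (rho := collapsed 9)).
- apply: merges_cat merges_edges _; apply: merges_cat merges_rows _.
  apply: merges_eq merges_chain => k; have := dec_valid k.
  rewrite /collapsed max0n; case: (dec k) => [i|i|b i|b o|i j l] /= v.
  + by congr VP; lia.
  + by congr VV; lia.
  + by case: b; congr VW; lia.
  + by case: b; case: o => [[]|].
  + case/and3P: v => i_n jn kL; rewrite edge_index_lt //.
    by congr VP; rewrite /spine; lia.
- exact: collapsed_red_bounded.
- have [i0 e] := dec_onto (isT : valid (VX true (Some true))).
  exists i0 => i; rewrite e /collapsed; congr nth; have := level_lt (dec i).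
  by rewrite [level (VX _ _)]/=; lia.
Qed.

End Contractions.

End Gadget.

(** * Induced packings and paths *)

Lemma isomorphic_image (V W : finType) (G : sgraph V) (K : sgraph W) (h : W -> V) :
  injective h -> (forall x y, G (h x) (h y) = K x y) ->
  isomorphic (induced G [set h x | x : W]) K.
Proof.
move=> hI hG; pose S := [set h x | x : W].
have hS x : h x \in S by exact: imset_f.
pose h' x : {y | y \in S} := exist _ (h x) (hS x).
have h'I : injective h' by move=> x y [/hI].
have cE : #|{: {y | y \in S}}| = #|W| by rewrite card_sig card_imset // cardsT.
have [f fK Kf] : bijective h' by apply: inj_card_bij => //; rewrite cE.
exists f; first by exists h'.
move=> x y; rewrite -hG -[x in RHS]Kf -[y in RHS]Kf; by [].
Qed.

Lemma induced_packing_single (C : graph_class) (V : finType) (G : sgraph V) (S : {set V}) :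
  S != set0 -> C _ (induced G S) -> induced_packing C G S.
Proof.
move=> S0 CS; exists [set S]; split.
- apply/and3P; split; first by rewrite /cover big_set1.
  + by apply/trivIsetP=> A B /set1P-> /set1P->; rewrite eqxx.
  + by rewrite inE eq_sym.
- by move=> A B /set1P-> /set1P->; rewrite eqxx.
- by move=> A /set1P->.
Qed.

(** * Walks in the gadget that end at a hub *)

Section Routes.
Variables (n L : nat) (g : rel nat).
Hypothesis g_sym : symmetric g.
Hypothesis g_irr : irreflexive g.
Hypothesis L_gt0 : 0 < L.

Notation vadj := (vadj L g).
Notation valid := (valid n L).

(** The vertex met at time [t] on the way from [VV i] to [VV j]. The copy [VE j i] is traversed
    backwards, hence the reversed index. *)
Definition inner (o : bool) (i j t : nat) : vtx :=
  if o then VE i j t else VE j i (L.-1 - t).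

Definition segment (o : bool) (i j : nat) : seq vtx :=
  [seq inner o i j t | t <- iota 0 L].

(** The walks from [VV i] to [VX true None] following the path [i :: xs]; each edge
    [ij] is traversed along one of the two copies [VE i j _] and [VE j i _]. *)
Inductive route : nat -> seq nat -> seq vtx -> Prop :=
  | RouteEnd i : route i [::] [:: VW true i; VX true None]
  | RouteStep o i j xs p : g i j -> route j xs p ->
      route i (j :: xs) (segment o i j ++ VV j :: p).

Lemma route_path i xs p : route i xs p -> path g i xs.
Proof. by elim=> //= o {}i j {}xs {}p -> _ ->. Qed.

Lemma route_size i xs p : route i xs p -> size p = size xs * L.+1 + 2.
Proof.
by elim=> //= o {}i j {}xs {}p _ _; rewrite size_cat /= size_map size_iota => ->; lia.
Qed.

Lemma route_VV i xs p : route i xs p -> subseq [seq VV x | x <- xs] p.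
Proof.
elim=> //= o {}i j {}xs {}p _ _ IH; apply: subseq_trans (suffix_subseq _ _).
by rewrite /= eqxx.
Qed.

Lemma route_VW i xs p a : route i xs p -> VW false a \notin p.
Proof.
elim=> // o {}i j {}xs {}p _ _ IH; rewrite mem_cat inE (negbTE IH) !orbF.
by apply/mapP=> -[t _]; rewrite /inner; case: o.
Qed.

Definition consecutive (s : seq nat) (a b : nat) : Prop :=
  exists q, q.+1 < size s /\
    (nth 0 s q = a /\ nth 0 s q.+1 = b \/ nth 0 s q = b /\ nth 0 s q.+1 = a).

(** A route traverses whole copies only, so the inner vertex of index 0 already tells which edge was
    used. The decoding program looks at no other inner vertices. *)
Lemma route_consecutive i xs p a b : route i xs p ->
  VE a b 0 \in p -> consecutive (i :: xs) a b.
Proof.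
elim=> // o {}i j {}xs {}p _ _ IH; rewrite mem_cat inE => /orP[|/= /IH[q [qs h]]].
  by case/mapP=> t _; rewrite /inner; case: o => -[-> -> _]; exists 0; split; auto.
by exists q.+1.
Qed.

Lemma consecutive_route i xs p q : route i xs p -> q < size xs ->
  (VE (nth 0 (i :: xs) q) (nth 0 xs q) 0 \in p) ||
  (VE (nth 0 xs q) (nth 0 (i :: xs) q) 0 \in p).
Proof.
move=> r; elim: r q => // o {}i j {}xs {}p _ _ IH [_|q /IH].
  rewrite !mem_cat /=; case: o.
    apply/orP; left; apply/orP; left; apply/mapP; exists 0 => //.
    by rewrite mem_iota.
  (* On a copy traversed backwards, the vertex of index 0 is met last. *)
  apply/orP; right; apply/orP; left; apply/mapP; exists L.-1; rewrite ?mem_iota; first by lia.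
  by rewrite /inner subnn.
by rewrite !mem_cat !inE => /orP[] /= ->; rewrite ?orbT.
Qed.

Lemma vadj_VV i v : vadj (VV i) v -> valid v ->
  (exists b, v = VW b i) \/ (exists o j, g i j /\ v = inner o i j 0).
Proof.
case: v => [a|a|b a|b o|a b k] //=; first by move=> /eqP->; left; exists b.
case/andP=> gab att /and3P[_ _ kL]; right; case/orP: att => /andP[/eqP-> /eqP k0].
  by exists true, b; rewrite k0.
by exists false, a; rewrite g_sym; split => //; rewrite /inner; congr VE; lia.
Qed.

Lemma vadj_inner o i j t v : t < L -> vadj (inner o i j t) v -> valid v ->
  [\/ 0 < t /\ v = inner o i j t.-1, t.+1 < L /\ v = inner o i j t.+1,
      t = 0 /\ v = VV i | t.+1 = L /\ v = VV j].
Proof.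
rewrite /inner; case: o; case: v => [a|a|c a|c o'|a b k] //= tL.
- case/andP=> _ /orP[] /andP[/eqP-> /eqP h] _; first by constructor 3.
  by constructor 4.
- move=> /and3P[/eqP<- /eqP<- /orP[]/eqP h] /and3P[_ _ kL].
    by constructor 2; rewrite h.
  by constructor 1; rewrite -h.
- case/andP=> _ /orP[] /andP[/eqP-> /eqP h] _; first by constructor 4; split=> //; lia.
  by constructor 3; split=> //; lia.
- move=> /and3P[/eqP<- /eqP<- /orP[]/eqP h] /and3P[_ _ kL].
    by constructor 1; split; [lia | congr VE; lia].
  by constructor 2; split; [lia | congr VE; lia].
Qed.

(** Inner vertices have at most two neighbours. A walk that does not return to its predecessor,
    repeats no vertex and ends at a hub can neither turn nor stop inside a copy, so it reaches
    [VV j]; here [m] counts the inner vertices still ahead. *)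
Lemma inner_walk o i j t m p : t + m.+1 = L ->
  path vadj (inner o i j t) p -> uniq (inner o i j t :: p) -> all valid p ->
  (if t is t'.+1 then inner o i j t' else VV i) \notin p ->
  last (inner o i j t) p = VX true None ->
  exists p', p = [seq inner o i j u | u <- iota t.+1 m] ++ VV j :: p'.
Proof.
elim: m t p => [|m IH] t [|v p] tm.
- by move=> _ _ _ _; case: o.
- case/andP=> tv _ _ /andP[vv _] ; rewrite inE negb_or => /andP[ne _] _.
  exists p => /=; congr cons.
  have tL : t < L by lia.
  have [[t0 e]|[]|[t0 e]|[] //] := vadj_inner tL tv vv.
  + by case: t t0 ne e {tm tv tL} => //= t _ ne e; rewrite e eqxx in ne.
  + by lia.
  + by subst t; rewrite e eqxx in ne.
- by move=> _ _ _ _; case: o {IH}.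
- case/andP=> tv pth /andP[nt upv] /andP[vv vp]; rewrite inE negb_or => /andP[ne _] lst.
  have e : v = inner o i j t.+1.
    have tL : t < L by lia.
    have [[t0 e]|[] //|[t0 e]|[e _]] := vadj_inner tL tv vv.
    + by case: t t0 ne e {tm tv tL nt pth lst} => //= t _ ne e; rewrite e eqxx in ne.
    + by subst t; rewrite e eqxx in ne.
    + by lia.
  subst v; have [||p' ->] := IH t.+1 p _ pth upv vp _ lst; first by lia.
    by apply: contra nt; rewrite inE => ->; rewrite orbT.
  by exists p'.
Qed.

(** From [VV i] the walk enters a copy, which it must traverse completely, or a vertex [VW b i],
    which leads on to the hub [b]. The hub [false] is excluded by hypothesis, and the hub [true] is
    the end. *)
Lemma walk_route i p : path vadj (VV i) p -> uniq (VV i :: p) -> all valid p ->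
  last (VV i) p = VX true None -> VX false None \notin p -> exists xs, route i xs p.
Proof.
have [m] := ubnP (size p); elim: m => // m IH in i p *.
case: p => [//|v p] /= pm /andP[iv pth] /andP[niv /andP[nv up]] /andP[vv vp] lst s0.
have [[b e]|[o [j [gij e]]]] := vadj_VV iv vv.
  subst v; case: p pth nv up vp lst s0 niv {pm IH vv iv} => [//|w p] /= /andP[vw pth] _ /andP[nw _] _.
  case: w vw pth nw => [a|a|c a|c o|a b' k] //=.
    by move=> /eqP-> _ _ _ _; rewrite !inE eqxx orbT.
  case/andP=> /eqP-> /eqP<- pth; case: c pth => _; last by rewrite !inE eqxx orbT.
  (* The hub [true] is the last vertex and occurs once, so nothing can follow it. *)
  move=> nw lst _ _; exists [::]; case: p nw lst => [|x p] nw lst; first by constructor.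
  by have := mem_last x p; rewrite /= in lst; rewrite lst (negbTE nw).
subst v; have [|||p' pE] := @inner_walk o i j 0 L.-1 p _ pth _ vp _ lst.
- by lia.
- by rewrite /= nv.
- by move: niv; rewrite inE negb_or => /andP[].
have sE : segment o i j = inner o i j 0 :: [seq inner o i j u | u <- iota 1 L.-1].
  by rewrite /segment -[in LHS](prednK L_gt0).
have p0E : inner o i j 0 :: p = segment o i j ++ VV j :: p' by rewrite sE pE.
have [||||||xs r] := IH j p'.
- by move: pm; rewrite pE size_cat /=; lia.
- by move: pth; rewrite pE cat_path /= => /and3P[].
- by move: up; rewrite pE cat_uniq => /and3P[].
- by move: vp; rewrite pE all_cat /= => /and3P[].
- by move: lst; rewrite pE last_cat.
- by move: s0; rewrite pE inE mem_cat inE !negb_or => /and4P[].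
by exists (j :: xs); rewrite p0E; constructor.
Qed.

End Routes.

(** * From a packing to a path *)

Section Packings.
Variables (n L : nat) (g : rel nat).
Hypothesis g_sym : symmetric g.
Hypothesis g_irr : irreflexive g.
Hypothesis L_gt0 : 0 < L.

Notation vadj := (vadj L g).
Notation valid := (valid n L).

Variables (V : finType) (G : sgraph V) (dec : V -> vtx).
Hypothesis dec_inj : injective dec.
Hypothesis dec_valid : forall x, valid (dec x).
Hypothesis dec_onto : forall v, valid v -> exists x, dec x = v.
Hypothesis decG : forall x y, G x y = vadj (dec x) (dec y).

Definition is_corner (v : vtx) : bool := if v is VX _ (Some _) then true else false.

Definition in_hub (b : bool) (v : vtx) : bool := if v is VX b' _ then b' == b else false.

Lemma in_hub_size b s : uniq s -> all (in_hub b) s -> size s <= 3.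
Proof.
move=> us /allP h.
apply: (@uniq_leq_size _ _ [:: VX b None; VX b (Some false); VX b (Some true)]) => // v /h.
by case: v => // b' [[]|] /= /eqP->; rewrite !inE eqxx ?orbT.
Qed.

(** As [g] has no loops, a path is attached to [VV c] at one end only; so [VV c] and two
    neighbouring inner vertices form no triangle. *)
Lemma attached_once a b c k k' : g a b ->
  (c == a) && (k == 0) || (c == b) && (k.+1 == L) ->
  (c == a) && (k' == 0) || (c == b) && (k'.+1 == L) ->
  ~~ ((k.+1 == k') || (k'.+1 == k)).
Proof.
by move=> gab; have : a != b by [apply: contraTneq gab => ->; rewrite g_irr]; lia.
Qed.

(** Hence the two triangles of an induced [D m] are the hubs, and a packing has one part. *)
Lemma triangle x y z : vadj x y -> vadj x z -> vadj y z ->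
  exists b, [/\ in_hub b x, in_hub b y & in_hub b z].
Proof.
case: x => [a|a|c a|c o|a b k]; case: y => [a'|a'|c' a'|c' o'|a' b' k'] //=;
  case: z => [a2|a2|c2 a2|c2 o2|a2 b2 k2] //=; try by lia.
- move=> /andP[gab h] /andP[_ h'] /and3P[/eqP e1 /eqP e2]; subst a2 b2.
  by rewrite (negbTE (attached_once gab h h')).
- by move=> /andP[/eqP-> _] /andP[/eqP-> _] /andP[].
- by move=> /andP[/eqP-> _] /andP[_ ne] /andP[/eqP o2E _]; rewrite o2E in ne.
- by move=> /andP[_ ne] /andP[/eqP oE _] /andP[/eqP o'E _]; rewrite oE o'E in ne.
- by move=> /andP[/eqP-> _] /andP[/eqP-> _] _; exists c2; rewrite eqxx.
- move=> /andP[gab h] /and3P[/eqP e1 /eqP e2 kk] /andP[_ h']; subst a2 b2.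
  by rewrite (negbTE (attached_once gab h h')) in kk.
- move=> /and3P[/eqP e1 /eqP e2 kk] /andP[gab h] /andP[_ h']; subst a' b'.
  by rewrite (negbTE (attached_once gab h h')) in kk.
Qed.

Section Part.
Variables (m : nat) (h : 'I_m + bool * bool -> V).
Hypothesis m_gt0 : 0 < m.
Hypothesis h_inj : injective h.
Hypothesis hG : forall x y, G (h x) (h y) = D m x y.

Let d x := dec (h x).

Let d_inj : injective d. Proof. by move=> x y /dec_inj/h_inj. Qed.

Let d_adj x y : vadj (d x) (d y) = D_rel x y. Proof. by rewrite /d -decG hG. Qed.

Lemma in_hub_image b s : uniq s -> all (fun x => in_hub b (d x)) s -> size s <= 3.
Proof.
by move=> us hs; rewrite -(size_map d) (@in_hub_size b) ?map_inj_uniq ?all_map.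
Qed.

Lemma part_end_subproof (c : bool) : (if c then m.-1 else 0) < m.
Proof. by case: c => //; rewrite prednK. Qed.

Definition part_end (c : bool) : 'I_m := Ordinal (part_end_subproof c).

Lemma part_end_hub c : exists b,
  [/\ in_hub b (d (inl (part_end c))), in_hub b (d (inr (c, false)))
    & in_hub b (d (inr (c, true)))].
Proof. by apply: triangle; rewrite d_adj /= ?eqxx. Qed.

Lemma part_hub_inj b :
  ~ (in_hub b (d (inr (false, false))) /\ in_hub b (d (inr (true, true))) /\
     in_hub b (d (inr (false, true))) /\ in_hub b (d (inr (true, false)))).
Proof.
move=> [h1 [h2 [h3 h4]]].
have := @in_hub_image b [:: inr (false, false); inr (false, true);
  inr (true, false); inr (true, true)].
by rewrite /= h1 h2 h3 h4 => /(_ isT isT).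
Qed.

(** Each end of the part forms a triangle with its two pendant vertices and hence fills a hub. A hub
    has three vertices and cannot hold four pendants, so the ends use different hubs; [r] tells
    whether the part runs from hub [true] to hub [false]. *)
Lemma part_hubs : exists r : bool, forall c,
  [/\ d (inl (part_end c)) = VX (c (+) r) None,
      forall c', is_corner (d (inr (c, c')))
    & forall o, exists c', d (inr (c, c')) = VX (c (+) r) (Some o)].
Proof.
have [b0 [e0 f0 t0]] := part_end_hub false.
have [b1 [e1 f1 t1]] := part_end_hub true.
have b01 : b1 = ~~ b0.
  case: b0 b1 e0 f0 t0 e1 f1 t1 => [] [] // *; exfalso;
    by [apply: (@part_hub_inj true) | apply: (@part_hub_inj false)].
(* For [m = 1] both ends are the same vertex, which cannot lie in two hubs. *)
have m1 : 1 < m.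
  rewrite ltnNge; apply/negP=> m1; move: e1.
  have -> : part_end true = part_end false by apply/val_inj; rewrite /=; clear -m1; lia.
  by rewrite b01; move: e0; case: (d _) => //= b o /eqP->; case: (b0).
exists b0 => c.
have [e f t] : [/\ in_hub (c (+) b0) (d (inl (part_end c))),
    in_hub (c (+) b0) (d (inr (c, false))) & in_hub (c (+) b0) (d (inr (c, true)))].
  by case: c => //=; rewrite -b01.
have pm2 : (if c then m.-2 else 1) < m by clear -m1; case: c; lia.
pose j : 'I_m := Ordinal pm2.
have jadj : D_rel (inl (part_end c)) (inl j) by rewrite /=; clear -m1; case: c; lia.
have jne : j != part_end c by rewrite -val_eqE /=; clear -m1; case: c; lia.
(* A corner has all its neighbours in its hub, so if the end were a corner, its neighbour on the
   path would be a fourth vertex there. *)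
have eE : d (inl (part_end c)) = VX (c (+) b0) None.
  move: (e); case dE : (d (inl (part_end c))) => [|||b [o|]|] //= /eqP bE; last by rewrite bE.
  exfalso; have jh : in_hub (c (+) b0) (d (inl j)).
    have := d_adj (inl (part_end c)) (inl j); rewrite jadj dE.
    by case: (d (inl j)) => //= b' o' /andP[/eqP<- _]; rewrite bE.
  have := @in_hub_image (c (+) b0) [:: inl j; inl (part_end c); inr (c, false); inr (c, true)].
  rewrite /= e f t jh !inE -[inl _ == inl _]/(j == part_end c) (negbTE jne) /=.
  by case: (c) => /(_ isT isT).
split=> //.
  move=> c'; have : in_hub (c (+) b0) (d (inr (c, c'))) by case: c'.
  case dE: (d (inr (c, c'))) => [|||b [o|]|] //= /eqP bE.
  by have := d_inj (etrans dE (etrans (congr1 (fun b => VX b None) bE) (esym eE))).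
(* A corner missed by the part would be a fourth vertex of its hub. *)
move=> o; have := @in_hub_size (c (+) b0) (VX (c (+) b0) (Some o) :: [seq d x | x <- [::
    inl (part_end c); inr (c, false); inr (c, true)]]).
rewrite cons_uniq (map_inj_uniq d_inj) /= !inE e f t eqxx eE => H.
have [->|n1] := eqVneq (VX (c (+) b0) (Some o)) (d (inr (c, false))); first by exists false.
have [->|n2] := eqVneq (VX (c (+) b0) (Some o)) (d (inr (c, true))); first by exists true.
have ne : (VX (c (+) b0) (Some o) == VX (c (+) b0) None) = false by apply/eqP => -[].
move: H; rewrite ne (negbTE n1) (negbTE n2); case: (c) => /(_ isT isT) //.
Qed.

End Part.
Notation hub_walk a xs p :=
  [/\ route L g a xs p, uniq (a :: xs), all (gtn n) (a :: xs) &
      uniq (VX false None :: VW false a :: VV a :: p)].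

Lemma walk_hubs s : sorted vadj s -> uniq s -> all valid s ->
  (forall v, v \in s -> ~~ is_corner v) ->
  (exists s', s = VX false None :: s') -> last (VP 0) s = VX true None ->
  exists a xs p, s = [:: VX false None, VW false a, VV a & p] /\ hub_walk a xs p.
Proof.
move=> st us vs nc [s' sE] ls; subst s.
case: s' => [|v s'] //= in st us vs nc ls *.
case/andP: st => hv st.
have vc : ~~ is_corner v by apply: nc; rewrite !inE eqxx orbT.
case: v => [a|a|b a|b o|a b k] //= in hv st us vs nc ls vc *; last first.
  by case: o hv vc {st us vs nc ls} => [?|] //; rewrite eqxx andbF.
case/eqP: hv => e; subst b.
case: s' => [|v s'] //= in st us vs nc ls *.
case/andP: st => av st; have {vc} vc : ~~ is_corner v by apply: nc; rewrite !inE eqxx !orbT.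
case: v => [c|c|b c|b o|c b k] //= in av st us vs nc ls vc *; last first.
  case/andP: av => /eqP oE /eqP bE; subst o b.
  by case/andP: us; rewrite !inE eqxx.
case/eqP: av => e; subst c.
have [s0 [w1 [w2 [us1 us2]]]] : VX false None \notin s' /\ VW false a \notin s' /\
    VV a \notin s' /\ uniq s' /\ uniq (VV a :: s').
  by move: us => /=; rewrite !inE !negb_or -!andbA /= => /and4P[-> -> -> ->].
case/and3P: vs => a_n _ vs.
have [xs r] := walk_route g_sym L_gt0 st us2 vs ls s0.
exists a, xs, s'; split=> //; split=> //.
- have := subseq_uniq (route_VV r) us1; rewrite map_inj_uniq /= => [->|? ? [] //].
  rewrite andbT; apply: contra w2 => ax.
  by apply: (mem_subseq (route_VV r)); apply: map_f.
- rewrite /= a_n; apply/allP=> x xs_x.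
  have /(mem_subseq (route_VV r)) : VV x \in [seq VV x | x <- xs] by exact: map_f.
  by move/allP: vs => /[apply].
Qed.

(** The path of [D m] becomes a walk between the hub centres that avoids the corners. Each edge of
    the path of $G$ accounts for [L] inner vertices and one vertex of $G$; the remaining nine are
    both hubs, one [VW] vertex for each, and the starting vertex. *)
Lemma part_route m (A : {set V}) : 0 < m -> isomorphic (induced G A) (D m) ->
  exists a xs p, hub_walk a xs p /\
    #|A| = size xs * L.+1 + 9 /\
    forall x, (x \in A) = is_corner (dec x) ||
      (dec x \in [:: VX false None, VW false a, VV a & p]).
Proof.
move=> m0 [f [f' fK f'K] fG].
pose h x := val (f' x).
have h_inj : injective h by move=> x y /val_inj/(can_inj f'K).
have hG x y : G (h x) (h y) = D m x y by rewrite -{2}(f'K x) -{2}(f'K y) fG.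
have hA x : (x \in A) = (x \in codom h).
  apply/idP/codomP => [xA|[y ->]]; last exact: (valP (f' y)).
  by exists (f (Sub x xA)); rewrite /h fK.
have [r hubs] := part_hubs m0 h_inj hG.
pose s0 := [seq dec (h (inl i)) | i <- enum 'I_m].
have s0_size : size s0 = m by rewrite size_map size_enum_ord.
have s0_nth (i : 'I_m) : nth (VP 0) s0 i = dec (h (inl i)).
  by rewrite (nth_map i) ?size_enum_ord // nth_ord_enum.
have s0_uniq : uniq s0 by rewrite map_inj_uniq ?enum_uniq // => i j /dec_inj/h_inj[].
have s0_sorted : sorted vadj s0.
  apply/(sortedP (VP 0)) => i; rewrite s0_size => im.
  rewrite (s0_nth (Ordinal im)) (s0_nth (Ordinal (ltnW im))) -decG hG /=.
  by rewrite eqxx.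
have s0_first : nth (VP 0) s0 0 = VX r None.
  by have [+ _ _] := hubs false; rewrite -s0_nth.
have s0_last : nth (VP 0) s0 m.-1 = VX (~~ r) None.
  by have [+ _ _] := hubs true; rewrite -s0_nth.
(* Oriented so that the walk starts at the hub [false]. *)
pose s := if r then rev s0 else s0.
have s_mem : s =i s0 by rewrite /s; case: (r) => // v; rewrite mem_rev.
have s_size : size s = m by rewrite /s; case: (r); rewrite ?size_rev.
have s_uniq : uniq s by rewrite /s; case: (r); rewrite ?rev_uniq.
have s_first : nth (VP 0) s 0 = VX false None.
  rewrite /s; move: s0_first s0_last; case: (r) => //= _ <-.
  by rewrite nth_rev s0_size ?subn1.
have s_last : last (VP 0) s = VX true None.
  rewrite -nth_last s_size /s; move: s0_first s0_last; case: (r) => //= <- _.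
  by rewrite nth_rev s0_size ?prednK // subnn.
have s_sorted : sorted vadj s.
  rewrite /s; case: (r) => //; rewrite rev_sorted.
  by move: s0_sorted; apply: sub_sorted => x y; rewrite vadj_sym.
have s_corner v : v \in s -> ~~ is_corner v.
  rewrite s_mem => /mapP[i _ ->]; apply/negP.
  case dE: (dec _) => [|||b [o|]|] // _.
  have [_ _ /(_ o)[c' c'E]] := hubs (b (+) r).
  by have := h_inj _ _ (dec_inj (etrans dE (esym (etrans c'E (congr1 (VX^~ (Some o)) (addbK r b)))))).
have s_valid : all valid s.
  by apply/allP=> v; rewrite s_mem => /mapP[i _ ->].
have s_cons : exists s', s = VX false None :: s'.
  by case: (s) s_size s_first => [|v s'] //= _ ->; exists s'.
have [a [xs [p [sE hw]]]] := walk_hubs s_sorted s_uniq s_valid s_corner s_cons s_last.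
exists a, xs, p; split=> //; split.
  rewrite (eq_card hA) card_codom // card_sum card_prod card_bool card_ord.
  by case: hw => /route_size e _ _ _; rewrite -s_size sE /= e; lia.
move=> x; rewrite -sE s_mem hA; apply/codomP/orP => [[[i|[c c']] ->]|[]].
- by right; apply/mapP; exists i; rewrite ?mem_enum.
- by left; have [_ + _] := hubs c; apply.
- case dE: (dec x) => [|||b [o|]|] // _.
  have [_ _ /(_ o)[c' c'E]] := hubs (b (+) r).
  by exists (inr (b (+) r, c')); apply: dec_inj; rewrite dE c'E addbK.
- by case/mapP=> i _ /dec_inj ->; exists (inl i).
Qed.

(** Every part contains [VX false None], and parts are disjoint, so there is only one. *)
Lemma packing_route (S : {set V}) : S != set0 -> induced_packing D_class G S ->
  exists a xs p, hub_walk a xs p /\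
    #|S| = size xs * L.+1 + 9 /\
    forall x, (x \in S) = is_corner (dec x) ||
      (dec x \in [:: VX false None, VW false a, VV a & p]).
Proof.
move=> S0 [P [/and3P[/eqP cP tP P0] _ iso]].
have [x xS] := set0Pn _ S0; move: xS; rewrite -cP => /bigcupP[A AP _].
have [c cE] : exists c, dec c = VX false None by exact: dec_onto.
have part B : B \in P -> exists a xs p, hub_walk a xs p /\
    #|B| = size xs * L.+1 + 9 /\
    forall x, (x \in B) = is_corner (dec x) ||
      (dec x \in [:: VX false None, VW false a, VV a & p]).
  by move=> BP; have [m m0 /part_route] := iso _ BP; apply.
suff -> : cover P = A by exact: part.
have cB B : B \in P -> c \in B.
  by move=> /part[a [xs [p [_ [_ ->]]]]]; rewrite cE inE.
apply/eqP; rewrite eqEsubset; apply/andP; split; last exact: bigcup_sup.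
apply/bigcupsP=> B BP; have [->//|ne] := eqVneq B A.
move/trivIsetP: tP => /(_ _ _ BP AP ne)/pred0P/(_ c).
by rewrite /= cB ?cB.
Qed.

(** * From a path to a packing *)

Definition chordless (s : seq vtx) : Prop :=
  forall p q, p < q -> q < size s ->
    vadj (nth (VP 0) s p) (nth (VP 0) s q) = (q == p.+1).

Lemma chordless_cat s1 s2 : chordless s1 -> chordless s2 ->
  (forall p q, p < size s1 -> q < size s2 ->
    vadj (nth (VP 0) s1 p) (nth (VP 0) s2 q) = (p.+1 == size s1) && (q == 0)) ->
  chordless (s1 ++ s2).
Proof.
move=> c1 c2 c12 p q pq; rewrite size_cat !nth_cat => qs.
case: ltnP => p1; case: ltnP => q1; try by lia.
- exact: c1.
- by rewrite c12; lia.
- by rewrite c2; lia.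
Qed.

(** One particular [route], always on the copies directed like the path. A single packing is enough
    for the lower bound on the optimum. *)
Fixpoint forward (i : nat) (xs : seq nat) : seq vtx :=
  if xs is j :: xs' then segment L true i j ++ VV j :: forward j xs'
  else [:: VW true i; VX true None].

Lemma forward_mem i xs v : v \in forward i xs ->
  match v with
  | VP _ => false
  | VV a => a \in xs
  | VW b a => b && (a == last i xs)
  | VX b o => b && (o == None)
  | VE a b k => [&& a \in i :: xs, b \in xs & k < L]
  end.
Proof.
elim: xs i => [|j xs IH] i /=; first by rewrite !inE => /orP[/eqP->|/eqP->] /=.
rewrite mem_cat inE => /or3P[/mapP[k]|/eqP->|/IH].
- by rewrite mem_iota => /= kL ->; rewrite !inE !eqxx.
- by rewrite inE eqxx.
case: v {IH} => //= a; first by rewrite inE => ->; rewrite orbT.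
by move=> b k /and3P[]; rewrite !inE => -> -> ->; rewrite !orbT.
Qed.

Lemma forward_size i xs : size (forward i xs) = size xs * L.+1 + 2.
Proof.
by elim: xs i => //= j xs IH i; rewrite size_cat size_map size_iota /= IH; lia.
Qed.

Lemma forward_last i xs v : last v (forward i xs) = VX true None.
Proof. by elim: xs i v => //= j xs IH i v; rewrite last_cat /= IH. Qed.

Lemma forward_uniq i xs : uniq (i :: xs) -> uniq (VV i :: forward i xs).
Proof.
elim: xs i => //= j xs IH i /andP[ix jx]; apply/andP; split.
  rewrite mem_cat negb_or; apply/andP; split; first by apply/mapP=> -[].
  apply: contra ix; rewrite !inE => /orP[/eqP[->]|/forward_mem ->];
    by rewrite ?eqxx ?orbT.
rewrite cat_uniq [uniq (VV j :: _)]/= IH // andbT map_inj_uniq ?iota_uniq => [|? ? [] //].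
rewrite andTb; apply/hasPn=> v; rewrite inE => /orP[/eqP->|/forward_mem vP].
  by apply/mapP=> -[].
apply: contra ix => /mapP[k _ vE]; rewrite {v}vE in vP.
by case/and3P: vP.
Qed.

(** The path of $G$ may well have chords. In the gadget vertices of $G$ are pairwise non-adjacent,
    and a chosen inner vertex sees only its own copy and the two vertices that this copy joins. *)
Lemma forward_chordless i xs : uniq (i :: xs) -> path g i xs ->
  chordless (VV i :: forward i xs).
Proof.
elim: xs i => [|j xs IH] i.
  move=> _ _ [|[|[|p]]] [|[|[|q]]] //= _ _; by rewrite ?eqxx.
rewrite [uniq _]/= [path _ _ _]/= inE negb_or => /and3P[/andP[ij ix] jx xs_u] /andP[gij pxs].
rewrite [forward _ _]/= -cat_cons; apply: chordless_cat.
- move=> [|p] [|q] //= pq; rewrite size_map size_iota ltnS => qL;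
    rewrite !(nth_map 0) ?size_iota ?nth_iota ?add0n //=; try exact: ltn_trans qL.
    by rewrite gij !eqxx /= (negbTE ij) orbF.
  by rewrite !eqxx /=; move: pq; clear; lia.
- by apply: IH; rewrite ?pxs //= jx.
move=> p q; rewrite [size (_ :: segment _ _ _ _)]/= size_map size_iota ltnS => pL qs.
have : nth (VP 0) (VV j :: forward j xs) q \in VV j :: forward j xs by exact: mem_nth.
rewrite inE; case: q qs => [|q] qs /=.
  case: p pL => [|p] pL _ /=; first by lia.
  rewrite (nth_map 0) ?size_iota ?nth_iota //= add0n gij eq_sym (negbTE ij) eqxx /= andbT.
  by rewrite eqSS.
rewrite andbF; set v := nth _ _ _ => /orP[/eqP vE|/forward_mem].
  by have := forward_uniq (i := j) (xs := xs); rewrite /= jx xs_u -vE mem_nth // => /(_ isT).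
move=> vP; apply/negbTE; apply: contraTN vP.
case: p pL => [|p] pL /=.
  case: v => [a|a|b a|b o|a b k] //=.
    move=> /eqP->; apply/negP=> /andP[_ /eqP e].
    by have := mem_last j xs; rewrite -e inE (negbTE ij) (negbTE ix).
  case/andP=> _ /orP[] /andP[/eqP<- _]; rewrite ?inE ?(negbTE ij) ?(negbTE ix) ?andbF //.
rewrite (nth_map 0) ?size_iota ?nth_iota // add0n /inner.
case: v => [a|a|b a|b o|a b k] //=.
  by case/andP=> _ /orP[] /andP[/eqP-> _].
by case/and3P=> /eqP<- /eqP<- _; rewrite inE (negbTE ij) (negbTE ix).
Qed.

Definition through_hubs (i : nat) (xs : seq nat) : seq vtx :=
  [:: VX false None; VW false i] ++ VV i :: forward i xs.

Lemma through_hubs_uniq i xs : uniq (i :: xs) -> uniq (through_hubs i xs).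
Proof.
move=> u; rewrite /through_hubs cat_uniq forward_uniq // andbT andTb.
apply/hasPn=> v; rewrite !inE => /orP[/eqP-> //|/forward_mem].
by case: v => //= [[] a|[] o].
Qed.

Lemma through_hubs_chordless i xs : uniq (i :: xs) -> path g i xs ->
  chordless (through_hubs i xs).
Proof.
move=> u p; apply: chordless_cat; last 1 first.
- move=> a b a2 bs.
  have : nth (VP 0) (VV i :: forward i xs) b \in VV i :: forward i xs by exact: mem_nth.
  rewrite inE; case: b bs => [|b] bs /=.
    by case: a a2 => [|[|]] //= _ _; rewrite eqxx.
  rewrite andbF; set v := nth _ _ _ => /orP[/eqP vE|/forward_mem].
    by have := forward_uniq u; rewrite /= -vE mem_nth.
  case: a a2 => [|[|]] //= _; case: v => [c|c|c d|c o|c d k] //=.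
  + by case: c => // _; rewrite andbF.
  + by case/andP=> ->.
  + by case/andP: u => ix _ cx; apply: contraNF ix => /eqP->.
  + by case: c => // _; rewrite andbF.
- by move=> a b ab b2; have [-> ->] : a = 0 /\ b = 1 by move: b2; rewrite /=; lia.
- exact: forward_chordless.
Qed.

Lemma path_packing i xs : all (gtn n) (i :: xs) -> uniq (i :: xs) -> path g i xs ->
  exists S : {set V}, induced_packing D_class G S /\ #|S| = size xs * L.+1 + 9.
Proof.
move=> xn u pxs; pose s := through_hubs i xs; pose m := size s.
have mE : m = size xs * L.+1 + 5 by rewrite /m size_cat /= forward_size; lia.
have m0 : 0 < m by rewrite mE addnS.
have s_valid v : v \in s -> valid v.
  rewrite mem_cat !inE -orbA => /or4P[/eqP->|/eqP->|/eqP->|/forward_mem] //=;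
    try by case/andP: xn.
  have h a : a \in i :: xs -> a < n by exact: (allP xn).
  case: v => //= [a ax|b a /andP[_ /eqP->]|a b k /and3P[ai bx ->]].
  - by apply: h; rewrite inE ax orbT.
  - by apply/h/mem_last.
  - by rewrite !h // inE bx orbT.
have s_nocorner v : v \in s -> ~~ is_corner v.
  rewrite mem_cat !inE -orbA => /or4P[/eqP->|/eqP->|/eqP->|/forward_mem] //=.
  by case: v => //= b o /andP[_ /eqP->].
pose d (x : 'I_m + bool * bool) : vtx :=
  match x with inl p => nth (VP 0) s p | inr (b, c) => VX b (Some c) end.
have d_valid x : valid (d x) by case: x => [p|[b c]] //=; exact/s_valid/mem_nth.
have d_inj : injective d.
  move=> [p|[b c]] [q|[b' c']] //=.
  - move=> /eqP; rewrite nth_uniq ?through_hubs_uniq // => /eqP e.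
    by congr inl; apply: val_inj.
  - by move=> e; have := s_nocorner _ (mem_nth (VP 0) (ltn_ord p)); rewrite e.
  - by move=> e; have := s_nocorner _ (mem_nth (VP 0) (ltn_ord q)); rewrite -e.
  - by case=> -> ->.
have [enc encK] : exists enc, forall x, dec (enc x) = d x.
  have hx x : exists y, dec y == d x by have [y e] := dec_onto (d_valid x); exists y; rewrite e.
  by exists (fun x => xchoose (hx x)) => x; apply/eqP/(xchooseP (hx x)).
have enc_inj : injective enc by move=> x y e; apply: d_inj; rewrite -!encK e.
have s_ch := through_hubs_chordless u pxs.
have s_end (p : 'I_m) b : (nth (VP 0) s p == VX b None) = (p == (if b then m.-1 else 0) :> nat).
  have -> : VX b None = nth (VP 0) s (if b then m.-1 else 0).
    case: b => //; rewrite nth_last /s /through_hubs last_cat.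
    by rewrite /= forward_last.
  by rewrite nth_uniq ?through_hubs_uniq //; case: b; rewrite // prednK.
have end_corner (p : 'I_m) b c :
    vadj (nth (VP 0) s p) (VX b (Some c)) = (p == (if b then m.-1 else 0) :> nat).
  rewrite -s_end; have := s_nocorner _ (mem_nth (VP 0) (ltn_ord p)).
  case: (nth _ _ _) => [?|?|? ?|b' [o|]|? ? ?] //= _; try by apply/esym/eqP.
  by rewrite andbT; apply/eqP/eqP => [->|[->]].
have encG x y : G (enc x) (enc y) = D m x y.
  rewrite decG !encK; move: x y => [p1|[b1 c1]] [q1|[b2 c2]].
  - rewrite /=; case: (ltngtP p1 q1) => pq.
    + by rewrite s_ch //; lia.
    + by rewrite vadj_sym s_ch //; lia.
    + by rewrite pq vadj_irr; lia.
  - by rewrite [LHS]end_corner.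
  - by rewrite vadj_sym [LHS]end_corner.
  - by rewrite /= (inj_eq (@Some_inj _)).
exists [set enc x | x : 'I_m + bool * bool]; split.
  apply: induced_packing_single.
    by apply/set0Pn; exists (enc (inr (true, true))); exact: imset_f.
  by exists m => //; apply: isomorphic_image.
by rewrite card_imset // card_sum card_prod card_bool card_ord mE; lia.
Qed.

End Packings.

(** * Programs *)

(** A Hoare triple for total correctness with a time bound. The frame conditions are supplied
    separately, by [written] and [unchanged]. *)
Definition runs (c : prog) (m : memory) (T : nat) (Q : memory -> Prop) : Prop :=
  exists t m', [/\ exec c m t m', t <= T & Q m'].

Fixpoint written (c : prog) : seq nat :=
  match c with
  | Skip => [::]
  | Set_ a _ _ => [:: a]
  | Seq c1 c2 => written c1 ++ written c2
  | If _ c1 c2 => written c1 ++ written c2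
  | While _ c => written c
  end.

Definition unchanged (s : seq nat) (m m' : memory) : Prop :=
  forall a i, a \notin s -> m' a i = m a i.

Lemma exec_unchanged c m t m' : exec c m t m' -> unchanged (written c) m m'.
Proof.
elim=> {c m t m'} //=.
- by move=> a i e m b j; rewrite inE /update => /negbTE->.
- move=> c1 c2 m1 m2 m3 t1 t2 _ IH1 _ IH2 a i.
  by rewrite mem_cat negb_or => /andP[a1 a2]; rewrite IH2 // IH1.
- by move=> e c1 c2 m m' t _ _ IH a i; rewrite mem_cat negb_or => /andP[a1 _]; exact: IH.
- by move=> e c1 c2 m m' t _ _ IH a i; rewrite mem_cat negb_or => /andP[_ a2]; exact: IH.
- by move=> e c m1 m2 m3 t1 t2 _ _ IH1 _ IH2 a i ac; rewrite IH2 // IH1.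
Qed.

Lemma runs_weaken c m T T' (Q Q' : memory -> Prop) :
  runs c m T Q -> T <= T' -> (forall m', Q m' -> Q' m') -> runs c m T' Q'.
Proof.
move=> [t [m' [h tT q]]] TT QQ; exists t, m'.
by split; [|exact: leq_trans TT|exact: QQ].
Qed.

Lemma runs_unchanged c m T (Q : memory -> Prop) : runs c m T Q ->
  runs c m T (fun m' => Q m' /\ unchanged (written c) m m').
Proof.
by move=> [t [m' [h tT q]]]; exists t, m'; split=> //; split=> //; exact: exec_unchanged h.
Qed.

Lemma runs_skip m (Q : memory -> Prop) : Q m -> runs Skip m 1 Q.
Proof. by exists 1, m; split=> //; constructor. Qed.

Lemma runs_set a i e m (Q : memory -> Prop) :
  Q (update m a (eval m i) (eval m e)) -> runs (Set_ a i e) m 1 Q.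
Proof. by move=> q; eexists 1, _; split; [constructor | |exact: q]. Qed.

Lemma runs_seq c1 c2 m T1 T2 Q :
  runs c1 m T1 (fun m1 => runs c2 m1 T2 Q) -> runs (Seq c1 c2) m (T1 + T2) Q.
Proof.
move=> [t1 [m1 [h1 l1 [t2 [m2 [h2 l2 q]]]]]]; exists (t1 + t2), m2.
by split; [apply: ExecSeq h1 h2 | apply: leq_add |].
Qed.

Lemma runs_if e c1 c2 m T Q :
  (eval m e != 0 -> runs c1 m T Q) -> (eval m e = 0 -> runs c2 m T Q) ->
  runs (If e c1 c2) m T.+1 Q.
Proof.
move=> h1 h2; have [e0|e0] := eqVneq (eval m e) 0.
  by have [t [m' [h l q]]] := h2 e0; exists t.+1, m'; split=> //; apply: ExecIfFalse.
by have [t [m' [h l q]]] := h1 e0; exists t.+1, m'; split=> //; apply: ExecIfTrue.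
Qed.

(** Every loop below is a bounded one whose guard evaluates exactly to the number of rounds left, so
    termination and the number of rounds come from the same equation. *)
Lemma runs_while e c b m T (Inv : nat -> memory -> Prop) :
  Inv 0 m ->
  (forall k m1, k <= b -> unchanged (written c) m m1 -> Inv k m1 -> eval m1 e = b - k) ->
  (forall k m1, k < b -> unchanged (written c) m m1 -> Inv k m1 ->
    runs c m1 T (Inv k.+1)) ->
  runs (While e c) m (b * T.+1 + 1) (Inv b).
Proof.
move=> I0 ev body.
suff H r k m1 : k + r = b -> unchanged (written c) m m1 -> Inv k m1 ->
    runs (While e c) m1 (r * T.+1 + 1) (Inv b) by exact: (H b 0).
elim: r k m1 => [|r IH] k m1 kr u Ik.
  rewrite addn0 in kr; subst k; exists 1, m1; split=> //.
  by apply: ExecWhileFalse; rewrite (ev b) // subnn.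
have kb : k < b by rewrite -kr addnS ltnS leq_addr.
have [t1 [m2 [h1 l1 I1]]] := body k m1 kb u Ik.
have u2 : unchanged (written c) m m2.
  by move=> a i ac; rewrite (exec_unchanged h1) // u.
have [|t2 [m3 [h2 l2 I2]]] := IH k.+1 m2 _ u2 I1; first by rewrite addSnnS.
exists (t1 + t2).+1, m3; split=> //; last by rewrite mulSn; lia.
by apply: ExecWhileTrue h1 h2; rewrite (ev k) // 1?ltnW // -lt0n subn_gt0.
Qed.

(** Renaming the arrays of a program gives it a fresh memory. *)
Section Shift.
Variable K : nat.

Fixpoint shift_expr (e : expr) : expr :=
  match e with
  | Const k => Const k
  | Get a i => Get (K + a) (shift_expr i)
  | Add e1 e2 => Add (shift_expr e1) (shift_expr e2)
  | Defs.Sub e1 e2 => Defs.Sub (shift_expr e1) (shift_expr e2)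
  end.

Fixpoint shift (c : prog) : prog :=
  match c with
  | Skip => Skip
  | Set_ a i e => Set_ (K + a) (shift_expr i) (shift_expr e)
  | Seq c1 c2 => Seq (shift c1) (shift c2)
  | If e c1 c2 => If (shift_expr e) (shift c1) (shift c2)
  | While e c => While (shift_expr e) (shift c)
  end.

Definition shifted (m M : memory) : Prop := forall a i, M (K + a) i = m a i.

Lemma shift_eval m M e : shifted m M -> eval M (shift_expr e) = eval m e.
Proof.
move=> mM; elim: e => //= [a e ->|e1 -> e2 ->|e1 -> e2 ->] //; exact: mM.
Qed.

Lemma shift_exec c m t m' M : exec c m t m' -> shifted m M ->
  exists M', [/\ exec (shift c) M t M', shifted m' M' &
    forall a i, a < K -> M' a i = M a i].
Proof.
move=> h; elim: h M => {c m t m'} /=.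
- by move=> m M mM; exists M; split=> //; constructor.
- move=> a i e m M mM; eexists; split; first by constructor.
    by move=> b j; rewrite /update !(shift_eval _ mM) eqn_add2l mM.
  by move=> b j bK; rewrite /update (_ : b == K + a = false) //; lia.
- move=> c1 c2 m1 m2 m3 t1 t2 _ IH1 _ IH2 M /IH1[M1 [h1 s1 u1]].
  have [M2 [h2 s2 u2]] := IH2 _ s1; exists M2; split=> //; first exact: ExecSeq h1 h2.
  by move=> a i aK; rewrite u2 // u1.
- move=> e c1 c2 m m' t e0 _ IH M mM; have [M' [h s u]] := IH _ mM.
  by exists M'; split=> //; apply: ExecIfTrue => //; rewrite (shift_eval _ mM).
- move=> e c1 c2 m m' t e0 _ IH M mM; have [M' [h s u]] := IH _ mM.
  by exists M'; split=> //; apply: ExecIfFalse => //; rewrite (shift_eval _ mM).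
- move=> e c m1 m2 m3 t1 t2 e0 _ IH1 _ IH2 M mM; have [M1 [h1 s1 u1]] := IH1 _ mM.
  have [M2 [h2 s2 u2]] := IH2 _ s1; exists M2; split=> //.
    by apply: ExecWhileTrue h1 h2; rewrite (shift_eval _ mM).
  by move=> a i aK; rewrite u2 // u1.
- move=> e c m e0 M mM; exists M; split=> //.
  by apply: ExecWhileFalse; rewrite (shift_eval _ mM).
Qed.

End Shift.

Definition Var (a : nat) : expr := Get a (Const 0).
Definition Assign (a : nat) (e : expr) : prog := Set_ a (Const 0) e.
(** Truncated subtraction from 1 tests for zero, and all Boolean connectives and equality are built
    from it. *)
Definition NotE (e : expr) : expr := Defs.Sub (Const 1) e.
Definition AndE (e1 e2 : expr) : expr := NotE (Add (NotE e1) (NotE e2)).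
Definition OrE (e1 e2 : expr) : expr := NotE (NotE (Add e1 e2)).
Definition EqE (e1 e2 : expr) : expr := NotE (Add (Defs.Sub e1 e2) (Defs.Sub e2 e1)).

Lemma eval_NotE m e : eval m (NotE e) = (eval m e == 0).
Proof. by rewrite /=; case: eqP; lia. Qed.

Lemma eval_AndE m e1 e2 : eval m (AndE e1 e2) = (eval m e1 != 0) && (eval m e2 != 0).
Proof. by rewrite /=; do 2 case: eqP; lia. Qed.

Lemma eval_OrE m e1 e2 : eval m (OrE e1 e2) = (eval m e1 != 0) || (eval m e2 != 0).
Proof. by rewrite /=; do 2 case: eqP; lia. Qed.

Lemma eval_EqE m e1 e2 : eval m (EqE e1 e2) = (eval m e1 == eval m e2).
Proof. by rewrite /=; case: eqP; lia. Qed.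

Lemma update_cell m a i x j : update m a i x a j = if j == i then x else m a j.
Proof. by rewrite /update eqxx. Qed.

Lemma update_array m a i x b : b != a -> update m a i x b = m b.
Proof. by rewrite /update => /negbTE->. Qed.

(** Loop-free programs are run by the function [sem], so that their effect is found by
    simplification rather than by building derivations of [exec]. *)
Fixpoint straight (c : prog) : bool :=
  match c with
  | Seq c1 c2 | If _ c1 c2 => straight c1 && straight c2
  | While _ _ => false
  | _ => true
  end.

Fixpoint cost (c : prog) : nat :=
  match c with
  | Seq c1 c2 => cost c1 + cost c2
  | If _ c1 c2 => (maxn (cost c1) (cost c2)).+1
  | _ => 1
  end.

Fixpoint sem (c : prog) (m : memory) : memory :=
  match c with
  | Set_ a i e => update m a (eval m i) (eval m e)
  | Seq c1 c2 => sem c2 (sem c1 m)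
  | If e c1 c2 => if eval m e != 0 then sem c1 m else sem c2 m
  | _ => m
  end.

Lemma runs_straight c m (Q : memory -> Prop) :
  straight c -> Q (sem c m) -> runs c m (cost c) Q.
Proof.
elim: c m Q => [|a i e|c1 IH1 c2 IH2|e c1 IH1 c2 IH2|//] m Q /=.
- by move=> _; exact: runs_skip.
- by move=> _; exact: runs_set.
- by case/andP=> s1 s2 q; apply: runs_seq; apply: IH1 => //; apply: IH2.
- case/andP=> s1 s2 q; apply: runs_if => e0; rewrite e0 /= in q.
    by apply: runs_weaken (IH1 m Q s1 q) _ _ => //; exact: leq_maxl.
  by apply: runs_weaken (IH2 m Q s2 q) _ _ => //; exact: leq_maxr.
Qed.

Lemma sem_unchanged c m : unchanged (written c) m (sem c m).
Proof.
elim: c m => [|a i e|c1 IH1 c2 IH2|e c1 IH1 c2 IH2|//] m b j //=.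
- by rewrite inE => ba; rewrite update_array.
- by rewrite mem_cat negb_or => /andP[b1 b2]; rewrite IH2 // IH1.
- by rewrite mem_cat negb_or => /andP[b1 b2]; case: ifP => _; [exact: IH1|exact: IH2].
Qed.

Lemma sem_kept s c m : all (fun a => a \notin written c) s ->
  forall a j, a \in s -> sem c m a j = m a j.
Proof. by move=> /allP h a j /h; exact: sem_unchanged. Qed.

Lemma unchanged_kept s t m m' : unchanged t m m' -> all (fun a => a \notin t) s ->
  forall a j, a \in s -> m' a j = m a j.
Proof. by move=> u /allP h a j /h; exact: u. Qed.

Lemma runs_seq_straight c1 c2 m T Q :
  straight c1 -> runs c2 (sem c1 m) T Q -> runs (Seq c1 c2) m (cost c1 + T) Q.
Proof. by move=> s1 r; apply: runs_seq; apply: runs_straight. Qed.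

Lemma runs_then_straight c1 c2 m T (Q : memory -> Prop) :
  straight c2 -> runs c1 m T (fun m' => Q (sem c2 m')) -> runs (Seq c1 c2) m (T + cost c2) Q.
Proof.
move=> s2 r; apply: runs_seq; apply: (runs_weaken r (leqnn T)) => m'.
exact: runs_straight.
Qed.

(** Arrays 0 and 1 hold the input, and 2, 3, 4 the numbers of vertices of the gadget, of
    inner vertices of a path, and of inner vertices of all paths. Arrays 5 to 9 hold the
    attributes of the vertices of the gadget, 10 their current names in the contraction
    sequence, 11 and 12 the numbers of contractions and of vertices generated so far; 13
    to 19 are scratch variables, and 20 to 22 are used to decode the path. The memory of
    the packing algorithm starts at array 32. *)
Definition Multiply (r a b : nat) : prog :=
  Seq (Assign r (Const 0)) (Seq (Assign 13 (Var a))
    (While (Var 13) (Seq (Assign r (Add (Var r) (Var b)))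
      (Assign 13 (Defs.Sub (Var 13) (Const 1)))))).

Lemma runs_Multiply r a b m : r != 13 -> a != r -> b != r -> a != 13 -> b != 13 ->
  runs (Multiply r a b) m (m a 0 * 3 + 3) (fun m' => m' r 0 = m a 0 * m b 0).
Proof.
move=> r13 ar br a13 b13.
rewrite (_ : m a 0 * 3 + 3 = 1 + (1 + (m a 0 * 3 + 1))); last by lia.
apply: runs_seq_straight => //; apply: runs_seq_straight => //.
set m0 := sem _ _; have m0E : m0 13 0 = m a 0 /\ m0 r 0 = 0 /\ m0 b 0 = m b 0.
  by rewrite /m0 /= /update /= (negbTE ar) (negbTE br) (negbTE r13) (negbTE b13) !eqxx.
apply: (@runs_weaken _ _ (m a 0 * 3 + 1) _
  (fun m' => m' 13 0 = m a 0 - m a 0 /\ m' r 0 = m a 0 * m b 0)) => [||m' []//].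
  apply: (@runs_while _ _ (m a 0) _ 2
    (fun k m' => m' 13 0 = m a 0 - k /\ m' r 0 = k * m b 0)); last 1 first.
  - move=> k m1 km u [e1 e2]; apply: runs_straight => //=.
    rewrite /update /= ![13 == r]eq_sym (negbTE r13) !eqxx /= e1 e2 u ?inE ?negb_or ?br ?b13 //.
    by case: m0E => _ [_ ->]; split; lia.
  - by case: m0E => -> [-> _]; rewrite subn0.
  - by move=> k m1 km u [e1 _]; rewrite /= e1.
by [].
Qed.

(** * Computing the gadget *)

Definition increment (a : nat) : prog := Assign a (Add (Var a) (Const 1)).

Definition PushVertex (k a b c d : expr) : prog :=
  Seq (Set_ 5 (Var 12) k) (Seq (Set_ 6 (Var 12) a) (Seq (Set_ 7 (Var 12) b)
  (Seq (Set_ 8 (Var 12) c) (Seq (Set_ 9 (Var 12) d) (Seq (Set_ 10 (Var 12) (Var 12))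
  (increment 12)))))).

Definition PushBlock (r : nat) (b : expr) : prog :=
  Seq (Assign 15 (Const 0)) (While (Defs.Sub b (Var 15))
    (Seq (PushVertex (Const r) (Var 15) (Const 0) (Const 0) (Const 0)) (increment 15))).

Definition PushPath : prog :=
  PushVertex (Const 6) (Var 16) (Var 17) (Var 18) (Get 1 (Var 19)).

(** Variables 16, 17 and 18 hold the components of the path vertex numbered by 15, and
    19 the position of its edge in the adjacency matrix. *)
Definition NextPath : prog :=
  Seq (increment 15) (Seq (increment 18)
    (If (Defs.Sub (Var 3) (Var 18)) Skip
      (Seq (Assign 18 (Const 0)) (Seq (increment 19) (Seq (increment 17)
      (If (Defs.Sub (Var 0) (Var 17)) Skip
        (Seq (Assign 17 (Const 0)) (increment 16)))))))).

Definition PushPaths : prog :=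
  Seq (Assign 15 (Const 0)) (Seq (Assign 16 (Const 0)) (Seq (Assign 17 (Const 0))
  (Seq (Assign 18 (Const 0)) (Seq (Assign 19 (Const 0))
  (While (Defs.Sub (Var 4) (Var 15)) (Seq PushPath NextPath)))))).

Lemma iota0S k : iota 0 k.+1 = rcons (iota 0 k) k.
Proof. by rewrite -addn1 iotaD cats1. Qed.

Section Tables.
Variables (n L : nat) (g : rel nat).

(** The last entry stores with each path vertex whether its path is attached. The adjacency test can
    then be an expression, without the product that a lookup in the matrix would need. *)
Definition attributes (v : vtx) : nat * nat * nat * nat * nat :=
  (vcode v, if v is VE i j _ then g i j : nat else 0).

Definition cells (m : memory) (p : nat) := (m 5 p, m 6 p, m 7 p, m 8 p, m 9 p).

Definition table (m : memory) (s : seq vtx) : Prop :=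
  m 12 0 = size s /\
  forall p, p < size s -> cells m p = attributes (nth (VP 0) s p) /\ m 10 p = p.

(** The expressions are evaluated in between the writes, hence the requirement that they keep their
    values when arrays 5 to 10 change. *)
Lemma table_push k a b c d m s v : table m s ->
  (forall m', unchanged [:: 5; 6; 7; 8; 9; 10] m m' ->
    (eval m' k, eval m' a, eval m' b, eval m' c, eval m' d) = attributes v) ->
  table (sem (PushVertex k a b c d) m) (rcons s v).
Proof.
move=> [x t] h; rewrite /=.
set m1 := update m 5 _ _; set m2 := update m1 6 _ _; set m3 := update m2 7 _ _.
set m4 := update m3 8 _ _; set m5 := update m4 9 _ _; set m6 := update m5 10 _ _.
have u0 : unchanged [:: 5; 6; 7; 8; 9; 10] m m by [].
have up m' b' j y : unchanged [:: 5; 6; 7; 8; 9; 10] m m' -> b' \in [:: 5; 6; 7; 8; 9; 10] ->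
    unchanged [:: 5; 6; 7; 8; 9; 10] m (update m' b' j y).
  move=> u bb a' i' na; rewrite update_array; first exact: u.
  by apply: contraNneq na => ->.
have u1 : unchanged [:: 5; 6; 7; 8; 9; 10] m m1 by exact: up.
have u2 : unchanged [:: 5; 6; 7; 8; 9; 10] m m2 by exact: up.
have u3 : unchanged [:: 5; 6; 7; 8; 9; 10] m m3 by exact: up.
have u4 : unchanged [:: 5; 6; 7; 8; 9; 10] m m4 by exact: up.
have u5 : unchanged [:: 5; 6; 7; 8; 9; 10] m m5 by exact: up.
have u6 : unchanged [:: 5; 6; 7; 8; 9; 10] m m6 by exact: up.
have e1 : eval m k = (attributes v).1.1.1.1 by rewrite -(h _ u0).
have e2 : eval m1 a = (attributes v).1.1.1.2 by rewrite -(h _ u1).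
have e3 : eval m2 b = (attributes v).1.1.2 by rewrite -(h _ u2).
have e4 : eval m3 c = (attributes v).1.2 by rewrite -(h _ u3).
have e5 : eval m4 d = (attributes v).2 by rewrite -(h _ u4).
have x' m' : unchanged [:: 5; 6; 7; 8; 9; 10] m m' -> m' 12 0 = size s.
  by move=> u; rewrite u.
have c1 p : m6 5 p = if p == size s then (attributes v).1.1.1.1 else m 5 p.
  by rewrite /m6 /m5 /m4 /m3 /m2 !update_array // /m1 update_cell e1 x'.
have c2 p : m6 6 p = if p == size s then (attributes v).1.1.1.2 else m 6 p.
  by rewrite /m6 /m5 /m4 /m3 !update_array // /m2 update_cell e2 x' // /m1 !update_array.
have c3 p : m6 7 p = if p == size s then (attributes v).1.1.2 else m 7 p.
  by rewrite /m6 /m5 /m4 !update_array // /m3 update_cell e3 x' // /m2 /m1 !update_array.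
have c4 p : m6 8 p = if p == size s then (attributes v).1.2 else m 8 p.
  by rewrite /m6 /m5 !update_array // /m4 update_cell e4 x' // /m3 /m2 /m1 !update_array.
have c5 p : m6 9 p = if p == size s then (attributes v).2 else m 9 p.
  by rewrite /m6 !update_array // /m5 update_cell e5 x' // /m4 /m3 /m2 /m1 !update_array.
have c6 p : m6 10 p = if p == size s then size s else m 10 p.
  by rewrite /m6 update_cell !x' // /m5 /m4 /m3 /m2 /m1 !update_array.
split; first by rewrite update_cell x' // size_rcons addn1.
move=> p; rewrite size_rcons ltnS leq_eqVlt nth_rcons /cells !update_array //.
rewrite c1 c2 c3 c4 c5 c6 => /orP[/eqP->|ps].
  by rewrite ltnn eqxx; case: (attributes v) => [[[[? ?] ?] ?] ?].
by rewrite ps (ltn_eqF ps); exact: t.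
Qed.

Lemma runs_PushBlock r b m s B (f : nat -> vtx) : table m s ->
  (forall m', unchanged (written (PushBlock r b)) m m' -> eval m' b = B) ->
  (forall i, i < B -> attributes (f i) = (r, i, 0, 0, 0)) ->
  runs (PushBlock r b) m (1 + (B * 9 + 1))
    (fun m' => table m' (s ++ [seq f i | i <- iota 0 B])).
Proof.
move=> t bB fr; apply: runs_seq_straight => //.
apply: (@runs_weaken _ _ (B * 9 + 1) _ (fun m' => m' 15 0 = B /\
  table m' (s ++ [seq f i | i <- iota 0 B]))) => // [|m' []//].
apply: (@runs_while _ _ B _ 8 (fun i m' => m' 15 0 = i /\
  table m' (s ++ [seq f k | k <- iota 0 i]))).
- by rewrite cats0 /= update_cell.
- move=> i m1 _ u [i1 _]; rewrite /= i1 bB // => a j h; rewrite u.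
    by rewrite /= update_array //; apply: contraNneq h => ->.
  by apply: contra h; rewrite /= !inE => ->; rewrite orbT.
- move=> i m1 iB u [i1 t1]; apply: runs_straight => //.
  split; first by rewrite /= update_cell !update_array //= i1 addn1.
  rewrite iota0S map_rcons -rcons_cat.
  have := @table_push (Const r) (Var 15) (Const 0) (Const 0) (Const 0) m1 _ (f i) t1.
  rewrite (fr i iB); set m2 := sem _ _ => H.
  have {H}[|h1 h2] := H; first by move=> m' u'; rewrite /= u' // i1.
  have e a j : a != 15 -> sem (Seq (PushVertex (Const r) (Var 15) (Const 0) (Const 0) (Const 0))
      (increment 15)) m1 a j = m2 a j.
    by move=> a15; rewrite -[sem _ _]/(sem (increment 15) m2) /= update_array.
  by split; [rewrite e | move=> p ps; rewrite /cells !e //; exact: h2].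
Qed.

(** The machine has no division: quotients and remainders are kept up to date like the digits of an
    odometer. *)
Lemma divn_modn_succ c d : 0 < d ->
  (c.+1 %/ d, c.+1 %% d) =
  if (c %% d).+1 < d then (c %/ d, (c %% d).+1) else ((c %/ d).+1, 0).
Proof.
move=> d0; have e : c.+1 = c %/ d * d + (c %% d).+1 by rewrite addnS -divn_eq.
case: ltnP => h; first by rewrite e divnMDl // modnMDl (divn_small h) (modn_small h) addn0.
have -> : c.+1 = (c %/ d).+1 * d + 0.
  by rewrite e mulSn; have := ltn_pmod c d0; lia.
by rewrite divnMDl // modnMDl div0n mod0n addn0.
Qed.

Lemma table_unchanged m m' s : (forall a j, a \in [:: 5; 6; 7; 8; 9; 10; 12] -> m' a j = m a j) ->
  table m s -> table m' s.
Proof.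
move=> u [t1 t2]; split; first by rewrite u.
by move=> p ps; rewrite /cells !u //; exact: t2.
Qed.

Definition graph_memory (m : memory) : Prop :=
  [/\ m 0 0 = n, m 3 0 = L, m 4 0 = n * n * L &
      forall i j, i < n -> j < n -> m 1 (i * n + j) = g i j].

Lemma graph_memory_unchanged m m' : (forall a j, a \in [:: 0; 1; 3; 4] -> m' a j = m a j) ->
  graph_memory m -> graph_memory m'.
Proof.
by move=> u [m0 m3 m4 m1]; split; rewrite ?u // => i j i_n jn; rewrite u // m1.
Qed.

Definition path_cells (c : nat) (m : memory) : Prop :=
  [/\ m 15 0 = c, m 16 0 = c %/ L %/ n, m 17 0 = c %/ L %% n, m 18 0 = c %% L &
      m 19 0 = c %/ L].

Lemma path_cells_next c m : 0 < n -> 0 < L -> graph_memory m -> path_cells c m ->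
  path_cells c.+1 (sem NextPath m).
Proof.
move=> n0 L0 [g0 g3 _ _] [e15 e16 e17 e18 e19]; rewrite /path_cells /NextPath.
have [d1 d2] := (divn_modn_succ c L0, divn_modn_succ (c %/ L) n0).
have eL : (m 3 0 - (m 18 0 + 1) != 0) = ((c %% L).+1 < L).
  by rewrite g3 e18 addn1 subn_eq0 -ltnNge.
have en : (m 0 0 - (m 17 0 + 1) != 0) = ((c %/ L %% n).+1 < n).
  by rewrite g0 e17 addn1 subn_eq0 -ltnNge.
rewrite /= ?(update_cell, update_array) //= ?(update_cell, update_array) //= eL.
case: ltnP d1 => _ [-> ->].
  by rewrite ?(update_cell, update_array) //= e15 e16 e17 e18 e19 !addn1.
rewrite ?(update_cell, update_array) //= ?(update_cell, update_array) //= en.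
case: ltnP d2 => _ [-> ->];
  by rewrite ?(update_cell, update_array) //= ?(update_cell, update_array) //= e15 e16 ?e17 e19 !addn1.
Qed.

Lemma runs_PushPaths m s : 0 < n -> 0 < L -> graph_memory m -> table m s ->
  runs PushPaths m (1 + (1 + (1 + (1 + (1 + (n * n * L * 17 + 1))))))
    (fun m' => table m' (s ++ [seq edge_path n L c | c <- iota 0 (n * n * L)])).
Proof.
move=> n0 L0 gm t; do 5 (apply: runs_seq_straight; first by []).
set m0 := sem _ _.
have gm0 : graph_memory m0.
  by apply: graph_memory_unchanged gm => a j h; rewrite /m0 !(@sem_kept [:: 0; 1; 3; 4]).
have t0 : table m0 s.
  by apply: table_unchanged t => a j h;
    rewrite /m0 !(@sem_kept [:: 5; 6; 7; 8; 9; 10; 12]).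
apply: (@runs_weaken _ _ (n * n * L * 17 + 1) _ (fun m' => path_cells (n * n * L) m' /\
  table m' (s ++ [seq edge_path n L c | c <- iota 0 (n * n * L)]))) => // [|m' []//].
apply: (@runs_while _ _ (n * n * L) _ 16 (fun c m' => path_cells c m' /\
  table m' (s ++ [seq edge_path n L c | c <- iota 0 c]))).
- by split; rewrite ?cats0 // /path_cells !div0n !mod0n.
- by move=> c m1 _ u [[c1 _ _ _ _] _]; rewrite /= c1 u //; case: gm0 => _ _ ->.
move=> c m1 cl u [pc t1].
have gm1 : graph_memory m1.
  by apply: graph_memory_unchanged gm0; exact: (unchanged_kept u).
apply: runs_straight => //; rewrite -[sem _ m1]/(sem NextPath (sem PushPath m1)).
have t2 : table (sem PushPath m1)
    (rcons (s ++ [seq edge_path n L c | c <- iota 0 c]) (edge_path n L c)).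
  case: pc => _ e16 e17 e18 e19; case: gm1 => _ _ _ g1.
  have i_n : c %/ L %/ n < n by rewrite ltn_divLR // ltn_divLR.
  have jn : c %/ L %% n < n by rewrite ltn_mod.
  apply: table_push t1 _ => m' u'; rewrite /= !u' // e16 e17 e18 e19.
  by rewrite [in m1 1 _](divn_eq (c %/ L) n) g1.
rewrite iota0S map_rcons -rcons_cat; split.
  apply: (path_cells_next n0 L0).
    by apply: graph_memory_unchanged gm1; exact: sem_kept.
  by case: pc => *; split; rewrite (@sem_kept [:: 15; 16; 17; 18; 19]).
by apply: table_unchanged t2; exact: sem_kept.
Qed.
End Tables.

Lemma runs_seq_unchanged c1 c2 m T1 T2 (P Q : memory -> Prop) :
  runs c1 m T1 P ->
  (forall m1, P m1 -> unchanged (written c1) m m1 -> runs c2 m1 T2 Q) ->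
  runs (Seq c1 c2) m (T1 + T2) Q.
Proof.
move=> r h; apply: runs_seq; apply: runs_weaken (runs_unchanged r) (leqnn _) _.
by move=> m1 [p u]; exact: h.
Qed.

(** The eight additions compute [9 * n], the number of inner vertices of a path. *)
Definition Setup : prog :=
  Seq (Assign 3 (iter 8 (Add (Var 0)) (Var 0)))
  (Seq (Multiply 14 0 0) (Seq (Multiply 4 14 3)
  (Seq (PushBlock 0 (Var 0)) (Seq (PushBlock 1 (Var 0))
  (Seq (PushBlock 2 (Var 0)) (Seq (PushBlock 3 (Var 0))
  (Seq (PushBlock 4 (Const 3)) (Seq (PushBlock 5 (Const 3))
  (Seq PushPaths (Assign 2 (Var 12))))))))))).

Definition setup_time (n : nat) : nat :=
  let block b := 1 + (b * 9 + 1) in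
  1 + (n * 3 + 3 + (n * n * 3 + 3 +
  (block n + (block n + (block n + (block n + (block 3 + (block 3 +
  (1 + (1 + (1 + (1 + (1 + (n * n * (9 * n) * 17 + 1))))) + 1))))))))).

Lemma runs_Setup n (g : rel nat) m : 0 < n -> m 0 0 = n -> m 12 0 = 0 ->
  (forall i j, i < n -> j < n -> m 1 (i * n + j) = g i j) ->
  runs Setup m (setup_time n) (fun m' =>
    [/\ table g m' (vertices n (9 * n)), graph_memory n (9 * n) g m' &
        m' 2 0 = size (vertices n (9 * n))]).
Proof.
move=> n0 m0 m12 mG; apply: runs_seq_straight => //.
set m1 := sem _ m.
have m1L : m1 3 0 = 9 * n by rewrite /m1 /= update_cell eqxx !m0; clear; lia.
have u1 : unchanged [:: 3] m m1 by exact: (@sem_unchanged (Assign 3 _)).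
apply: (runs_seq_unchanged (P := fun m' => m' 14 0 = n * n)) => [|m2 m2S u2].
  rewrite (_ : n * 3 + 3 = m1 0 0 * 3 + 3); last by rewrite u1 ?m0.
  by apply: runs_weaken (@runs_Multiply 14 0 0 m1 _ _ _ _ _) _ _ => // m'; rewrite u1 ?m0.
apply: (runs_seq_unchanged (P := fun m' => m' 4 0 = n * n * (9 * n))) => [|m3 m3T u3].
  rewrite (_ : n * n * 3 + 3 = m2 14 0 * 3 + 3); last by rewrite m2S.
  apply: runs_weaken (@runs_Multiply 4 14 3 m2 _ _ _ _ _) _ _ => // m'.
  by rewrite m2S u2 // m1L.
have gm : graph_memory n (9 * n) g m3.
  have e a j : a \in [:: 0; 1] -> m3 a j = m a j.
    rewrite !inE => /orP[]/eqP->; by rewrite u3 // u2 // u1.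
  split=> //; [by rewrite e | by rewrite u3 // u2 |].
  by move=> i j i_n jn; rewrite e // mG.
have t3 : table g m3 [::] by split=> //; rewrite u3 // u2 // u1.
clearbody m1; clear m1L u1 m2 m2S u2 m3T u3.
have step r b f B c T Q m' s : table g m' s -> graph_memory n (9 * n) g m' ->
    (forall m'', m'' 0 0 = n -> eval m'' b = B) ->
    (forall i, i < B -> attributes g (f i) = (r, i, 0, 0, 0)) ->
    (forall m'', table g m'' (s ++ [seq f i | i <- iota 0 B]) ->
      graph_memory n (9 * n) g m'' -> runs c m'' T Q) ->
    runs (Seq (PushBlock r b) c) m' ((1 + (B * 9 + 1)) + T) Q.
  move=> t gm' bB fr h; apply: runs_seq_unchanged.
    apply: (runs_PushBlock t (f := f)) fr => m'' u; apply: bB.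
    by rewrite u //; case: gm'.
  move=> m'' t' u; apply: h t' _.
  by apply: graph_memory_unchanged gm'; exact: (unchanged_kept u).
apply: (step 0 _ VP n) t3 gm _ _ _ => // m4 t4 gm4.
apply: (step 1 _ VV n) t4 gm4 _ _ _ => // m5 t5 gm5.
apply: (step 2 _ (VW false) n) t5 gm5 _ _ _ => // m6 t6 gm6.
apply: (step 3 _ (VW true) n) t6 gm6 _ _ _ => // m7 t7 gm7.
(* The inverse of [corner] on 0, 1 and 2. *)
pose X b i := VX b (if i is i'.+1 then Some (i' == 1) else None).
apply: (step 4 _ (X false) 3) t7 gm7 _ _ _ => [//|[|[|[|i]]]//|m8 t8 gm8].
apply: (step 5 _ (X true) 3) t8 gm8 _ _ _ => [//|[|[|[|i]]]//|m9 t9 gm9].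
apply: runs_seq_unchanged (runs_PushPaths n0 _ gm9 t9) _; first by rewrite muln_gt0.
move=> m10 t10 u10.
apply: runs_straight => //.
have {}t10 : table g m10 (vertices n (9 * n)).
  by move: t10; rewrite /= -!catA.
split.
- by apply: table_unchanged t10; exact: sem_kept.
- apply: (@graph_memory_unchanged n (9 * n) g m10) => [|]; first exact: sem_kept.
  by apply: graph_memory_unchanged gm9; exact: (unchanged_kept u10).
- by rewrite /= update_cell; case: t10.
Qed.

Lemma nat_of_bool_neq0 (b : bool) : (b != 0 :> nat) = b.
Proof. by case: b. Qed.

Lemma nat_of_bool_eq0 (b : bool) : (b == 0 :> nat) = ~~ b.
Proof. by case: b. Qed.

Lemma corner_inj : injective corner.
Proof. by move=> [[]|] [[]|]. Qed.

Lemma corner_eq0 o : (corner o == 0) = (o == None).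
Proof. by case: o. Qed.

(** The edges of [vadj] between vertices of different kinds, in one direction. *)
Definition MixedEdgeE (x y : nat) : expr :=
  let K z := Get 5 (Var z) in let A z := Get 6 (Var z) in
  let B z := Get 7 (Var z) in let C z := Get 8 (Var z) in let g z := Get 9 (Var z) in
  OrE (AndE (EqE (K x) (Const 1)) (AndE (EqE (K y) (Const 6)) (AndE (g y)
        (OrE (AndE (EqE (A x) (A y)) (EqE (C y) (Const 0)))
             (AndE (EqE (A x) (B y)) (EqE (Add (C y) (Const 1)) (Var 3)))))))
  (OrE (AndE (OrE (EqE (K x) (Const 2)) (EqE (K x) (Const 3)))
             (AndE (EqE (K y) (Const 1)) (EqE (A x) (A y))))
       (AndE (EqE (K x) (Add (K y) (Const 2)))
             (AndE (OrE (EqE (K y) (Const 2)) (EqE (K y) (Const 3))) (EqE (A x) (Const 0))))).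

Definition SameEdgeE (x y : nat) : expr :=
  let K z := Get 5 (Var z) in let A z := Get 6 (Var z) in
  let B z := Get 7 (Var z) in let C z := Get 8 (Var z) in
  AndE (EqE (K x) (K y))
    (OrE (AndE (EqE (K x) (Const 6)) (AndE (EqE (A x) (A y)) (AndE (EqE (B x) (B y))
           (OrE (EqE (Add (C x) (Const 1)) (C y)) (EqE (Add (C y) (Const 1)) (C x))))))
         (AndE (OrE (EqE (K x) (Const 4)) (EqE (K x) (Const 5))) (NotE (EqE (A x) (A y))))).

Definition EdgeE (x y : nat) : expr :=
  OrE (SameEdgeE x y) (OrE (MixedEdgeE x y) (MixedEdgeE y x)).

Lemma eval_EdgeE L g m x y v w :
  cells m (m x 0) = attributes g v -> cells m (m y 0) = attributes g w -> m 3 0 = L ->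
  eval m (EdgeE x y) = vadj L g v w.
Proof.
move=> cv cw mL; rewrite /EdgeE /SameEdgeE /MixedEdgeE.
rewrite !(eval_OrE, eval_AndE, eval_EqE, eval_NotE) !(nat_of_bool_neq0, nat_of_bool_eq0) /=.
rewrite mL; case: v cv => [i|i|[] i|[] o|i j k] [-> -> -> -> ->];
  case: w cw => [i'|i'|[] i'|[] o'|i' j' k'] [-> -> -> -> ->];
  congr nat_of_bool; rewrite /= ?nat_of_bool_neq0 ?(andbT, andbF, orbF, addn1) //.
all: by rewrite ?corner_eq0 ?(inj_eq corner_inj).
Qed.

(** Arrays 32 to 35 are what the shifted packing algorithm sees as arrays 0 to 3, so 33 is its
    adjacency matrix. Variable 17 runs through the row-major positions, which saves computing
    products. *)
Definition FillMatrix : prog :=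
  Seq (Assign 15 (Const 0)) (Seq (Assign 17 (Const 0))
  (While (Defs.Sub (Var 2) (Var 15))
    (Seq (Assign 16 (Const 0))
    (Seq (While (Defs.Sub (Var 2) (Var 16))
           (Seq (Set_ 33 (Var 17) (EdgeE 15 16)) (Seq (increment 17) (increment 16))))
         (increment 15))))).

Lemma runs_FillMatrix L g vs m :
  table g m vs -> m 2 0 = size vs -> m 3 0 = L -> (forall k, m 33 k = 0) ->
  runs FillMatrix m (1 + (1 + (size vs * (1 + ((size vs * 4 + 1) + 1)).+1 + 1)))
    (fun m' => forall k, m' 33 k = ((k < size vs * size vs) &&
      vadj L g (nth (VP 0) vs (k %/ size vs)) (nth (VP 0) vs (k %% size vs)))).
Proof.
set N := size vs; pose entry k := vadj L g (nth (VP 0) vs (k %/ N)) (nth (VP 0) vs (k %% N)).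
move=> t mN mL m33; do 2 (apply: runs_seq_straight; first by []).
set m0 := sem _ _.
apply: (@runs_weaken _ _ (N * (1 + ((N * 4 + 1) + 1)).+1 + 1) _ (fun m' =>
  [/\ m' 15 0 = N, m' 17 0 = N * N & forall k, m' 33 k = (k < N * N) && entry k])) => //;
  last by move=> m' [].
have keep (s : seq nat) m' : all (fun a => a \notin [:: 15; 17]) s ->
    all (fun a => a \notin [:: 16; 33; 17; 16; 15]) s ->
    unchanged [:: 16; 33; 17; 16; 15] m0 m' -> forall a j, a \in s -> m' a j = m a j.
  move=> s1 s2 u a j h; rewrite (unchanged_kept u s2) //.
  have /allP/(_ _ h) := s1; rewrite !inE !negb_or => /andP[a15 a17].
  by rewrite /m0 /= !update_array.
apply: (@runs_while _ _ N _ _ (fun x m' =>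
  [/\ m' 15 0 = x, m' 17 0 = x * N & forall k, m' 33 k = (k < x * N) && entry k])).
- by split=> // k; rewrite -[LHS]/(m 33 k) m33.
- by move=> x m1 _ u [e _ _]; rewrite /= e (keep [:: 2] _ _ _ u) // mN.
move=> x m1 xN u [e15 e17 e33].
apply: runs_seq_straight => //; apply: runs_then_straight => //.
set m2 := sem _ _.
have u2 : unchanged [:: 16; 33; 17; 16; 15] m0 m2.
  by move=> a j h; rewrite -u // /m2 sem_unchanged //; move: h; rewrite !inE => /norP[].
apply: (@runs_weaken _ _ (N * 4 + 1) _ (fun m' => [/\ m' 15 0 = x, m' 16 0 = N,
   m' 17 0 = x * N + N & forall k, m' 33 k = (k < x * N + N) && entry k])) => //; last first.
  move=> m' [f15 f16 f17 f33]; split; rewrite /= ?update_cell ?update_array //.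
  - by rewrite f15 addn1.
  - by rewrite f17 mulSnr.
  - by move=> k; rewrite f33 mulSnr.
apply: (@runs_while _ _ N _ 3 (fun y m' => [/\ m' 15 0 = x, m' 16 0 = y,
   m' 17 0 = x * N + y & forall k, m' 33 k = (k < x * N + y) && entry k])).
- by split; rewrite ?addn0 // => k; rewrite -[LHS]/(m1 33 k) e33.
- move=> y m3 _ u3 [_ f16 _ _]; rewrite /= f16 u3 // -mN.
  by rewrite (keep [:: 2] m2).
move=> y m3 yN u3 [f15 f16 f17 f33]; apply: runs_straight => //.
have u3' : unchanged [:: 16; 33; 17; 16; 15] m0 m3.
  move=> a j h; rewrite u3 ?u2 //; apply: contra h.
  by rewrite !inE => /or3P[]->; rewrite ?orbT.
have kp := keep _ _ _ _ u3'.
have c3 p : p < N -> cells m3 p = attributes g (nth (VP 0) vs p).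
  by case: t => _ t pN; rewrite /cells !(kp [:: 5; 6; 7; 8; 9]) //; case: (t p pN).
have eE : eval m3 (EdgeE 15 16) = entry (x * N + y).
  rewrite (@eval_EdgeE L g m3 15 16 (nth (VP 0) vs x) (nth (VP 0) vs y)) ?f15 ?f16 ?c3 //.
    by rewrite /entry divnMDl ?modnMDl ?divn_small ?modn_small ?addn0 //; apply: leq_ltn_trans xN.
  by rewrite (kp [:: 3]).
rewrite -[sem _ m3]/(sem (Seq (increment 17) (increment 16)) (update m3 33 (m3 17 0) (eval m3 (EdgeE 15 16)))).
rewrite eE f17; split=> [|||k]; rewrite /= ?(update_cell, update_array) //=.
- by rewrite f16 addn1.
- by rewrite f17 addn1 addnS.
- case: eqP => [->|/eqP ne]; first by rewrite addnS ltnSn.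
  by rewrite f33 addnS ltnS (leq_eqVlt k) (negbTE ne).
Qed.

(** * Computing the contraction sequence *)

Section Names.
Variable T : eqType.

Fixpoint names (name : T -> nat) (w : nat) (ms : seq (T * T)) : T -> nat :=
  if ms is (x, y) :: ms' then names (renamed name y w) w.+1 ms' else name.

Lemma names_rcons name w ms x y :
  names name w (rcons ms (x, y)) = renamed (names name w ms) y (w + size ms).
Proof.
elim: ms name w => [|[a b] ms IH] name w /=; first by rewrite addn0.
by rewrite IH addSnnS.
Qed.

Lemma emit_rcons name w ms x y :
  emit name w (rcons ms (x, y)) =
  rcons (emit name w ms) (names name w ms x, names name w ms y).
Proof. by elim: ms name w => [|[a b] ms IH] name w //=; rewrite IH. Qed.

Lemma size_emit (name : T -> nat) w ms : size (emit name w ms) = size ms.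
Proof. by elim: ms name w => [|[a b] ms IH] name w //=; rewrite IH. Qed.
End Names.

(** Both names are read before array 10 changes. The new name is the number of vertices plus the
    number of earlier contractions, as [d_sequence] prescribes. *)
Definition Emit (x y : expr) : prog :=
  Seq (Set_ 34 (Var 11) (Get 10 x)) (Seq (Set_ 35 (Var 11) (Get 10 y))
  (Seq (Set_ 10 y (Add (Var 2) (Var 11))) (increment 11))).

Definition MinE (e1 e2 : expr) : expr := Defs.Sub e1 (Defs.Sub e1 e2).

Definition SpineE : expr :=
  let i := Get 6 (Var 15) in let j := Get 7 (Var 15) in let k := Get 8 (Var 15) in
  Add (MinE (Add i k) j) (Defs.Sub (Defs.Sub i k) j).

Definition EmitPaths : prog :=
  Seq (Assign 15 (Defs.Sub (Var 2) (Var 4))) (While (Defs.Sub (Var 2) (Var 15))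
    (Seq (Emit (Var 15) SpineE) (increment 15))).

Definition TimesE (k : nat) (e : expr) : expr := iter k (Add e) (Const 0).

Definition EmitRow (k : nat) : prog :=
  Emit (Add (TimesE k (Var 0)) (Var 15))
    (Add (TimesE k (Var 0)) (Add (Var 15) (Const 1))).

Definition EmitRows : prog :=
  Seq (Assign 15 (Const 0)) (While (Defs.Sub (Defs.Sub (Var 0) (Const 1)) (Var 15))
    (Seq (EmitRow 2) (Seq (EmitRow 3) (Seq (EmitRow 1) (Seq (EmitRow 0) (increment 15)))))).

(** The first four vertices of [chain] are the last ones of the first four blocks of [vertices],
    each block having [n] vertices; the hubs come right after these blocks. *)
Definition ChainE (k : nat) : expr :=
  if k < 4 then Defs.Sub (TimesE k.+1 (Var 0)) (Const 1)
  else Add (TimesE 4 (Var 0)) (Const (k - 4)).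

Definition EmitChain : prog :=
  foldr (fun k c => Seq (Emit (ChainE k) (ChainE k.+1)) c) Skip (iota 0 9).

Lemma eval_TimesE m k e : eval m (TimesE k e) = k * eval m e.
Proof. by elim: k => //= k ->; rewrite mulSn. Qed.

Section Emission.
Variables (n L : nat) (g : rel nat).
Hypotheses (n_gt0 : 0 < n) (n_L : n <= L).

Let vs := vertices n L.

Definition label (v : vtx) : nat := index v vs.

(** The pairs are prescribed at every [k], also past the end of the sequence, because the packing
    algorithm is entitled to find zeros there. *)
Definition emitted (m : memory) (ms : seq (vtx * vtx)) : Prop :=
  [/\ m 11 0 = size ms,
      forall k, (m 34 k, m 35 k) = nth (0, 0) (emit label (size vs) ms) k &
      forall v, v \in vs -> m 10 (label v) = names label (size vs) ms v].

Lemma emitted_step m ms ex ey x y : m 2 0 = size vs -> x \in vs -> y \in vs ->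
  (forall m', unchanged [:: 34; 35] m m' -> eval m' ex = label x /\ eval m' ey = label y) ->
  emitted m ms -> emitted (sem (Emit ex ey) m) (rcons ms (x, y)).
Proof.
move=> mN xv yv ev [m11 m34 m10]; rewrite /emitted emit_rcons names_rcons.
set m1 := update m 34 (m 11 0) (names label (size vs) ms x).
set m2 := update m1 35 (m 11 0) (names label (size vs) ms y).
set m3 := update m2 10 (label y) (size vs + m 11 0).
have u1 : unchanged [:: 34; 35] m m1.
  by move=> a j; rewrite !inE => /norP[h _]; rewrite /m1 update_array.
have u2 : unchanged [:: 34; 35] m m2.
  move=> a j h; rewrite /m2 update_array; first exact: u1.
  by move: h; rewrite !inE => /norP[].
have -> : sem (Emit ex ey) m = update m3 11 0 (m 11 0).+1.
  rewrite /=; have [-> _] := ev m (fun _ _ _ => erefl).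
  have [_ ey1] := ev m1 u1; have [_ ey2] := ev m2 u2.
  by rewrite m10 // -/m1 ey1 u1 // (u1 10) // m10 // -/m2 ey2 !u2 // mN addn1.
split.
- by rewrite size_rcons update_cell eqxx m11.
- move=> k; rewrite /m3 /m2 /m1 ?(update_cell, update_array) // nth_rcons size_emit m11.
  case: (ltngtP k (size ms)) => //= h; rewrite m34 //.
  by rewrite nth_default // size_emit ltnW.
- move=> v vv; rewrite update_array // /m3 update_cell /renamed m11.
  have -> : (label v == label y) = (v == y).
    apply/eqP/eqP => [e|-> //]; rewrite -(nth_index (VP 0) vv) -(nth_index (VP 0) yv).
    by congr nth.
  by case: eqP => // _; rewrite u2 // m10.
Qed.

Lemma label_nth p v : p < size vs -> nth (VP 0) vs p = v -> label v = p /\ v \in vs.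
Proof. by move=> pv <-; rewrite /label index_uniq ?uniq_vertices // mem_nth. Qed.

Lemma nth_drop_cat (s1 s2 : seq vtx) p k : size s1 = p -> nth (VP 0) (s1 ++ s2) (p + k) = nth (VP 0) s2 k.
Proof. by move=> <-; rewrite nth_cat ltnNge leq_addr /= addKn. Qed.

Lemma nth_block (f : nat -> vtx) i s : i < n ->
  nth (VP 0) ([seq f k | k <- iota 0 n] ++ s) i = f i.
Proof.
by move=> i_n; rewrite nth_cat size_map size_iota i_n (nth_map 0) ?size_iota ?nth_iota.
Qed.

Let size_block (f : nat -> vtx) : size [seq f k | k <- iota 0 n] = n.
Proof. by rewrite size_map size_iota. Qed.

Lemma label_VP i : i < n -> label (VP i) = i /\ VP i \in vs.
Proof.
move=> i_n; apply: label_nth; first by rewrite size_vertices; lia.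
exact: nth_block.
Qed.

Lemma label_VV i : i < n -> label (VV i) = n + i /\ VV i \in vs.
Proof.
move=> i_n; apply: label_nth; first by rewrite size_vertices; lia.
by rewrite nth_drop_cat // nth_block.
Qed.

Lemma label_VW b i : i < n -> label (VW b i) = (2 + b) * n + i /\ VW b i \in vs.
Proof.
move=> i_n; apply: label_nth; first by rewrite size_vertices; case: b; lia.
case: b.
  by rewrite (_ : _ + i = n + (n + (n + i))) ?nth_drop_cat ?nth_block //; lia.
by rewrite (_ : _ + i = n + (n + i)) ?nth_drop_cat ?nth_block //; lia.
Qed.

Lemma label_VX b o : label (VX b o) = 4 * n + (3 * b + corner o) /\ VX b o \in vs.
Proof.
apply: label_nth; first by rewrite size_vertices; case: b; case: o => [[]|] /=; lia.
rewrite (_ : 4 * n + _ = n + (n + (n + (n + (3 * b + corner o))))); last by lia.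
by do 4 (rewrite nth_drop_cat; last by []); case: b; case: o => [[]|].
Qed.

Lemma label_edge c : c < n * n * L ->
  label (edge_path n L c) = 4 * n + 6 + c /\ edge_path n L c \in vs.
Proof.
move=> cl; apply: label_nth; first by rewrite size_vertices; lia.
rewrite (_ : _ + c = n + (n + (n + (n + (3 + (3 + c)))))); last by lia.
by rewrite !nth_drop_cat // (nth_map 0) ?size_iota ?nth_iota.
Qed.

Lemma runs_Emit m ms ex ey x y c T Q : m 2 0 = size vs -> emitted m ms ->
  x \in vs -> y \in vs ->
  (forall m', unchanged [:: 34; 35] m m' -> eval m' ex = label x /\ eval m' ey = label y) ->
  (forall m', unchanged (written (Emit ex ey)) m m' -> emitted m' (rcons ms (x, y)) ->
    runs c m' T Q) ->
  runs (Seq (Emit ex ey) c) m (4 + T) Q.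
Proof.
move=> mN em xv yv ev h; apply: runs_seq_straight => //.
by apply: h; [exact: sem_unchanged | exact: emitted_step].
Qed.

Lemma runs_EmitPaths m : table g m vs -> m 2 0 = size vs -> m 4 0 = n * n * L ->
  emitted m [::] ->
  runs EmitPaths m (1 + (n * n * L * 6 + 1)) (fun m' => emitted m'
    (flatten [seq [:: (edge_path n L c, spine_of (edge_path n L c))] |
              c <- iota 0 (n * n * L)])).
Proof.
move=> t mN mT em; apply: runs_seq_straight => //; set m0 := sem _ _.
pose ms c := flatten [seq [:: (edge_path n L c, spine_of (edge_path n L c))] |
              c <- iota 0 c].
apply: (@runs_weaken _ _ (n * n * L * 6 + 1) _ (fun m' =>
  m' 15 0 = size vs - n * n * L + n * n * L /\ emitted m' (ms (n * n * L)))) => //; last by move=> m' [].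
apply: (@runs_while _ _ (n * n * L) _ 5 (fun c m' =>
  m' 15 0 = size vs - n * n * L + c /\ emitted m' (ms c))).
- split; first by rewrite /m0 /= update_cell eqxx mN mT addn0.
  by case: em => *; split=> // k; rewrite /m0 /= !update_array.
- move=> c m1 cl u [e _]; rewrite /= e u // [m0 2 0]mN size_vertices; lia.
move=> c m1 cl u [e15 em1].
have [lc vc] := label_edge cl.
have [L0 _] : 0 < L /\ 0 < n by split=> //; lia.
have i_n : c %/ L %/ n < n by rewrite ltn_divLR // ltn_divLR.
have jn : c %/ L %% n < n by rewrite ltn_mod.
have [lsp vsp] : label (spine_of (edge_path n L c)) =
    spine (c %/ L %/ n) (c %/ L %% n) (c %% L) /\ spine_of (edge_path n L c) \in vs.
  by apply: label_VP; rewrite /spine; lia.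
have msE : ms c.+1 = rcons (ms c) (edge_path n L c, spine_of (edge_path n L c)).
  by rewrite /ms iota0S map_rcons flatten_rcons cats1.
have e15' : m1 15 0 = label (edge_path n L c) by rewrite e15 lc size_vertices; lia.
rewrite (_ : 5 = 4 + 1) //; apply: (@runs_Emit _ (ms c) _ _ (edge_path n L c) (spine_of (edge_path n L c))) => //.
- by rewrite u // [m0 2 0]mN.
- move=> m' u'; split; first by rewrite /= u'.
  have cE : cells m1 (label (edge_path n L c)) = attributes g (edge_path n L c).
    have [_ /(_ (label (edge_path n L c)))[]] := t; first by rewrite index_mem.
    by rewrite nth_index // /cells !u.
  have [_ e6 e7 e8 _] := cE.
  rewrite lsp /= !u' // e15' e6 e7 e8 /spine; congr (_ + _).
  by rewrite /minn; case: ltnP; lia.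
move=> m' u' em'; apply: runs_straight => //; split.
  by rewrite /= update_cell eqxx u' // e15 -addnA addn1.
by rewrite msE; case: em' => *; split=> // k; rewrite /= !update_array.
Qed.

Definition row (b : nat) (q : nat) : vtx :=
  match b with 0 => VP q | 1 => VV q | 2 => VW false q | _ => VW true q end.

Lemma label_row b q : b < 4 -> q < n -> label (row b q) = b * n + q /\ row b q \in vs.
Proof.
move: b => [|[|[|[|]]]] //= _ qn.
- exact: label_VP.
- by rewrite mul1n; exact: label_VV.
- exact: label_VW.
- exact: label_VW.
Qed.

Lemma runs_EmitRow b q m ms c T Q : b < 4 -> q.+1 < n ->
  m 0 0 = n -> m 2 0 = size vs -> m 15 0 = q -> emitted m ms ->
  (forall m', m' 0 0 = n -> m' 2 0 = size vs -> m' 15 0 = q ->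
    emitted m' (rcons ms (row b q, row b q.+1)) -> runs c m' T Q) ->
  runs (Seq (EmitRow b) c) m (4 + T) Q.
Proof.
move=> b4 qn m0 m2 m15 em h.
have [l1 v1] := label_row b4 (ltnW qn); have [l2 v2] := label_row b4 qn.
apply: (runs_Emit m2 em v1 v2) => [m' u|m' u em'].
  by rewrite l1 l2 /= !eval_TimesE /= !u // m0 m15 addn1.
by apply: h; rewrite ?u.
Qed.

Lemma runs_EmitRows m ms : m 0 0 = n -> m 2 0 = size vs -> emitted m ms ->
  runs EmitRows m (1 + (n.-1 * 18 + 1)) (fun m' => emitted m'
    (ms ++ flatten [seq merge_rows q | q <- iota 0 n.-1])).
Proof.
move=> m0 mN em; apply: runs_seq_straight => //; set m1 := sem _ _.
apply: (@runs_weaken _ _ (n.-1 * 18 + 1) _ (fun m' => m' 15 0 = n.-1 /\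
  emitted m' (ms ++ flatten [seq merge_rows q | q <- iota 0 n.-1]))) => //; last by move=> m' [].
apply: (@runs_while _ _ n.-1 _ 17 (fun k m' => m' 15 0 = k /\
  emitted m' (ms ++ flatten [seq merge_rows q | q <- iota 0 k]))).
- by rewrite cats0; split=> //; case: em => *; split=> // k; rewrite /m1 /= !update_array.
- by move=> k m2 _ u [e _]; rewrite /= e u // [m1 0 0]m0 subn1.
move=> q m2 qn u [e em2]; have qn1 : q.+1 < n by lia.
have m20 : m2 0 0 = n by rewrite u.
have m2N : m2 2 0 = size vs by rewrite u.
apply: (@runs_EmitRow 2 q) em2 _ => // m3 m30 m3N e3 em3.
apply: (@runs_EmitRow 3 q) em3 _ => // m4 m40 m4N e4 em4.
apply: (@runs_EmitRow 1 q) em4 _ => // m5 m50 m5N e5 em5.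
apply: (@runs_EmitRow 0 q) em5 _ => // m6 m60 m6N e6 em6.
apply: runs_straight => //; split; first by rewrite /= update_cell eqxx e6 addn1.
have -> : ms ++ flatten [seq merge_rows q0 | q0 <- iota 0 q.+1] =
    rcons (rcons (rcons (rcons (ms ++ flatten [seq merge_rows q0 | q0 <- iota 0 q])
      (row 2 q, row 2 q.+1)) (row 3 q, row 3 q.+1)) (row 1 q, row 1 q.+1)) (row 0 q, row 0 q.+1).
  by rewrite iota0S map_rcons flatten_rcons -!cats1 -!catA.
by case: em6 => *; split=> // k; rewrite /= !update_array.
Qed.

Lemma chain_label k : k < 10 -> nth (VP 0) (chain n) k \in vs /\
  forall m, m 0 0 = n -> eval m (ChainE k) = label (nth (VP 0) (chain n) k).
Proof.
have n1 : n.-1 < n by rewrite prednK.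
have [l0 v0] := label_VP n1; have [l1 v1] := label_VV n1.
have [l2 v2] := label_VW false n1; have [l3 v3] := label_VW true n1.
have lX := label_VX.
case: k => [|[|[|[|k]]]] k10; last first.
  move: k10 lX; move: k => [|[|[|[|[|[|//]]]]]] _ lX;
  (split; [exact: (lX _ _).2 | move=> m m0; rewrite /ChainE (lX _ _).1 /= ?m0; lia]).
all: split=> // m m0; rewrite /ChainE /= ?m0 ?l0 ?l1 ?l2 ?l3; lia.
Qed.

Lemma runs_EmitChain m ms : m 0 0 = n -> m 2 0 = size vs -> emitted m ms ->
  runs EmitChain m 37 (fun m' => emitted m' (ms ++
    flatten [seq [:: (nth (VP 0) (chain n) k, nth (VP 0) (chain n) k.+1)] | k <- iota 0 9])).
Proof.
pose step k := [:: (nth (VP 0) (chain n) k, nth (VP 0) (chain n) k.+1)].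
suff gen r k m' ms' : k + r = 9 -> m' 0 0 = n -> m' 2 0 = size vs -> emitted m' ms' ->
    runs (foldr (fun k c => Seq (Emit (ChainE k) (ChainE k.+1)) c) Skip (iota k r)) m' (r * 4 + 1)
      (fun m' => emitted m' (ms' ++ flatten [seq step k | k <- iota k r])).
  by exact: (gen 9 0 m ms).
elim: r k m' ms' => [|r IH] k {}m {}ms kr m0 mN em.
  by apply: runs_skip; rewrite cats0.
rewrite mulSn -addnA.
have k9 : k < 9 by lia.
have [v1 l1] := chain_label (ltnW k9); have [v2 l2] := @chain_label k.+1 k9.
apply: (runs_Emit mN em v1 v2) => [m' u|m' u em'].
  by rewrite l1 ?l2 ?u.
rewrite /= -cat_rcons; apply: IH; rewrite ?u //; lia.
Qed.

Definition EmitAll : prog := Seq EmitPaths (Seq EmitRows EmitChain).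

Lemma runs_EmitAll m : table g m vs -> graph_memory n L g m -> m 2 0 = size vs ->
  m 11 0 = 0 -> (forall k, m 34 k = 0) -> (forall k, m 35 k = 0) ->
  runs EmitAll m ((1 + (n * n * L * 6 + 1)) + ((1 + (n.-1 * 18 + 1)) + 37))
    (fun m' => forall k, (m' 34 k, m' 35 k) =
       nth (0, 0) (emit label (size vs) (contractions n L)) k).
Proof.
move=> t [m0 m3 m4 _] mN m11 m34 m35.
have em : emitted m [::].
  split=> // [k|v vv]; first by rewrite m34 m35 nth_nil.
  by have [_ /(_ (label v))[]] := t; rewrite ?index_mem.
apply: runs_seq_unchanged (runs_EmitPaths t mN m4 em) _ => m1 em1 u1.
apply: runs_seq_unchanged (runs_EmitRows _ _ em1) _; rewrite ?u1 // => m2 em2 u2.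
apply: runs_weaken (runs_EmitChain _ _ em2) _ _; rewrite ?u2 ?u1 //.
by move=> m' []; rewrite -catA.
Qed.

End Emission.

(** * Reading a path off a packing *)

Definition ForVertices (c : prog) : prog :=
  Seq (Assign 15 (Const 0)) (While (Defs.Sub (Var 2) (Var 15)) (Seq c (increment 15))).

Definition TestStart : prog :=
  If (AndE (Get 33 (Var 15)) (EqE (Get 5 (Var 15)) (Const 2)))
    (Assign 19 (Get 6 (Var 15))) Skip.

Definition Visit : prog :=
  Seq (Set_ 21 (Var 19) (Const 1)) (Seq (Set_ 1 (Var 22) (Var 19)) (increment 22)).

(** Variable 20 receives the next vertex plus one, so that 0 can mean that none has been found. *)
Definition TestNext : prog :=
  If (AndE (Get 33 (Var 15)) (AndE (EqE (Get 5 (Var 15)) (Const 6))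
       (EqE (Get 8 (Var 15)) (Const 0))))
    (If (AndE (EqE (Get 6 (Var 15)) (Var 19)) (NotE (Get 21 (Get 7 (Var 15)))))
       (Assign 20 (Add (Get 7 (Var 15)) (Const 1)))
       (If (AndE (EqE (Get 7 (Var 15)) (Var 19)) (NotE (Get 21 (Get 6 (Var 15)))))
          (Assign 20 (Add (Get 6 (Var 15)) (Const 1))) Skip))
    Skip.

Definition Advance : prog :=
  If (Var 20) (Seq (Assign 19 (Defs.Sub (Var 20) (Const 1))) Visit) Skip.

Definition Decode : prog :=
  Seq (ForVertices TestStart) (Seq Visit (Seq (Assign 16 (Var 0))
  (Seq (While (Var 16)
     (Seq (Assign 20 (Const 0)) (Seq (ForVertices TestNext)
     (Seq Advance
       (Assign 16 (Defs.Sub (Var 16) (Const 1)))))))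
  (Assign 0 (Var 22))))).

(** The vertex at position [k.-1] has at most two neighbours along [s], and the one before it is
    already among the first [k]. *)
Lemma consecutive_next s a b k : uniq s -> 0 < k <= size s ->
  consecutive s a b \/ consecutive s b a -> a = nth 0 s k.-1 -> b \notin take k s ->
  k < size s /\ b = nth 0 s k.
Proof.
move=> us /andP[k0 ks] cab ak bk.
have [q [qs h]] : exists q, q.+1 < size s /\
    (nth 0 s q = a /\ nth 0 s q.+1 = b \/ nth 0 s q = b /\ nth 0 s q.+1 = a).
  by case: cab => -[q [qs h]]; exists q; split=> //; case: h; tauto.
have kS : k.-1 < size s by rewrite prednK.
case: h => -[qa qb]; move/eqP: ak.
  rewrite -qa (nth_uniq 0 (ltnW qs) kS us) => /eqP qk.
  have qk1 : q.+1 = k by rewrite qk prednK.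
  by rewrite -qb qk1; split=> //; rewrite -qk1.
rewrite -qb (nth_uniq 0 qs kS us) => /eqP qk; case/negP: bk.
have qk1 : q < k by rewrite -(prednK k0) -qk ltnW.
by rewrite -qa -(@nth_take k _ 0 q) // mem_nth // size_take_min leq_min qk1 ltnW.
Qed.

Lemma cells_vcode g m p v : cells m p = attributes g v ->
  [/\ m 5 p = (vcode v).1.1.1, m 6 p = (vcode v).1.1.2, m 7 p = (vcode v).1.2 &
      m 8 p = (vcode v).2].
Proof. by rewrite /cells /attributes; case: (vcode v) => [[[? ?] ?] ?] [-> -> -> -> _]. Qed.

Section Decoding.
Variables (g : rel nat) (vs : seq vtx) (inS : pred vtx) (i : nat) (xs : seq nat).
Let s := i :: xs.
Hypothesis s_uniq : uniq s.
Hypothesis start_in : VW false i \in vs.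
Hypothesis startP : forall a, inS (VW false a) = (a == i).
Hypothesis edgeP : forall a b, inS (VE a b 0) -> consecutive s a b.
Hypothesis next_edge : forall q, q < size xs ->
  exists2 e, e \in vs /\ inS e & e = VE (nth 0 s q) (nth 0 s q.+1) 0 \/
                              e = VE (nth 0 s q.+1) (nth 0 s q) 0.

Definition readable (m : memory) : Prop :=
  [/\ m 2 0 = size vs,
      forall p, p < size vs -> cells m p = attributes g (nth (VP 0) vs p) &
      forall p, p < size vs -> (m 33 p != 0) = inS (nth (VP 0) vs p)].

Lemma readable_unchanged m m' :
  (forall a j, a \in [:: 2; 5; 6; 7; 8; 9; 33] -> m' a j = m a j) ->
  readable m -> readable m'.
Proof.
move=> u [m2 mc m33]; split; first by rewrite u.
  by move=> p pv; rewrite /cells !u //; exact: mc.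
by move=> p pv; rewrite u //; exact: m33.
Qed.

Lemma runs_ForVertices c m (Inv : nat -> memory -> Prop) : straight c ->
  all (fun a => a \notin written c) [:: 2; 15; 5; 6; 7; 8; 9; 33] -> readable m ->
  (forall k m1 m2, (forall a j, a != 15 -> m2 a j = m1 a j) -> Inv k m1 -> Inv k m2) ->
  Inv 0 m ->
  (forall k m1, k < size vs -> readable m1 -> m1 15 0 = k -> Inv k m1 ->
     Inv k.+1 (sem c m1)) ->
  runs (ForVertices c) m (1 + (size vs * (cost c + 1).+1 + 1)) (Inv (size vs)).
Proof.
move=> sc wc rm Iext I0 step; apply: runs_seq_straight => //; set m0 := sem _ _.
have rm0 : readable m0 by apply: readable_unchanged rm; exact: sem_kept.
apply: (@runs_weaken _ _ (size vs * (cost c + 1).+1 + 1) _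
  (fun m' => m' 15 0 = size vs /\ Inv (size vs) m')) => //; last by move=> m' [].
have wb : all (fun a => a \notin written (Seq c (increment 15))) [:: 2; 5; 6; 7; 8; 9; 33].
  apply/allP=> a ha; rewrite /= mem_cat negb_or inE; apply/andP; split.
    by move/allP: wc; apply; move: ha; rewrite !inE => /orP[->|->]; rewrite ?orbT.
  by apply: contraTneq ha => ->.
apply: (@runs_while _ _ (size vs) _ (cost c + 1) (fun k m' => m' 15 0 = k /\ Inv k m')).
- split; first by rewrite /m0 /= update_cell.
  by apply: Iext I0 => a j h; rewrite /m0 /= update_array.
- move=> k m1 _ u [e _]; rewrite /= e (unchanged_kept u wb) //.
  by case: rm0 => ->.
move=> k m1 ks u [e Ik]; apply: runs_straight; first by rewrite /= sc.
have rm1 : readable m1.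
  by apply: readable_unchanged rm0; exact: (unchanged_kept u wb).
rewrite -[sem _ m1]/(sem (increment 15) (sem c m1)); split.
  rewrite /= update_cell eqxx sem_unchanged ?e ?addn1 //.
  by move/allP: wc; apply.
by apply: Iext (step k m1 ks rm1 e Ik) => a j h; rewrite /= update_array.
Qed.

Lemma runs_FindStart m : readable m ->
  runs (ForVertices TestStart) m (1 + (size vs * 4 + 1)) (fun m' => m' 19 0 = i).
Proof.
move=> rm.
apply: (@runs_weaken _ _ (1 + (size vs * 4 + 1)) _
  (fun m' => VW false i \in take (size vs) vs -> m' 19 0 = i)) => //; last first.
  by move=> m'; rewrite take_size; apply.
apply: (@runs_ForVertices TestStart m (fun k m' => VW false i \in take k vs -> m' 19 0 = i)) => //.
- by move=> k m1 m2 e h /h <-; rewrite e.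
- by rewrite take0.
move=> k m1 ks [_ mc m33] m15 Ik; rewrite (take_nth (VP 0)) // mem_rcons inE.
rewrite /TestStart /sem -/sem eval_AndE nat_of_bool_neq0 eval_EqE nat_of_bool_neq0.
rewrite [eval m1 (Get 33 _)]/= [eval m1 (Get 5 _)]/= [eval m1 (Const _)]/= m15 m33 //.
have [-> e6 _ _] := cells_vcode (mc k ks).
set v := nth _ _ _ in e6 *.
case: (boolP (_ && _)) => [/andP[vS v2] _|h].
  move: vS v2 e6; case: v => [?|?|[] a|[] ?|? ? ?] //=; rewrite startP => /eqP-> _ e6.
  by rewrite update_cell m15 e6.
case/orP=> [/eqP ve|]; last exact: Ik.
by move: h; rewrite -ve startP eqxx.
Qed.

Definition visiting (k : nat) (m : memory) : Prop :=
  [/\ m 19 0 = nth 0 s k.-1, m 22 0 = k, forall q, q < k -> m 1 q = nth 0 s q &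
      forall a, m 21 a = (a \in take k s)].

Lemma visit k m : k < size s -> m 19 0 = nth 0 s k -> m 22 0 = k ->
  (forall q, q < k -> m 1 q = nth 0 s q) -> (forall a, m 21 a = (a \in take k s)) ->
  visiting k.+1 (sem Visit m).
Proof.
move=> ks m19 m22 m1 m21; split=> [||q|a]; rewrite [sem _ _]/= ?(update_cell, update_array) //=.
- by rewrite m22 addn1.
- rewrite ltnS leq_eqVlt m22 m19.
  by case: eqP => [->|_ /= /m1].
- rewrite m19 -[i :: take k xs]/(take k.+1 s) (take_nth 0) // mem_rcons inE.
  by rewrite m21; case: eqP.
Qed.

Definition hit (k : nat) (v : vtx) : bool :=
  if v is VE a b 0 then inS v && ((a == nth 0 s k.-1) && (b \notin take k s) ||
                                  (b == nth 0 s k.-1) && (a \notin take k s))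
  else false.

Lemma hit_next k : 0 < k <= size s -> has (hit k) vs = (k < size s).
Proof.
move=> hk; apply/hasP/idP => [[v _]|ks].
  case: v => // a b [|//] /= /andP[/edgeP ab] /orP[]/andP[/eqP e nt].
    by have [] := consecutive_next s_uniq hk (or_introl ab) e nt.
  by have [] := consecutive_next s_uniq hk (or_intror ab) e nt.
have nt : nth 0 s k \notin take k s.
  have := take_uniq k.+1 s_uniq; rewrite (take_nth 0) // rcons_uniq => /andP[] //.
have kx : k.-1 < size xs by move: ks hk; rewrite /s /=; lia.
have kk : k.-1.+1 = k by case/andP: hk => /prednK.
have [e [ev eS] ee] := next_edge kx; exists e => //.
move: eS; rewrite kk in ee; case: ee => -> /= ->; rewrite eqxx nt ?orbT //.
Qed.

(** The whole list is scanned without stopping at a hit. This is sound because by [consecutive_next]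
    all hits yield the same vertex. *)
Lemma runs_FindNext k m : readable m -> 0 < k <= size s -> visiting k m -> m 20 0 = 0 ->
  runs (ForVertices TestNext) m (1 + (size vs * 6 + 1)) (fun m' =>
    visiting k m' /\ m' 20 0 = if k < size s then (nth 0 s k).+1 else 0).
Proof.
move=> rm hk vm m20.
apply: (@runs_weaken _ _ (1 + (size vs * 6 + 1)) _ (fun m' => visiting k m' /\
    m' 20 0 = if has (hit k) (take (size vs) vs) then (nth 0 s k).+1 else 0)) => //; last first.
  by move=> m'; rewrite take_size hit_next.
apply: (@runs_ForVertices TestNext m (fun p m' => visiting k m' /\
    m' 20 0 = if has (hit k) (take p vs) then (nth 0 s k).+1 else 0)) => //.
- move=> p m1 m2 e [[v19 v22 v1 v21] v20]; split; last by rewrite e.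
  by split=> [||q qk|a]; rewrite e //; auto.
- by rewrite take0.
move=> p m1 ps [_ mc m33] m15 [vis m120].
have v' : visiting k (sem TestNext m1).
  by case: vis => *; split=> *; rewrite (@sem_kept [:: 19; 22; 1; 21]) //; auto.
split=> {v'}//; rewrite (take_nth (VP 0)) // has_rcons.
have [e5 e6 e7 e8] := cells_vcode (mc p ps); have {m33} := m33 p ps.
move: e5 e6 e7 e8; set v := nth _ _ _ => e5 e6 e7 e8 mS.
case: vis => v19 _ _ v21.
rewrite /TestNext /sem -/sem !(eval_AndE, eval_EqE, eval_NotE) !nat_of_bool_neq0.
rewrite /= m15 e5 e6 e7 e8 v19 !v21 mS !nat_of_bool_eq0.
clear ps mc e5 e6 e7 e8 mS.
case: v => [?|?|[] ?|[] ?|a b [|c]]; rewrite /= ?andbF //.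
case: (boolP (inS _)) => [/edgeP ab|_] //=.
case: ifP => [/andP[/eqP ea nb]|_] /=.
  have [_ <-] := consecutive_next s_uniq hk (or_introl ab) ea nb.
  by rewrite update_cell addn1.
case: ifP => [/andP[/eqP eb na]|_] //=.
have [_ <-] := consecutive_next s_uniq hk (or_intror ab) eb na.
by rewrite update_cell addn1.
Qed.

Lemma runs_Decode n m : size s <= n -> readable m -> m 0 0 = n -> m 22 0 = 0 ->
  (forall a, m 21 a = 0) ->
  runs Decode m (1 + (size vs * 4 + 1) +
    (3 + (1 + (n * (1 + (1 + (size vs * 6 + 1) + 6)).+1 + 1 + 1))))
    (fun m' => output_seq m' = s).
Proof.
move=> sn rm m0 m22 m21.
apply: runs_seq_unchanged (runs_FindStart rm) _ => m1 m1i u1.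
have rm1 : readable m1.
  by apply: readable_unchanged rm; exact: (unchanged_kept u1).
apply: runs_seq_straight => //; apply: runs_seq_straight => //.
have v1 : visiting 1 (sem Visit m1).
  by apply: visit => // [|a]; rewrite u1.
apply: runs_then_straight => //; set m2 := sem _ _.
have v2 : visiting 1 m2.
  by case: v1 => *; split=> *; rewrite /m2 (@sem_kept [:: 19; 22; 1; 21]) //; auto.
have rm2 : readable m2.
  apply: readable_unchanged rm1 => a j h; rewrite /m2.
  by rewrite !(@sem_kept [:: 2; 5; 6; 7; 8; 9; 33]).
have m2n : m2 16 0 = n.
  by rewrite /m2 /= update_cell eqxx !update_array // u1.
clearbody m2; clear v1 m1i u1 rm1 rm m0 m22 m21.
set T := 1 + (1 + (size vs * 6 + 1) + 6).
(* The number of vertices listed after [r] rounds. There are always [n] rounds, enough for any path;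
   once the path is exhausted the remaining rounds change nothing in [visiting]. *)
pose k r := minn r.+1 (size s).
apply: (@runs_weaken _ _ (n * T.+1 + 1) _ (fun m' => m' 16 0 = n - n /\ visiting (k n) m')) => //;
    last first.
  move=> m' [_ [_ e22 e1 _]]; rewrite /output_seq /= update_cell eqxx e22.
  have kn : k n = size s by rewrite /k; lia.
  rewrite kn.
  rewrite -[RHS](mkseq_nth 0); apply/eq_in_map => q; rewrite mem_iota => /= qs.
  by rewrite update_array // e1 // kn.
apply: (@runs_while _ _ n _ T (fun r m' => m' 16 0 = n - r /\ visiting (k r) m')).
- by rewrite subn0 (_ : k 0 = 1) // /k /s /=; lia.
- by move=> r m3 _ _ [].
move=> r m3 rn u [e16 v3].
have rm3 : readable m3 by apply: readable_unchanged rm2; exact: (unchanged_kept u).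
have hk : 0 < k r <= size s by rewrite /k /=; lia.
apply: runs_seq_straight => //; set m4 := sem _ m3.
have v4 : visiting (k r) m4.
  by case: v3 => *; split=> *; rewrite /m4 (@sem_kept [:: 19; 22; 1; 21]) //; auto.
have rm4 : readable m4 by apply: readable_unchanged rm3; exact: sem_kept.
have m4e : m4 16 0 = n - r by rewrite /m4 (@sem_kept [:: 16]).
have m420 : m4 20 0 = 0 by rewrite /m4 /= update_cell.
apply: runs_seq_unchanged (runs_FindNext rm4 hk v4 m420) _ => m5 [v5 m520] u5.
have m5e : m5 16 0 = n - r by rewrite u5.
apply: runs_straight => //.
pose m6 := sem Advance m5; have v6 : visiting (k r.+1) m6.
  rewrite /m6 /Advance /sem -/sem [eval _ _]/= m520; case: ltnP => ks /=.
    have -> : k r.+1 = (k r).+1 by move: ks; rewrite /k; lia.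
    case: v5 => _ e22 e1 e21.
    by apply: visit => //; rewrite /= ?update_cell ?eqxx ?m520 ?ks ?subn1.
  by have -> : k r.+1 = k r by move: ks; rewrite /k; lia.
have m6e : m6 16 0 = n - r by rewrite /m6 (@sem_kept [:: 16]).
rewrite -[sem _ m5]/(sem (Assign 16 (Defs.Sub (Var 16) (Const 1))) m6); split.
  by rewrite /= update_cell eqxx m6e subn1 subnS.
by case: v6 => *; split=> *; rewrite (@sem_kept [:: 19; 22; 1; 21]) //; auto.
Qed.

End Decoding.

(** * The reduction *)

(** With the positive base [n.+1] exponents can be raised freely, which gives closure under sums and
    products without a special case at 0. [poly_boundedP] returns to the form in which running times
    are stated. *)
Definition poly_bounded (f : nat -> nat) : Prop :=
  exists k, forall n, f n <= k * n.+1 ^ k.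

Lemma poly_bounded_le f h : (forall n, f n <= h n) -> poly_bounded h -> poly_bounded f.
Proof. by move=> fh [k hk]; exists k => n; apply: leq_trans (hk n). Qed.

Lemma poly_bounded_const c : poly_bounded (fun=> c).
Proof. by exists c => n; rewrite -[leqLHS]muln1 leq_mul2l expn_gt0 orbT. Qed.

Lemma poly_bounded_id : poly_bounded id.
Proof. by exists 1 => n; rewrite mul1n expn1. Qed.

Lemma poly_bounded_add f h :
  poly_bounded f -> poly_bounded h -> poly_bounded (fun n => f n + h n).
Proof.
move=> [k fk] [l hl]; exists (k + l) => n; rewrite mulnDl; apply: leq_add.
  by apply: leq_trans (fk n) _; rewrite leq_mul2l leq_pexp2l ?orbT ?leq_addr.
by apply: leq_trans (hl n) _; rewrite leq_mul2l leq_pexp2l ?orbT ?leq_addl.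
Qed.

Lemma poly_bounded_mul f h :
  poly_bounded f -> poly_bounded h -> poly_bounded (fun n => f n * h n).
Proof.
move=> [k fk] [l hl]; exists (k * l + (k + l)) => n.
apply: leq_trans (leq_mul (fk n) (hl n)) _; rewrite mulnACA -expnD.
by apply: leq_mul; [exact: leq_addr | rewrite leq_pexp2l ?leq_addl].
Qed.

Lemma poly_bounded_exp f k : poly_bounded f -> poly_bounded (fun n => f n ^ k).
Proof.
move=> fb; elim: k => [|k IH]; first exact: poly_bounded_const.
apply: (@poly_bounded_le _ (fun n => f n * f n ^ k)); first by move=> n; rewrite expnS.
exact: poly_bounded_mul.
Qed.

Lemma poly_boundedP f : poly_bounded f -> exists k, forall n, f n <= k * n ^ k + k.
Proof.
(* The factor [2 ^ k] pays for replacing [n.+2] by [2 * n.+1]. *)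
move=> [k fk]; exists (k * 2 ^ k) => -[|n]; apply: leq_trans (fk _) _.
  by rewrite exp1n muln1 -[leqLHS]muln1; apply: leq_trans (leq_addl _ _); rewrite leq_mul2l expn_gt0 orbT.
apply: leq_trans (leq_addr _ _); rewrite -mulnA leq_mul2l; apply/orP; right.
apply: (@leq_trans (2 ^ k * n.+1 ^ k)).
  by rewrite -expnMn; case: (k) => // k'; rewrite leq_exp2r // mul2n -addnn; lia.
rewrite leq_mul2l leq_pexp2l ?orbT // -[leqLHS]muln1 leq_mul2l expn_gt0 orbT //.
Qed.

Section Ratio.
Local Open Scope ring_scope.

(** Squaring the ratio absorbs the additive constant [9], since [9 * n + 1] is at
    least [9] times the unsquared ratio. *)
Lemma ratio_transfer (R : realType) (eps : R) : 0 < eps ->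
  exists2 eps' : R, 0 < eps' & forall n l l' : nat, (l < n)%N ->
    (l * (9 * n).+1 + 9)%:R / (4 * n + 6 + n * n * (9 * n))%:R `^ eps' <=
      (l' * (9 * n).+1 + 9)%:R :> R ->
    l%:R / n%:R `^ eps <= l'%:R :> R.
Proof.
move=> eps0; pose d := Num.min eps 1.
(* The cap at 1 ensures [y <= n] below. The 14 is twice 7: the gadget has at most [n ^ 7] vertices,
   so its ratio with exponent [d / 14] is at most [y], the power of [n] with exponent [d / 2]. *)
have d0 : 0 < d by rewrite lt_min eps0 ltr01.
exists (d / 14%:R); first by rewrite divr_gt0.
move=> n l l' ln; set N := (4 * n + _ + _)%N; set M := (9 * n).+1.
case: l ln => [|l] ln h; first by rewrite mul0r.
have n2 : (2 <= n)%N by lia.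
have n1 : 1 <= n%:R :> R by rewrite ler1n; lia.
have n0 : 0 <= n%:R :> R by rewrite ler0n.
set y : R := n%:R `^ (d / 2%:R).
have y1 : 1 <= y by rewrite -[leLHS](powRr0 n%:R) ler_powR // divr_ge0 // ltW.
have yn : y <= n%:R.
  rewrite -[leRHS](powRr1 n0) ler_powR // ler_pdivrMr // mul1r.
  by apply: (@le_trans _ _ 1); rewrite ?ge_min ?lexx ?orbT // ler1n.
have yy : y * y <= n%:R `^ eps.
  rewrite /y -powRD; last by apply/implyP => _; rewrite pnatr_eq0; lia.
  by rewrite -splitr ler_powR // ge_min lexx.
have Nn : (N <= n ^ 7)%N.
  have h1 : (4 * n <= n ^ 3)%N by rewrite !expnS expn0; nia.
  have h2 : (6 <= n ^ 3)%N by rewrite !expnS expn0; nia.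
  have h3 : (16 <= n ^ 4)%N by apply: (@leq_trans (2 ^ 4)) => //; rewrite leq_exp2r.
  have h4 : (n * n * (9 * n) = 9 * n ^ 3)%N by rewrite !expnS expn0; lia.
  by rewrite /N h4 (expnD n 3 4); nia.
have N0 : (0 < N)%N by rewrite /N; lia.
have rpos : 0 < N%:R `^ (d / 14%:R) :> R by rewrite powR_gt0 // ltr0n.
have ry : N%:R `^ (d / 14%:R) <= y.
  have -> : y = (n ^ 7)%:R `^ (d / 14%:R).
    rewrite natrX -powR_mulrn // -powRrM; congr (_ `^ _).
    by field.
  by apply: ge0_ler_powR; rewrite ?nnegrE ?ler0n ?ler_nat ?divr_ge0 // ltW.
move: h; rewrite ler_pdivrMr // => h.
have {}h : (l.+1 * M + 9)%:R <= (l' * M + 9)%:R * y :> R.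
  by apply: le_trans h _; rewrite ler_wpM2l // ler0n.
have n_eps : 0 < n%:R `^ eps by rewrite powR_gt0 // (lt_le_trans ltr01 n1).
rewrite ler_pdivrMr //; apply: (@le_trans _ _ (l'%:R * (y * y))); last first.
  by rewrite ler_wpM2l // ler0n.
have M0 : 0 < M%:R :> R by rewrite ltr0n.
rewrite -(ler_pM2r M0).
have yM : 9%:R * y <= M%:R.
  by apply: (@le_trans _ _ (9%:R * n%:R)); [rewrite ler_wpM2l|rewrite -natrM ler_nat /M].
have l1 : 1 <= l.+1%:R :> R by rewrite ler1n.
have lM : 9%:R * y <= l.+1%:R * M%:R.
  by apply: le_trans yM _; rewrite -[leLHS]mul1r ler_wpM2r // ltW.
move: h; rewrite !natrD !natrM => h.
have hy : (l.+1%:R * M%:R + 9) * y <= (l'%:R * M%:R + 9) * y * y.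
  by rewrite ler_wpM2r // (le_trans ler01).
(* Multiplying [h] by [y] leaves exactly this product as the slack: with [a] and [q] as below, it
   equals [(a * q + 9) * y - 9 * y * y - a * q]. *)
have hp : 0 <= (y - 1) * (l.+1%:R * M%:R - 9 * y) by apply: mulr_ge0; rewrite subr_ge0.
move: hy hp; set a := l.+1%:R; set b := l'%:R; set q := M%:R; move=> hy hp.
have -> : b * (y * y) * q = (b * q + 9) * y * y - 9 * y * y by ring.
rewrite -subr_ge0; apply: le_trans hp _; rewrite -subr_ge0.
apply: le_trans (_ : 0 <= (b * q + 9) * y * y - (a * q + 9) * y) _; first by rewrite subr_ge0.
by rewrite le_eqVlt; apply/orP; left; apply/eqP; ring.
Qed.

End Ratio.

Lemma edivn_inj n i j i' j' : j < n -> j' < n -> i * n + j = i' * n + j' ->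
  i = i' /\ j = j'.
Proof.
move=> jn jn' e; have n0 : 0 < n by case: n jn {jn' e}.
have := congr1 (divn^~ n) e; have := congr1 (modn^~ n) e.
by rewrite !modnMDl !divnMDl // !modn_small // !divn_small // !addn0.
Qed.

Lemma graph_input_cell n (G : sgraph 'I_n) i j : i < n -> j < n ->
  graph_input G 1 (i * n + j) = graph_black G i j.
Proof.
move=> i_n jn; congr nat_of_bool; apply/existsP/existsP => -[i' /existsP[j']].
  case/andP=> /eqP e ij; have [-> ->] := edivn_inj jn (ltn_ord j') e.
  by exists i'; apply/existsP; exists j'; rewrite !eqxx.
case/and3P=> /eqP-> /eqP-> ij.
by exists i'; apply/existsP; exists j'; rewrite eqxx.
Qed.

Lemma graph_input_matrix N (G : sgraph 'I_N) (e : rel nat) k :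
  (forall i j, G i j = e i j) ->
  graph_input G 1 k = (k < N * N) && e (k %/ N) (k %% N).
Proof.
move=> Ge; congr nat_of_bool; apply/existsP/andP => [[i /existsP[j /andP[/eqP-> ij]]]|[kN ij]].
  have N0 : 0 < N by apply: leq_ltn_trans (ltn_ord i).
  rewrite divnMDl // modnMDl (divn_small (ltn_ord j)) (modn_small (ltn_ord j)) addn0 -Ge.
  by split=> //; have := ltn_ord i; have := ltn_ord j; nia.
have N0 : 0 < N by case: N kN {G Ge ij}.
have i_N : k %/ N < N by rewrite ltn_divLR.
exists (Ordinal i_N); apply/existsP; exists (Ordinal (ltn_pmod k N0)).
by rewrite -divn_eq eqxx Ge.
Qed.

Lemma lift_seq n (s : seq nat) : all (gtn n) s -> exists s' : seq 'I_n, map val s' = s.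
Proof.
elim: s => [|x s IH] /=; first by exists [::].
by case/andP=> xn /IH[s' <-]; exists (Ordinal xn :: s').
Qed.

(** * The complete program and its correctness *)

Definition Reduction (c : prog) : prog :=
  Seq Setup (Seq (Assign 32 (Var 2)) (Seq FillMatrix (Seq EmitAll (Seq (shift 32 c) Decode)))).

Section Reduction.
Variables (n : nat) (G : sgraph 'I_n).
Hypothesis n_gt0 : 0 < n.

Let g := graph_black G.
Let L := 9 * n.
Let vs := vertices n L.
Let N := size vs.

Let g_sym : symmetric g. Proof. exact: graph_black_sym. Qed.
Let g_irr : irreflexive g. Proof. exact: graph_black_irr. Qed.
Let L_gt0 : 0 < L. Proof. by rewrite muln_gt0. Qed.
Let n_L : n <= L. Proof. by rewrite /L leq_pmull. Qed.

Let gadget_vtx (i : 'I_N) : vtx := nth (VP 0) vs i.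

Let gadget_rel : rel 'I_N := fun i j => vadj L g (gadget_vtx i) (gadget_vtx j).

Lemma gadget_sym : symmetric gadget_rel.
Proof. by move=> i j; exact: vadj_sym. Qed.

Lemma gadget_irr : irreflexive gadget_rel.
Proof. by move=> i; exact: vadj_irr. Qed.

Definition gadget : sgraph 'I_N := SGraph gadget_sym gadget_irr.

Definition gadget_seq : seq (nat * nat) := emit (label n L) N (contractions n L).

Lemma gadget_vtx_valid i : valid n L (gadget_vtx i).
Proof. by rewrite -mem_vertices mem_nth. Qed.

Lemma gadget_vtx_inj : injective gadget_vtx.
Proof.
by move=> i j /eqP; rewrite nth_uniq ?uniq_vertices // => /eqP/val_inj.
Qed.

Lemma gadget_vtx_onto v : valid n L v -> exists i, gadget_vtx i = v.
Proof.
rewrite -mem_vertices => vv.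
have iN : index v vs < N by rewrite index_mem.
by exists (Ordinal iN); rewrite /gadget_vtx nth_index.
Qed.

Lemma gadget_d_sequence : d_sequence 4 gadget gadget_seq.
Proof.
apply: (contractions_d_sequence (dec := gadget_vtx)) => //.
- exact: gadget_vtx_valid.
- exact: gadget_vtx_onto.
- exact: gadget_vtx_inj.
- by move=> i; rewrite /label /gadget_vtx index_uniq ?uniq_vertices.
Qed.

Definition reduction_time (t : nat) : nat :=
  setup_time n + (1 + ((1 + (1 + (N * (1 + ((N * 4 + 1) + 1)).+1 + 1))) +
  (((1 + (n * n * L * 6 + 1)) + ((1 + (n.-1 * 18 + 1)) + 37)) + (t +
  (1 + (N * 4 + 1) + (3 + (1 + (n * (1 + (1 + (N * 6 + 1) + 6)).+1 + 1 + 1)))))))).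

Lemma runs_Reduction c t m' i xs p :
  exec c (graph_seq_input gadget gadget_seq) t m' ->
  route L g i xs p -> uniq (i :: xs) -> all (gtn n) (i :: xs) ->
  (forall x, (x \in output_set N m') = is_corner (gadget_vtx x) ||
    (gadget_vtx x \in [:: VX false None, VW false i, VV i & p])) ->
  runs (Reduction c) (graph_input G) (reduction_time t)
    (fun m => output_seq m = i :: xs).
Proof.
move=> ex r us xn mem; rewrite /reduction_time; set m0 := graph_input G.
apply: runs_seq_unchanged.
  apply: (@runs_Setup n g m0) => // a b an bn.
  by rewrite /m0 graph_input_cell.
move=> m1 [t1 gm1 mN1] u1; apply: runs_seq_straight => //; set m2 := sem _ _.
have u2 a j : a != 32 -> m2 a j = m1 a j by move=> h; rewrite /m2 /= update_array.
have t2 : table g m2 vs.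
  by apply: table_unchanged t1 => a j h; apply: u2; apply: contraTneq h => ->.
have gm2 : graph_memory n L g m2.
  by apply: graph_memory_unchanged gm1 => a j h; apply: u2; apply: contraTneq h => ->.
have mN2 : m2 2 0 = N by rewrite u2.
apply: runs_seq_unchanged.
  apply: (runs_FillMatrix (L := L) t2 mN2) => [|k]; first by case: gm2.
  by rewrite u2 // u1.
move=> m3 m33 u3.
have t3 : table g m3 vs by apply: table_unchanged t2; exact: (unchanged_kept u3).
have gm3 : graph_memory n L g m3.
  by apply: graph_memory_unchanged gm2; exact: (unchanged_kept u3).
have mN3 : m3 2 0 = N by rewrite u3.
have z3 a j : a \in [:: 11; 34; 35] -> m3 a j = 0.
  by rewrite !inE => /or3P[]/eqP->; rewrite u3 // u2 // u1.
apply: runs_seq_unchanged.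
  by apply: (runs_EmitAll n_gt0 n_L t3 gm3 mN3) => *; rewrite z3.
move=> m4 m4E u4.
have e4 a j : a \notin written Setup -> a != 32 -> a \notin written FillMatrix ->
    a \notin written EmitAll -> m4 a j = m0 a j.
  by move=> a1 a2 a3 a4; rewrite u4 // u3 // u2 // u1.
have sh : shifted 32 (graph_seq_input gadget gadget_seq) m4.
  move=> [|[|[|[|a]]]] k.
  - by rewrite u4 // u3 // /m2 /= update_cell; case: eqP => // _; rewrite u1.
  - rewrite u4 // m33; symmetry.
    exact: (@graph_input_matrix _ gadget
      (fun a b => vadj L g (nth (VP 0) vs a) (nth (VP 0) vs b))).
  - by rewrite [RHS]/= -[nth _ _ k](m4E k).
  - by rewrite [RHS]/= -[nth _ _ k](m4E k).
  - by rewrite e4.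
have [M [exM shM uM]] := shift_exec ex sh.
apply: runs_seq; exists t, M; split=> //.
have [r_VW r_path] : (VW false i \notin p) /\ path g i xs.
  by split; [exact: route_VW r | exact: route_path r].
pose inS v := is_corner v || (v \in [:: VX false None, VW false i, VV i & p]).
apply: (@runs_Decode g vs inS) => //.
- rewrite mem_vertices /=; by case/andP: xn.
- move=> a; rewrite /inS [is_corner _]/= orFb !inE (negbTE (route_VW a r)) orbF.
  apply/or3P/eqP => [[/eqP//|/eqP[]|/eqP]|->] //; by constructor 2.
- move=> a b; rewrite /inS /= !inE /=; exact: (route_consecutive r).
- move=> q qs; have xq : nth 0 (i :: xs) q < n /\ nth 0 (i :: xs) q.+1 < n.
    by split; apply: (allP xn); apply: mem_nth; rewrite /= ltnS // ltnW.
  have := consecutive_route L_gt0 r qs; case/orP=> ep.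
    exists (VE (nth 0 (i :: xs) q) (nth 0 (i :: xs) q.+1) 0); last by left.
    by rewrite mem_vertices /= L_gt0 !(xq.1, xq.2) /inS !inE /= ep.
  exists (VE (nth 0 (i :: xs) q.+1) (nth 0 (i :: xs) q) 0); last by right.
  by rewrite mem_vertices /= L_gt0 !(xq.1, xq.2) /inS !inE /= ep.
- rewrite -(size_iota 0 n); apply: uniq_leq_size => // x xi.
  by rewrite mem_iota; exact: (allP xn).
- split.
  + by rewrite uM // u4.
  + move=> q qs; have [_ /(_ q qs)[<- _]] := t3; rewrite /cells !uM // !u4 //.
  (* The decoder reads the computed packing in place: array 33 is the output array 1 of the shifted
     algorithm. *)
  + move=> q qs; have := mem (Ordinal qs); rewrite [X in X = _]inE => e; rewrite -[RHS]e.
    by rewrite -[33]/(32 + 1) shM.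
- by rewrite uM // e4.
- by rewrite uM // e4.
- by move=> a; rewrite uM // e4.
Qed.
End Reduction.

Lemma poly_bounded_succ f : poly_bounded f -> poly_bounded (fun n => (f n).+1).
Proof.
move=> fb; apply: (@poly_bounded_le _ (fun n => f n + 1)); first by move=> n; rewrite addn1.
exact: (poly_bounded_add fb (poly_bounded_const 1)).
Qed.

Lemma poly_bounded_pred f : poly_bounded f -> poly_bounded (fun n => (f n).-1).
Proof. by apply: poly_bounded_le => n; exact: leq_pred. Qed.

Ltac poly_bound := repeat first
  [ exact: poly_bounded_id | exact: poly_bounded_const | assumption
  | apply: poly_bounded_add | apply: poly_bounded_mul
  | apply: poly_bounded_succ | apply: poly_bounded_pred | apply: poly_bounded_exp ].

Lemma reduction_time_poly (k : nat) : poly_bounded (fun n =>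
  reduction_time n (k * size (vertices n (9 * n)) ^ k + k)).
Proof.
have vb : poly_bounded (fun n => size (vertices n (9 * n))).
  apply: (@poly_bounded_le _ (fun n => 4 * n + 6 + n * n * (9 * n))).
    by move=> n; rewrite size_vertices.
  by poly_bound.
by rewrite /reduction_time /setup_time; poly_bound.
Qed.

Local Open Scope ring_scope.

Theorem theorem7p3 (R : realType) :
  (forall eps : R, 0 < eps ->
     packing_approximable D_class 4 (fun n : nat => n%:R `^ eps)) ->
  forall eps : R, 0 < eps ->
    longest_path_approximable (fun n : nat => n%:R `^ eps).
Proof.
move=> approx eps eps0; have [e e0 transfer] := ratio_transfer eps0.
have [c [k0 cP]] := approx e e0.
have [k kP] := poly_boundedP (reduction_time_poly k0).
exists (Reduction c), k => n G n0.
have [t [m' [ex tk [feas opt]]]] := cP _ _ _ (gadget_d_sequence G n0).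
set N := size _ in m' ex tk feas opt; set S := output_set N m' in feas opt.
pose g := graph_black G; pose L := (9 * n)%N.
have g_sym : symmetric g by exact: graph_black_sym.
have g_irr : irreflexive g by exact: graph_black_irr.
have L0 : (0 < L)%N by rewrite muln_gt0.
pose dec (i : 'I_N) := nth (VP 0) (vertices n L) i.
have dec_inj : injective dec by exact: gadget_vtx_inj.
have dec_valid i : valid n L (dec i) by exact: gadget_vtx_valid.
have dec_onto v : valid n L v -> exists i, dec i = v by exact: gadget_vtx_onto.
have decG x y : gadget G x y = vadj L g (dec x) (dec y) by [].
have N0 : (0 < N)%N by rewrite /N size_vertices; lia.
(* Each path of [G] yields a feasible packing, so the output competes with all of them at once. *)
have optP i xs : all (gtn n) (i :: xs) -> uniq (i :: xs) -> path g i xs ->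
    (size xs * L.+1 + 9)%:R / N%:R `^ e <= #|S|%:R :> R.
  move=> xn us ps; have [S' [feas' <-]] :=
    path_packing L0 dec_onto decG xn us ps.
  exact: opt.
(* The path consisting of vertex 0 alone gives a packing of nine vertices, and the ratio is finite,
   so the output cannot be empty. *)
have S0 : S != set0.
  apply/eqP => SE; have := optP 0%N [::]; rewrite SE cards0 /= n0 => /(_ isT isT isT).
  by rewrite leNgt divr_gt0 // powR_gt0 // ltr0n.
have [a [xs [p [[r us xn _] [cardS memS]]]]] :=
  packing_route g_sym g_irr L0 dec_inj dec_valid dec_onto decG S0 feas.
have [t' [m [ex' tt' out]]] := runs_Reduction n0 ex r us xn memS.
have [s sE] := lift_seq xn.
exists t', m, s; split=> //.
- apply: leq_trans tt' _; apply: leq_trans (kP n).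
  by rewrite /reduction_time !leq_add2l leq_add2r.
- by rewrite out sE.
have sortedE (s' : seq 'I_n) : sorted G s' = sorted g (map val s').
  rewrite sorted_map; apply: eq_sorted => x y.
  apply/idP/existsP => [xy|[x' /existsP[y' /and3P[/eqP/val_inj-> /eqP/val_inj->]]] //].
  by exists x; apply/existsP; exists y; rewrite !eqxx.
split.
  split; first by case: (s) sE.
    by rewrite -(map_inj_uniq val_inj) sE.
  by rewrite sortedE sE; exact: route_path r.
move=> s' [s'0 us' ss'].
have -> : path_length s = size xs by rewrite /path_length -(size_map val) sE.
case: s' s'0 us' ss' => [//|x s'] _ us' ss'.
apply: transfer; first by have := max_card (mem (x :: s')); rewrite (card_uniqP us') card_ord.
rewrite -(size_vertices n (9 * n)) -cardS; have := optP (val x) (map val s'); rewrite size_map; apply.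
- by apply/allP=> _ /(@mapP _ _ _ (x :: s'))[y _ ->]; exact: ltn_ord.
- by rewrite -map_cons map_inj_uniq //; exact: val_inj.
- by have := sortedE (x :: s'); rewrite ss'.
Qed.
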